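(* Let $K$ be a field of characteristic $0$, let $Y_d=\{y_1,\ldots,y_d\}$, and let the vector space $KY_d$ with basis $Y_d$ be an $SL_2(K)$-module isomorphic to a direct sum $V_{p_1}\oplus\cdots\oplus V_{p_r}$, where $(p_1,\ldots,p_r)\neq(0,\ldots,0)$. Let $F_d=F_d(\mathfrak{A}^2)$ be the free metabelian Lie algebra over $K$ freely generated by $Y_d$, with the $SL_2(K)$-action induced from $KY_d$. Then the Lie algebra $F_d^{SL_2(K)}$ of $SL_2(K)$-invariants is finitely generated if and only if, as an $SL_2(K)$-module, $KY_d\cong V_1\oplus V_0\oplus\cdots\oplus V_0$ (with any number $\geq 0$ of summands $V_0$) or $KY_d\cong V_2$.
   Context: For $p\ge 0$, $V_p=S^p(K^2)$ is the $p$-th symmetric power of the canonical $2$-dimensional $SL_2(K)$-module $K^2$; it has dimension $p+1$, and $V_0=K$ is the trivial module. The free metabelian Lie algebra on $Y_d$ is $F_d=F_d(\mathfrak{A}^2)=L_d/L_d''$, where $L_d$ is the free Lie algebra over $K$ on $Y_d$ and $L_d''=[[L_d,L_d],[L_d,L_d]]$. A linear action of a group $G$ on $KY_d$ extends uniquely to an action by Lie algebra automorphisms of $F_d$, namely $g(f(y_1,\ldots,y_d))=f(g(y_1),\ldots,g(y_d))$; $F_d^G=\{f\in F_d\mid g(f)=f\text{ for all }g\in G\}$ is a Lie subalgebra of $F_d$. ''Finitely generated'' means finitely generated as a Lie algebra. *)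

(* Defs.v *)
From HB Require Import structures.
From mathcomp Require Import all_boot all_order all_algebra.
From mathcomp Require Import mpoly.
From mathcomp Require Import boolp classical_sets.

Set Implicit Arguments.
Unset Strict Implicit.
Unset Printing Implicit Defensive.

Import GRing.Theory.
Local Open Scope ring_scope.
Local Open Scope quotient_scope.

Definition linear_action (G : groupType) (K : fieldType) (V : lmodType K)
    (act : G -> V -> V) : Prop :=
  [/\ forall g, linear (act g),
      forall v, act 1%g v = v
    & forall g h v, act (g * h)%g v = act g (act h v)].

Structure gmodule (G : groupType) (K : fieldType) := GModule {
  gm_car :> lmodType K;
  gm_act : G -> gm_car -> gm_car;
  gm_actP : linear_action gm_act
}.

Definition gm_iso (G : groupType) (K : fieldType) (M N : gmodule G K) : Prop :=
  exists f : M -> N, [/\ linear f, bijective f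
    & forall g v, f (gm_act g v) = gm_act g (f v)].

Lemma gm0_actP (G : groupType) (K : fieldType) :
  linear_action (fun (_ : G) (v : 'rV[K]_0) => v).
Proof. by []. Qed.

Definition gm0 (G : groupType) (K : fieldType) : gmodule G K :=
  GModule (gm0_actP G K).

Lemma gm_sum_actP (G : groupType) (K : fieldType) (M N : gmodule G K) :
  linear_action (fun (g : G) (v : (M * N)%type) =>
    (gm_act g v.1, gm_act g v.2)).
Proof.
case: M N => M a [la a1 aM] [N b [lb b1 bM]].
split=> [g c x y|[x y]|g h [x y]] /=.
- by rewrite la lb.
- by rewrite a1 b1.
- by rewrite aM bM.
Qed.

Definition gm_sum (G : groupType) (K : fieldType) (M N : gmodule G K) :
  gmodule G K := GModule (gm_sum_actP M N).

Record SL2 (K : fieldType) :=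
  SL2Of { SL2_mx :> 'M[K]_2; SL2_det : \det SL2_mx == 1 }.

HB.instance Definition _ (K : fieldType) := [isSub for @SL2_mx K].
HB.instance Definition _ (K : fieldType) := [Choice of SL2 K by <:].

Section SL2Group.
Variable K : fieldType.
Implicit Types g h : SL2 K.

Fact SL2_one_subproof : \det (1%:M : 'M[K]_2) == 1.
Proof. by rewrite det1. Qed.

Fact SL2_mul_subproof g h : \det (SL2_mx g *m SL2_mx h) == 1.
Proof. by rewrite det_mulmx !(eqP (SL2_det _)) mulr1. Qed.

Fact SL2_inv_subproof g : \det (invmx (SL2_mx g)) == 1.
Proof. by rewrite det_inv (eqP (SL2_det _)) invr1. Qed.

Definition SL2_one := SL2Of SL2_one_subproof.
Definition SL2_mul g h := SL2Of (SL2_mul_subproof g h).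
Definition SL2_inv g := SL2Of (SL2_inv_subproof g).

Lemma SL2_unitmx g : SL2_mx g \in unitmx.
Proof. by rewrite unitmxE (eqP (SL2_det _)) unitr1. Qed.

Fact SL2_mulA : associative SL2_mul.
Proof. by move=> g h k; apply/val_inj; rewrite /= mulmxA. Qed.
Fact SL2_mul1 : left_id SL2_one SL2_mul.
Proof. by move=> g; apply/val_inj; rewrite /= mul1mx. Qed.
Fact SL2_mulr1 : right_id SL2_one SL2_mul.
Proof. by move=> g; apply/val_inj; rewrite /= mulmx1. Qed.
Fact SL2_mulV : left_inverse SL2_one SL2_inv SL2_mul.
Proof. by move=> g; apply/val_inj; rewrite /= mulVmx // SL2_unitmx. Qed.
Fact SL2_mulrV : right_inverse SL2_one SL2_inv SL2_mul.
Proof. by move=> g; apply/val_inj; rewrite /= mulmxV // SL2_unitmx. Qed.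
End SL2Group.

HB.instance Definition _ (K : fieldType) := isGroup.Build (SL2 K)
  (@SL2_mulA K) (@SL2_mul1 K) (@SL2_mulr1 K) (@SL2_mulV K) (@SL2_mulrV K).

(** S^p(K^2) is the degree p component of the symmetric algebra of K^2, i.e. of
    the polynomial ring in the canonical basis 'X_0, 'X_1 of K^2. A matrix g
    maps 'X_j to \sum_i g i j *: 'X_i and acts on polynomials by the
    corresponding substitution. *)
Section SymPow.
Variables (K : fieldType) (p : nat).
Implicit Types (g h : SL2 K) (f : dhomog 2 K p).

Definition SL2_var g : 2.-tuple {mpoly K[2]} :=
  [tuple \sum_(i < 2) SL2_mx g i j *: 'X_i | j < 2].

Lemma sym_act_homog g f : mpoly_of_dhomog f \mPo SL2_var g \is p.-homog.
Proof.
rewrite comp_mpolyEX big_seq rpred_sum // => m mf; apply: rpredZ.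
have <- := dhomog_mf (valP f) mf.
rewrite comp_mpolyX /= mdegE.
elim/big_ind2: _ => [|d q e r|i _].
- exact: dhomog1.
- exact: dhomogM.
- suff /(dhomogMn (m i)) : tnth (SL2_var g) i \is 1.-homog by rewrite mul1n.
  rewrite tnth_mktuple.
  by apply: rpred_sum => j _; apply: rpredZ; rewrite dhomogX /= mdeg1.
Qed.

Definition sym_act g f : dhomog 2 K p := DHomog (sym_act_homog g f).

Lemma SL2_var_comp g h (q : {mpoly K[2]}) :
  (q \mPo SL2_var h) \mPo SL2_var g = q \mPo SL2_var (SL2_mul g h).
Proof.
rewrite [q \mPo SL2_var h]comp_mpolyEX [RHS]comp_mpolyEX raddf_sum /=.
apply: eq_bigr => m _; rewrite comp_mpolyZ; congr (_ *: _).
rewrite !comp_mpolyX rmorph_prod /=; apply: eq_bigr => j _.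
rewrite rmorphXn /=; congr (_ ^+ _); rewrite !tnth_mktuple raddf_sum /=.
under eq_bigr => k _.
  rewrite comp_mpolyZ comp_mpolyXU -tnth_nth tnth_mktuple scaler_sumr; over.
rewrite exchange_big; apply: eq_bigr => i _ /=.
rewrite mxE scaler_suml; apply: eq_bigr => k _.
by rewrite scalerA mulrC.
Qed.

Lemma sym_actP : linear_action sym_act.
Proof.
split=> [g c f1 f2|f|g h f]; apply/val_inj.
- by rewrite /= linearP.
- rewrite /= -[RHS]comp_mpoly_id; congr comp_mpoly; apply: eq_from_tnth => j.
  rewrite !tnth_mktuple (bigD1 j) //= mxE eqxx scale1r big1 ?addr0 // => i ij.
  by rewrite mxE (negPf ij) scale0r.
- by rewrite /= SL2_var_comp.
Qed.

Definition sym_pow : gmodule (SL2 K) K := GModule sym_actP.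
End SymPow.

Definition sym_pow_sum (K : fieldType) (ps : seq nat) : gmodule (SL2 K) K :=
  foldr (fun p M => gm_sum (sym_pow K p) M) (gm0 (SL2 K) K) ps.

HB.mixin Record Lmodule_isLie (K : fieldType) L of GRing.Lmodule K L := {
  lbr : L -> L -> L;
  lbr_linearl : forall z, linear (lbr^~ z);
  lbr_linearr : forall z, linear (lbr z);
  lbrxx : forall x, lbr x x = 0;
  lbr_jacobi : forall x y z,
    lbr x (lbr y z) + lbr y (lbr z x) + lbr z (lbr x y) = 0
}.

#[short(type="lieAlgType")]
HB.structure Definition LieAlgebra (K : fieldType) :=
  { L of Lmodule_isLie K L & GRing.Lmodule K L }.

Inductive lin_span (K : fieldType) (V : lmodType K) (S : set V) : set V :=
| LinSpan0 : lin_span S 0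
| LinSpanP a u v : S u -> lin_span S v -> lin_span S (a *: u + v).

Inductive lie_span (K : fieldType) (L : lieAlgType K) (S : set L) : set L :=
| LieSpan_gen u : S u -> lie_span S u
| LieSpan0 : lie_span S 0
| LieSpanP a u v : lie_span S u -> lie_span S v -> lie_span S (a *: u + v)
| LieSpan_br u v : lie_span S u -> lie_span S v -> lie_span S (lbr u v).

Definition lie_fin_gen (K : fieldType) (L : lieAlgType K) (A : set L) : Prop :=
  exists s : seq L, A = lie_span [set` s]%classic.

Definition lie_comm (K : fieldType) (L : lieAlgType K) (A B : set L) : set L :=
  lin_span [set z | exists x y, [/\ A x, B y & z = lbr x y]]%classic.

Definition derived1 (K : fieldType) (L : lieAlgType K) : set L :=
  lie_comm setT setT.
Arguments derived1 {K} L _.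
Definition derived2 (K : fieldType) (L : lieAlgType K) : set L :=
  lie_comm (derived1 L) (derived1 L).
Arguments derived2 {K} L _.

(** The free Lie algebra is the set of formal Lie words modulo the least
    congruence satisfying the vector space and Lie algebra axioms. *)

Inductive lie_word (K : fieldType) (d : nat) :=
| LWvar of 'I_d
| LW0
| LWopp of lie_word K d
| LWadd of lie_word K d & lie_word K d
| LWscale of K & lie_word K d
| LWbr of lie_word K d & lie_word K d.

Arguments LWvar {K d}.
Arguments LW0 {K d}.

Inductive lie_cong (K : fieldType) (d : nat) :
    lie_word K d -> lie_word K d -> Prop :=
| LCrefl x : lie_cong x x
| LCsym x y : lie_cong x y -> lie_cong y x
| LCtrans y x z : lie_cong x y -> lie_cong y z -> lie_cong x z
| LCopp x x' : lie_cong x x' -> lie_cong (LWopp x) (LWopp x')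
| LCadd x x' y y' : lie_cong x x' -> lie_cong y y' ->
    lie_cong (LWadd x y) (LWadd x' y')
| LCscale a x x' : lie_cong x x' -> lie_cong (LWscale a x) (LWscale a x')
| LCbr x x' y y' : lie_cong x x' -> lie_cong y y' ->
    lie_cong (LWbr x y) (LWbr x' y')
| LCaddA x y z : lie_cong (LWadd x (LWadd y z)) (LWadd (LWadd x y) z)
| LCaddC x y : lie_cong (LWadd x y) (LWadd y x)
| LCadd0 x : lie_cong (LWadd LW0 x) x
| LCaddN x : lie_cong (LWadd (LWopp x) x) LW0
| LCscaleA a b x : lie_cong (LWscale a (LWscale b x)) (LWscale (a * b) x)
| LCscale1 x : lie_cong (LWscale 1 x) x
| LCscaleDr a x y :
    lie_cong (LWscale a (LWadd x y)) (LWadd (LWscale a x) (LWscale a y))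
| LCscaleDl a b x :
    lie_cong (LWscale (a + b) x) (LWadd (LWscale a x) (LWscale b x))
| LCbrl a x y z : lie_cong (LWbr (LWadd (LWscale a x) y) z)
    (LWadd (LWscale a (LWbr x z)) (LWbr y z))
| LCbrr a x y z : lie_cong (LWbr z (LWadd (LWscale a x) y))
    (LWadd (LWscale a (LWbr z x)) (LWbr z y))
| LCbrxx x : lie_cong (LWbr x x) LW0
| LCjacobi x y z : lie_cong
    (LWadd (LWadd (LWbr x (LWbr y z)) (LWbr y (LWbr z x))) (LWbr z (LWbr x y)))
    LW0.

HB.instance Definition _ (K : fieldType) (d : nat) :=
  gen_eqMixin (lie_word K d).
HB.instance Definition _ (K : fieldType) (d : nat) :=
  gen_choiceMixin (lie_word K d).

Section FreeLie.
Variables (K : fieldType) (d : nat).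
Local Notation W := (lie_word K d).

Definition lie_congb (x y : W) : bool := `[< lie_cong x y >].

Fact lie_congb_equiv : equiv_class_of lie_congb.
Proof.
split=> [x|x y|y x z].
- by apply/asboolP; exact: LCrefl.
- by apply/asboolP/asboolP; exact: LCsym.
- by move=> /asboolP xy /asboolP yz; apply/asboolP; exact: LCtrans xy yz.
Qed.

Canonical lie_congb_equivRel := EquivRelPack lie_congb_equiv.
Canonical lie_congb_encModRel := defaultEncModRel lie_congb.

Definition free_lie := {eq_quot lie_congb}.
HB.instance Definition _ := Choice.on free_lie.
HB.instance Definition _ : EqQuotient W lie_congb free_lie :=
  EqQuotient.on free_lie.

Local Notation cls := (\pi_free_lie : W -> free_lie).

Lemma free_lieP (x y : W) : cls x = cls y <-> lie_cong x y.
Proof.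
split=> [/eqP|xy]; first by rewrite piE => /asboolP.
by apply/eqP; rewrite piE; apply/asboolP.
Qed.

Lemma repr_free_lie (x : W) : lie_cong (repr (cls x)) x.
Proof. by apply/free_lieP; rewrite reprK. Qed.

Definition free_lie_gen (i : 'I_d) : free_lie := cls (LWvar i).
Definition fl_zero : free_lie := lift_cst free_lie LW0.
Definition fl_opp := lift_op1 free_lie (@LWopp K d).
Definition fl_add := lift_op2 free_lie (@LWadd K d).
Definition fl_scale (a : K) := lift_op1 free_lie (@LWscale K d a).
Definition fl_br := lift_op2 free_lie (@LWbr K d).

Lemma fl_zeroE : fl_zero = cls LW0.
Proof. by unlock fl_zero. Qed.
Lemma fl_oppE x : fl_opp (cls x) = cls (LWopp x).
Proof. by unlock fl_opp; apply/free_lieP/LCopp/repr_free_lie. Qed.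
Lemma fl_addE x y : fl_add (cls x) (cls y) = cls (LWadd x y).
Proof. by unlock fl_add; apply/free_lieP/LCadd; exact: repr_free_lie. Qed.
Lemma fl_scaleE a x : fl_scale a (cls x) = cls (LWscale a x).
Proof. by unlock fl_scale; apply/free_lieP/LCscale/repr_free_lie. Qed.
Lemma fl_brE x y : fl_br (cls x) (cls y) = cls (LWbr x y).
Proof. by unlock fl_br; apply/free_lieP/LCbr; exact: repr_free_lie. Qed.
Let flE := (fl_zeroE, fl_oppE, fl_addE, fl_scaleE, fl_brE).

Fact fl_addA : associative fl_add.
Proof.
by do 3!elim/quotW => ?; rewrite !flE; apply/free_lieP; exact: LCaddA.
Qed.
Fact fl_addC : commutative fl_add.
Proof.
by do 2!elim/quotW => ?; rewrite !flE; apply/free_lieP; exact: LCaddC.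
Qed.
Fact fl_add0 : left_id fl_zero fl_add.
Proof. by elim/quotW => ?; rewrite !flE; apply/free_lieP; exact: LCadd0. Qed.
Fact fl_addN : left_inverse fl_zero fl_opp fl_add.
Proof. by elim/quotW => ?; rewrite !flE; apply/free_lieP; exact: LCaddN. Qed.

HB.instance Definition _ :=
  GRing.isZmodule.Build free_lie fl_addA fl_addC fl_add0 fl_addN.

Fact fl_scaleA a b x : fl_scale a (fl_scale b x) = fl_scale (a * b) x.
Proof.
by elim/quotW: x => ?; rewrite !flE; apply/free_lieP; exact: LCscaleA.
Qed.
Fact fl_scale1 : left_id 1 fl_scale.
Proof. by elim/quotW => ?; rewrite !flE; apply/free_lieP; exact: LCscale1. Qed.
Fact fl_scaleDr : right_distributive fl_scale +%R.
Proof.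
move=> a; do 2!elim/quotW => ?; rewrite /GRing.add /= !flE.
by apply/free_lieP; exact: LCscaleDr.
Qed.
Fact fl_scaleDl x : {morph fl_scale^~ x : a b / a + b}.
Proof.
move=> a b; elim/quotW: x => ?; rewrite /= [RHS]/GRing.add /= !flE.
by apply/free_lieP; exact: LCscaleDl.
Qed.

HB.instance Definition _ := GRing.Zmodule_isLmodule.Build K free_lie
  fl_scaleA fl_scale1 fl_scaleDr fl_scaleDl.

Fact fl_brl z : linear (fl_br^~ z).
Proof.
move=> a; elim/quotW: z => ?; do 2!elim/quotW => ?.
rewrite /GRing.scale /GRing.add /= !flE; apply/free_lieP; exact: LCbrl.
Qed.
Fact fl_brr z : linear (fl_br z).
Proof.
move=> a; elim/quotW: z => ?; do 2!elim/quotW => ?.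
rewrite /GRing.scale /GRing.add /= !flE; apply/free_lieP; exact: LCbrr.
Qed.
Fact fl_brxx x : fl_br x x = 0.
Proof.
elim/quotW: x => ?; rewrite -[0]/fl_zero !flE; apply/free_lieP; exact: LCbrxx.
Qed.
Fact fl_jacobi x y z :
  fl_br x (fl_br y z) + fl_br y (fl_br z x) + fl_br z (fl_br x y) = 0.
Proof.
elim/quotW: x => ?; elim/quotW: y => ?; elim/quotW: z => ?.
by rewrite /GRing.add /= -[0]/fl_zero !flE; apply/free_lieP; exact: LCjacobi.
Qed.

HB.instance Definition _ := Lmodule_isLie.Build K free_lie
  fl_brl fl_brr fl_brxx fl_jacobi.

Lemma free_lie_piD x y : cls (LWadd x y) = cls x + cls y.
Proof. by rewrite -fl_addE. Qed.
Lemma free_lie_piZ a x : cls (LWscale a x) = a *: cls x.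
Proof. by rewrite -fl_scaleE. Qed.
Lemma free_lie_pi_br x y : cls (LWbr x y) = lbr (cls x) (cls y).
Proof. by rewrite -fl_brE. Qed.

End FreeLie.

Fixpoint lie_word_eval (K : fieldType) (d : nat) (A : lieAlgType K)
    (a : 'I_d -> A) (w : lie_word K d) : A :=
  match w with
  | LWvar i => a i
  | LW0 => 0
  | LWopp x => - lie_word_eval a x
  | LWadd x y => lie_word_eval a x + lie_word_eval a y
  | LWscale c x => c *: lie_word_eval a x
  | LWbr x y => lbr (lie_word_eval a x) (lie_word_eval a y)
  end.

Definition free_lie_eval (K : fieldType) (d : nat) (A : lieAlgType K)
    (a : 'I_d -> A) (x : free_lie K d) : A := lie_word_eval a (repr x).

Lemma lie_cong_eval (K : fieldType) (d : nat) (A : lieAlgType K)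
    (a : 'I_d -> A) (x y : lie_word K d) :
  lie_cong x y -> lie_word_eval a x = lie_word_eval a y.
Proof.
elim=> //=.
- by move=> {}x {}y z _ -> _ ->.
- by move=> {}x {}y _ ->.
- by move=> {}x {}y z t _ -> _ ->.
- by move=> c {}x {}y _ ->.
- by move=> {}x {}y z t _ -> _ ->.
- by move=> {}x {}y z; rewrite addrA.
- by move=> {}x {}y; rewrite addrC.
- by move=> {}x; rewrite add0r.
- by move=> {}x; rewrite addNr.
- by move=> c e {}x; rewrite scalerA.
- by move=> {}x; rewrite scale1r.
- by move=> c {}x {}y; rewrite scalerDr.
- by move=> c e {}x; rewrite scalerDl.
- by move=> c {}x {}y z; rewrite lbr_linearl.
- by move=> c {}x {}y z; rewrite lbr_linearr.
- by move=> {}x; rewrite lbrxx.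
- by move=> {}x {}y z; rewrite lbr_jacobi.
Qed.

Lemma free_lie_evalE (K : fieldType) (d : nat) (A : lieAlgType K)
    (a : 'I_d -> A) (w : lie_word K d) :
  free_lie_eval a (\pi_(free_lie K d) w) = lie_word_eval a w.
Proof. exact/lie_cong_eval/repr_free_lie. Qed.

Lemma free_lie_eval_gen (K : fieldType) (d : nat) (A : lieAlgType K)
    (a : 'I_d -> A) (i : 'I_d) :
  free_lie_eval a (free_lie_gen K i) = a i.
Proof. exact: free_lie_evalE. Qed.

Lemma free_lie_eval_linear (K : fieldType) (d : nat) (A : lieAlgType K)
    (a : 'I_d -> A) : linear (free_lie_eval a).
Proof.
move=> c; do 2!elim/quotW => ?.
by rewrite -free_lie_piZ -free_lie_piD !free_lie_evalE.
Qed.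

Lemma free_lie_eval_br (K : fieldType) (d : nat) (A : lieAlgType K)
    (a : 'I_d -> A) :
  {morph free_lie_eval a : x y / lbr x y}.
Proof.
by do 2!elim/quotW => ?; rewrite -free_lie_pi_br !free_lie_evalE.
Qed.

(** L / L'' with L'' = [[L, L], [L, L]] *)

Section Metabelianization.
Variables (K : fieldType) (L : lieAlgType K).

Definition metab_ideal : {pred L} := fun x => `[< derived2 L x >].

Lemma lin_span_lin (V : lmodType K) (S : set V) a u v :
  lin_span S u -> lin_span S v -> lin_span S (a *: u + v).
Proof.
move=> Su Sv; elim: Su => [|b x y Sx _ IH]; first by rewrite scaler0 add0r.
by rewrite scalerDr scalerA -addrA; exact: LinSpanP.
Qed.

Fact metab_ideal_submod : submod_closed metab_ideal.
Proof.
split=> [|a u v]; first by apply/asboolP; exact: LinSpan0.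
by move=> /asboolP Su /asboolP Sv; apply/asboolP; exact: lin_span_lin.
Qed.

HB.instance Definition _ :=
  GRing.isSubmodClosed.Build K L metab_ideal metab_ideal_submod.

Lemma lbrC (x y : L) : lbr x y = - lbr y x.
Proof.
have lD (u v w : L) : lbr (u + v) w = lbr u w + lbr v w.
  by rewrite -[u]scale1r lbr_linearl !scale1r.
have rD (u v w : L) : lbr w (u + v) = lbr w u + lbr w v.
  by rewrite -[u]scale1r lbr_linearr !scale1r.
apply/eqP; rewrite -addr_eq0; apply/eqP.
by have := lbrxx (x + y); rewrite lD !rD !lbrxx add0r addr0.
Qed.

Lemma derived1_br (x y : L) : derived1 L (lbr x y).
Proof.
rewrite -[lbr x y]scale1r -[X in derived1 L X]addr0.
by apply: LinSpanP; [exists x, y | exact: LinSpan0].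
Qed.

Lemma derived2_br (x y : L) :
  derived1 L x -> derived1 L y -> derived2 L (lbr x y).
Proof.
move=> dx dy; rewrite -[lbr x y]scale1r -[X in derived2 L X]addr0.
by apply: LinSpanP; [exists x, y | exact: LinSpan0].
Qed.

Lemma metab_ideal_brr (x y : L) :
  y \in metab_ideal -> lbr x y \in metab_ideal.
Proof.
move=> /asboolP; elim=> [|a u v [b [c [db dc ->]]] _ IH].
  by have := lbr_linearr x (-1) 0 0; rewrite !scaleN1r !addNr => ->; exact: rpred0.
rewrite lbr_linearr; apply: rpredD => //; apply: rpredZ.
have -> : lbr x (lbr b c) = - lbr b (lbr c x) - lbr c (lbr x b).
  by apply/eqP; rewrite -subr_eq0 opprD !opprK addrA; apply/eqP/lbr_jacobi.
apply: rpredD; rewrite rpredN; apply/asboolP; apply: derived2_br => //;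
  exact: derived1_br.
Qed.

Lemma metab_ideal_brl (x y : L) :
  x \in metab_ideal -> lbr x y \in metab_ideal.
Proof. by move=> mx; rewrite lbrC rpredN metab_ideal_brr. Qed.

Definition metab := Quotient.quot metab_ideal.
HB.instance Definition _ := GRing.Zmodule.on metab.
HB.instance Definition _ : EqQuotient L (Quotient.equiv metab_ideal) metab :=
  EqQuotient.on metab.

Local Notation cls := (\pi_metab : L -> metab).

Lemma metabP (x y : L) : cls x = cls y <-> x - y \in metab_ideal.
Proof. by rewrite Quotient.idealrBE; split=> [->|/eqP]. Qed.

Lemma repr_metab (x : L) : repr (cls x) - x \in metab_ideal.
Proof. by apply/metabP; rewrite reprK. Qed.

Definition mb_scale (a : K) := lift_op1 metab ( *:%R a).
Definition mb_br := lift_op2 metab (@lbr K L).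

Lemma mb_addE x y : cls x + cls y = cls (x + y).
Proof. by rewrite !piE. Qed.
Lemma mb_scaleE a x : mb_scale a (cls x) = cls (a *: x).
Proof.
by unlock mb_scale; apply/metabP; rewrite -scalerBr rpredZ // repr_metab.
Qed.
Lemma mb_brE x y : mb_br (cls x) (cls y) = cls (lbr x y).
Proof.
unlock mb_br; apply/metabP.
have lB (u v w : L) : lbr (u - v) w = lbr u w - lbr v w.
  by rewrite addrC -scaleN1r lbr_linearl scaleN1r addrC.
have rB (u v w : L) : lbr w (u - v) = lbr w u - lbr w v.
  by rewrite addrC -scaleN1r lbr_linearr scaleN1r addrC.
rewrite -[X in X - _](subrK (lbr x (repr (cls y)))) -addrA -lB -rB.
apply: rpredD; first exact/metab_ideal_brl/repr_metab.
exact/metab_ideal_brr/repr_metab.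
Qed.

Fact mb_scaleA a b x : mb_scale a (mb_scale b x) = mb_scale (a * b) x.
Proof. by elim/quotW: x => x; rewrite !mb_scaleE scalerA. Qed.
Fact mb_scale1 : left_id 1 mb_scale.
Proof. by elim/quotW=> x; rewrite mb_scaleE scale1r. Qed.
Fact mb_scaleDr : right_distributive mb_scale +%R.
Proof.
move=> a; do 2!elim/quotW=> ?.
by rewrite mb_addE !mb_scaleE mb_addE scalerDr.
Qed.
Fact mb_scaleDl x : {morph mb_scale^~ x : a b / a + b}.
Proof.
by move=> a b; elim/quotW: x => x; rewrite /= !mb_scaleE mb_addE scalerDl.
Qed.

HB.instance Definition _ := GRing.Zmodule_isLmodule.Build K metab
  mb_scaleA mb_scale1 mb_scaleDr mb_scaleDl.

Lemma metab_piD x y : cls (x + y) = cls x + cls y.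
Proof. by rewrite mb_addE. Qed.
Lemma metab_piZ a x : cls (a *: x) = a *: cls x.
Proof. by rewrite -mb_scaleE. Qed.

Fact mb_brl z : linear (mb_br^~ z).
Proof.
move=> a; elim/quotW: z => z; do 2!elim/quotW=> ?.
by rewrite -metab_piZ -metab_piD !mb_brE -metab_piZ -metab_piD lbr_linearl.
Qed.
Fact mb_brr z : linear (mb_br z).
Proof.
move=> a; elim/quotW: z => z; do 2!elim/quotW=> ?.
by rewrite -metab_piZ -metab_piD !mb_brE -metab_piZ -metab_piD lbr_linearr.
Qed.
Lemma metab_pi0 : cls 0 = 0.
Proof. by rewrite piE. Qed.
Fact mb_brxx x : mb_br x x = 0.
Proof. by elim/quotW: x => x; rewrite mb_brE lbrxx metab_pi0. Qed.
Fact mb_jacobi x y z :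
  mb_br x (mb_br y z) + mb_br y (mb_br z x) + mb_br z (mb_br x y) = 0.
Proof.
elim/quotW: x => x; elim/quotW: y => y; elim/quotW: z => z.
by rewrite !mb_brE -!metab_piD lbr_jacobi metab_pi0.
Qed.

HB.instance Definition _ := Lmodule_isLie.Build K metab
  mb_brl mb_brr mb_brxx mb_jacobi.

Lemma metab_pi_br x y : cls (lbr x y) = lbr (cls x) (cls y).
Proof. by rewrite -mb_brE. Qed.

End Metabelianization.

Definition free_metab (K : fieldType) (d : nat) : lieAlgType K :=
  metab (free_lie K d).

Definition free_metab_gen (K : fieldType) (d : nat) (i : 'I_d) :
  free_metab K d := \pi_(metab (free_lie K d)) (free_lie_gen K i).

(** [free_metab_eval a f] is f(a_1, ..., a_d), computed on a representative of
    f in L_d; it does not depend on that representative when A'' = 0. *)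
Definition free_metab_eval (K : fieldType) (d : nat) (A : lieAlgType K)
    (a : 'I_d -> A) (f : free_metab K d) : A := free_lie_eval a (repr f).

Definition metabelian (K : fieldType) (A : lieAlgType K) : Prop :=
  forall x y z t : A, lbr (lbr x y) (lbr z t) = 0.

Lemma free_metabP (K : fieldType) (d : nat) : metabelian (free_metab K d).
Proof.
elim/quotW=> x; elim/quotW=> y; elim/quotW=> z; elim/quotW=> t.
rewrite -!metab_pi_br -metab_pi0; apply/metabP; rewrite subr0.
by apply/asboolP/derived2_br; exact: derived1_br.
Qed.

Lemma free_lie_eval_derived2 (K : fieldType) (d : nat) (A : lieAlgType K)
    (a : 'I_d -> A) (x : free_lie K d) :
  metabelian A -> derived2 (free_lie K d) x -> free_lie_eval a x = 0.
Proof.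
have ev0 : free_lie_eval a 0 = 0.
  by have := free_lie_eval_linear a (-1) 0 0; rewrite !scaleN1r !addNr.
move=> mA; elim=> [//|c u v [y [z [dy dz ->]]] _ IH].
rewrite free_lie_eval_linear IH addr0 free_lie_eval_br.
have br0 (w : A) : lbr w 0 = 0.
  by have := lbr_linearr w (-1) 0 0; rewrite !scaleN1r !addNr.
have br0l (w : A) : lbr 0 w = 0 by rewrite lbrC br0 oppr0.
elim: dy => [|e b y' [y1 [y2 [_ _ ->]]] _ IHy].
  by rewrite ev0 br0l scaler0.
rewrite free_lie_eval_linear lbr_linearl scalerDr IHy addr0 free_lie_eval_br.
elim: dz => [|e' b' z' [z1 [z2 [_ _ ->]]] _ IHz].
  by rewrite ev0 br0 !scaler0.
rewrite free_lie_eval_linear lbr_linearr free_lie_eval_br mA scaler0 add0r.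
exact: IHz.
Qed.

Section FreeMetabEval.
Variables (K : fieldType) (d : nat) (A : lieAlgType K) (a : 'I_d -> A).
Hypothesis mA : metabelian A.

Lemma free_metab_evalE (x : free_lie K d) :
  free_metab_eval a (\pi_(metab (free_lie K d)) x) = free_lie_eval a x.
Proof.
have /asboolP/(free_lie_eval_derived2 a mA) := repr_metab x.
rewrite addrC -scaleN1r free_lie_eval_linear scaleN1r addrC.
by move/eqP; rewrite subr_eq0 => /eqP.
Qed.

Lemma free_metab_eval_gen (i : 'I_d) :
  free_metab_eval a (free_metab_gen K i) = a i.
Proof. by rewrite free_metab_evalE free_lie_eval_gen. Qed.

Lemma free_metab_eval_linear : linear (free_metab_eval a).
Proof.
move=> c; do 2!elim/quotW=> ?.
by rewrite -metab_piZ -metab_piD !free_metab_evalE free_lie_eval_linear.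
Qed.

Lemma free_metab_eval_br : {morph free_metab_eval a : x y / lbr x y}.
Proof.
do 2!elim/quotW=> ?.
by rewrite -metab_pi_br !free_metab_evalE free_lie_eval_br.
Qed.

End FreeMetabEval.

(** K Y_d is identified with 'rV[K]_d, y_i being the i-th unit vector. *)
Definition free_metab_lin (K : fieldType) (d : nat) (v : 'rV[K]_d) :
  free_metab K d := \sum_(i < d) v 0 i *: free_metab_gen K i.

Definition free_metab_act (G : Type) (K : fieldType) (d : nat)
    (rho : G -> 'rV[K]_d -> 'rV[K]_d) (g : G) (f : free_metab K d) :
  free_metab K d :=
  free_metab_eval (fun i => free_metab_lin (rho g (delta_mx 0 i))) f.

Definition free_metab_inv (G : Type) (K : fieldType) (d : nat)
    (rho : G -> 'rV[K]_d -> 'rV[K]_d) : set (free_metab K d) :=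
  [set f | forall g, free_metab_act rho g f = f]%classic.

(* Main.v *)
(** A free metabelian Lie algebra F_d embeds in the abelian wreath product: an
    element is sent to its tuple of Fox derivatives w in K[Y_d]^d, and (in
    characteristic 0, by contracting the Koszul complex with the Euler operator)
    the image consists of all w such that \sum_i y_i w_i is a linear form. This
    is equivariant, so F_d^G becomes the space of equivariant polynomial vector
    fields w : V^* -> V satisfying that equation.

    Brackets of elements of F_d^G do not raise the degree along a curve on which
    all linear invariants are constant. Multiplying one nonzero w in F_d' by the
    powers of a nonconstant polynomial invariant h does, so F_d^G is not finitely
    generated as soon as such w and h exist. If V contains V_p with p odd, w is
    the invariant symplectic form of V_p; if all p_i are even, w is
    E(h2) grad h1 - E(h1) grad h2 for two independent invariants, where E is the
    Euler operator. The invariants come from the invariant bilinear form on V_p,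
    from the determinant of the Hankel matrix of a form of even degree (its
    catalecticant), and from the discriminant of the transvectant (f, f)_(p-1) of
    a form f of odd degree.

    In the two remaining cases, evaluate w on orbits. For V_1 + V_0 + .. + V_0
    transitivity of SL_2 on K^2 \ 0 makes w a combination, with coefficients
    depending only on the trivial summands, of the symplectic form of V_1 and of
    vector fields on the trivial part. For V_2 the torus forces w to vanish on the
    orbits of the multiples of xy, which are dense, so F_d^G = 0. *)
From HB Require Import structures.
Require Import Defs.
From mathcomp Require Import all_boot all_order all_algebra.
From mathcomp Require Import ssrcomplements mpoly ring zify.
From mathcomp Require Import boolp classical_sets.

Set Implicit Arguments.
Unset Strict Implicit.
Unset Printing Implicit Defensive.

Import GRing.Theory.
Local Open Scope ring_scope.
Local Open Scope quotient_scope.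

(** * Free metabelian Lie algebras as modules *)

Section LieBasics.
Variables (K : fieldType) (L : lieAlgType K).
Implicit Types x y z : L.

HB.instance Definition _ z :=
  GRing.isLinear.Build K L L _ (lbr z) (lbr_linearr z).

Definition lbrl z x := lbr x z.
HB.instance Definition _ z :=
  GRing.isLinear.Build K L L _ (lbrl z) (lbr_linearl z).

Lemma lbrDl x y z : lbr (x + y) z = lbr x z + lbr y z.
Proof. exact: (raddfD (lbrl z)). Qed.
Lemma lbrZl a x z : lbr (a *: x) z = a *: lbr x z.
Proof. exact: (linearZ_LR (lbrl z)). Qed.
Lemma lbr_suml (I : Type) (r : seq I) (P : pred I) (F : I -> L) z :
  lbr (\sum_(i <- r | P i) F i) z = \sum_(i <- r | P i) lbr (F i) z.
Proof. exact: (raddf_sum (lbrl z)). Qed.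

Lemma lbr_leibniz x y z : lbr x (lbr y z) = lbr (lbr x y) z + lbr y (lbr x z).
Proof.
have := lbr_jacobi x y z; rewrite (lbrC z x) raddfN /= (lbrC z (lbr x y)).
by move/eqP; rewrite -addrA -opprD subr_eq0 => /eqP ->; rewrite addrC.
Qed.

End LieBasics.

(** * Linear extension from monomials and induction on monomials *)

Section MonomialExtension.
Variables (n : nat) (K : fieldType) (V : lmodType K) (F : 'X_{1..n} -> V).
Implicit Types p q : {mpoly K[n]}.

Definition mlift p : V := \sum_(m <- msupp p) p@_m *: F m.

(** The sum over the support becomes a sum over an index set that depends only on a degree bound, so
    that linearity can be checked on one index set common to several polynomials. *)
Lemma mliftwE k p : (msize p <= k)%N ->
  mlift p = \sum_(m : 'X_{1..n < k}) p@_m *: F m.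
Proof.
move=> lt_pk; rewrite (bigID (fun m : 'X_{1..n < k} => bmnm m \in msupp p)) /=.
rewrite addrC big1 ?add0r; last first.
  by move=> m /memN_msupp_eq0=> ->; rewrite scale0r.
rewrite /mlift (big_mksub 'X_{1..n < k}) //=; first exact/msupp_uniq.
by move=> m' /msize_mdeg_lt /leq_trans; apply.
Qed.

Fact mlift_linear : linear mlift.
Proof.
move=> a p q; pose k := maxn (msize (a *: p + q)) (maxn (msize p) (msize q)).
rewrite !(@mliftwE k) /k ?leq_maxl ?leq_maxr //; last first.
- by rewrite leq_max leq_max leqnn orbT.
- by rewrite leq_max leq_max leqnn orbT orbT.
rewrite scaler_sumr -big_split; apply: eq_bigr => m _ /=.
by rewrite mcoeffD mcoeffZ scalerDl scalerA.
Qed.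
HB.instance Definition _ :=
  GRing.isLinear.Build K {mpoly K[n]} V _ mlift mlift_linear.

Lemma mliftX m : mlift 'X_[m] = F m.
Proof. by rewrite /mlift msuppX big_seq1 mcoeffX eqxx scale1r. Qed.

End MonomialExtension.

Lemma mpoly_linear_ext (n : nat) (K : fieldType) (V : lmodType K)
    (f g : {mpoly K[n]} -> V) :
  linear f -> linear g -> (forall m, f 'X_[m] = g 'X_[m]) -> f =1 g.
Proof.
move=> lf lg fg.
have f0 : f 0 = 0 by have := lf (-1) 0 0; rewrite !scaleN1r !addNr.
have g0 : g 0 = 0 by have := lg (-1) 0 0; rewrite !scaleN1r !addNr.
by elim/mpolyind=> [|c m p _ _ IH]; [rewrite f0 g0 | rewrite lf lg fg IH].
Qed.

Lemma mnm_addU (n : nat) (m : 'X_{1..n}) i :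
  m i != 0%N -> m = (U_(i) + (m - U_(i)))%MM.
Proof. by move=> mi; rewrite addmC submK // lep1mP. Qed.

Lemma mnm_neq0 (n : nat) (m : 'X_{1..n}) :
  m != 0%MM -> exists i, m i != 0%N.
Proof.
move=> m0; apply/existsP; apply: contraNT m0; rewrite negb_exists => /forallP m0.
by apply/eqP/mnmP => i; rewrite mnm0E; apply/eqP; rewrite -[_ == _]negbK m0.
Qed.

Lemma mnm_ind (n : nat) (P : 'X_{1..n} -> Prop) :
  P 0%MM -> (forall i m, P m -> P (U_(i) + m)%MM) -> forall m, P m.
Proof.
move=> P0 PU m; have [k km] := ubnP (mdeg m); elim: k => // k IH in m km *.
have [->//|/mnm_neq0[i mi]] := eqVneq m 0%MM.
rewrite (mnm_addU mi); apply/PU/IH; move: km.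
by rewrite {1}(mnm_addU mi) mdegD mdeg1 add1n ltnS.
Qed.

(** * The commutator ideal as a module over K[Y_d] *)

Section FreeMetab.
Variables (K : fieldType) (d : nat).
Local Notation F := (free_metab K d).
Local Notation S := {mpoly K[d]}.
Local Notation y := (@free_metab_gen K d).
Implicit Types (f g u v : F) (q : S) (m : 'X_{1..d}).

Lemma free_metab_ind (P : F -> Prop) :
  P 0 -> (forall a f g, P f -> P g -> P (a *: f + g)) ->
  (forall i, P (y i)) -> (forall f g, P f -> P g -> P (lbr f g)) ->
  forall f, P f.
Proof.
move=> P0 Plin Pgen Pbr; elim/quotW=> x; elim/quotW: x.
pose cl (w : lie_word K d) : F :=
  \pi_(metab (free_lie K d)) (\pi_(free_lie K d) w).
rewrite -[forall x, _]/(forall w, P (cl w)).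
have PZ a f : P f -> P (a *: f) by move=> Pf; rewrite -[a *: f]addr0; apply: Plin.
have cl0 : cl LW0 = 0 by rewrite /cl -fl_zeroE; exact: metab_pi0.
have clZ a w : cl (LWscale a w) = a *: cl w by rewrite /cl free_lie_piZ metab_piZ.
have clD w w' : cl (LWadd w w') = cl w + cl w'.
  by rewrite /cl free_lie_piD metab_piD.
have clN w : cl (LWopp w) = - cl w.
  apply/eqP; rewrite -addr_eq0 -clD -cl0; apply/eqP; congr (\pi _).
  exact/free_lieP/LCaddN.
elim=> [i||w IH|w IHw w' IHw'|a w IH|w IHw w' IHw'].
- exact: Pgen.
- by rewrite cl0.
- by rewrite clN -scaleN1r; apply: PZ.
- by rewrite clD -[cl w]scale1r; apply: Plin.
- by rewrite clZ; apply: PZ.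
- by rewrite /cl free_lie_pi_br metab_pi_br; apply: Pbr.
Qed.

(** Stands in for membership in the commutator ideal: a single bracket remains one under every
    [lbr u], which suffices for the module structure below. *)
Definition is_br f := exists u v, f = lbr u v.

(** The two sides differ by [[u, v], f], a bracket of two commutators, which vanishes in a
    metabelian algebra. *)
Lemma lbr_comm u v f : is_br f -> lbr u (lbr v f) = lbr v (lbr u f).
Proof.
by case=> [x [z ->]]; rewrite lbr_leibniz (@free_metabP K d u v) add0r.
Qed.

Definition adm_seq m (s : seq 'I_d) f :=
  foldr (fun i g => iter (m i) (lbr (y i)) g) f s.
Definition adm m f := adm_seq m (enum 'I_d) f.
Definition pact f q := mlift (adm^~ f) q.
HB.instance Definition _ f := GRing.Linear.copy (pact f) (mlift (adm^~ f)).

Lemma adm_seq_br m s f : is_br f -> is_br (adm_seq m s f).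
Proof.
move=> fbr; elim: s => //= i s IH; elim: (m i) => //= k _.
by exists (y i); eexists.
Qed.

Lemma lbr_iter_comm i j k f : is_br f ->
  lbr (y i) (iter k (lbr (y j)) f) = iter k (lbr (y j)) (lbr (y i) f).
Proof.
move=> fbr; elim: k => //= k IH; rewrite lbr_comm ?IH //.
by case: k {IH} => //= k; exists (y j); eexists.
Qed.

Lemma adm_seqU m s i f : is_br f -> uniq s ->
  adm_seq (U_(i) + m)%MM s f =
  if i \in s then lbr (y i) (adm_seq m s f) else adm_seq m s f.
Proof.
move=> fbr; elim: s => //= j s IH /andP[js us]; rewrite inE IH //.
rewrite mnmDE mnm1E; case: (eqVneq i j) => [->|ij] /=.
  by rewrite (negPf js).
rewrite add0n; case: ifP => // _; rewrite lbr_iter_comm //.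
exact: adm_seq_br.
Qed.

Lemma admU m i f : is_br f -> adm (U_(i) + m)%MM f = lbr (y i) (adm m f).
Proof. by move=> fbr; rewrite /adm adm_seqU ?enum_uniq ?mem_enum. Qed.

Lemma adm0 f : adm 0%MM f = f.
Proof. by rewrite /adm; elim: (enum _) => //= i s ->; rewrite mnm0E. Qed.

Lemma pactXm m f : pact f 'X_[m] = adm m f.
Proof. exact: mliftX. Qed.

Lemma pact1 f : pact f 1 = f.
Proof. by rewrite -mpolyX0 pactXm adm0. Qed.

Lemma pactX i q f : is_br f -> pact f ('X_i * q) = lbr (y i) (pact f q).
Proof.
move=> fbr; move: q; apply: mpoly_linear_ext => [a p q|a p q|m].
- by rewrite mulrDr -scalerAr linearP.
- by rewrite !linearP.
- by rewrite -mpolyXD !pactXm admU.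
Qed.

Lemma pactDr q f g : pact (f + g) q = pact f q + pact g q.
Proof.
have itD k i : {morph iter k (@lbr K F (y i)) : u v / u + v}.
  by move=> u v; elim: k => //= k ->; rewrite raddfD.
rewrite /pact /mlift -big_split; apply: eq_bigr => m _ /=.
rewrite -scalerDr; congr (_ *: _); rewrite /adm.
by elim: (enum _) => //= i s ->; rewrite itD.
Qed.

Lemma pactNr q f : pact (- f) q = - pact f q.
Proof.
have pact_0 : pact 0 q = 0.
  by apply: (addrI (pact 0 q)); rewrite -pactDr !addr0.
by apply/eqP; rewrite -addr_eq0 -pactDr addNr pact_0.
Qed.

Lemma lbr_adm i m f : is_br f -> lbr (y i) (adm m f) = adm m (lbr (y i) f).
Proof.
move=> fbr; rewrite /adm; elim: (enum _) => //= j s <-.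
by rewrite lbr_iter_comm //; apply: adm_seq_br.
Qed.

Lemma lbr_pact i q f : is_br f -> lbr (y i) (pact f q) = pact (lbr (y i) f) q.
Proof.
move=> fbr; rewrite /pact /mlift raddf_sum; apply: eq_bigr => m _ /=.
by rewrite linearZ_LR /= lbr_adm.
Qed.

(** The Jacobi identity for y_i, y_k, y_l as a linear relation of the module; it collapses the sum
    in [magnus_inv_koszul]. *)
Lemma pact_jacobi q i k l :
  pact (lbr (y i) (y l)) ('X_k * q) - pact (lbr (y i) (y k)) ('X_l * q) =
  pact (lbr (y k) (y l)) ('X_i * q).
Proof.
have br f g : is_br (lbr f g) by exists f, g.
rewrite !pactX // !lbr_pact // -pactNr -pactDr; congr pact.
by rewrite [RHS]lbr_leibniz [lbr (lbr _ _) _]lbrC addrC.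
Qed.

End FreeMetab.

(** * The embedding into the wreath product *)

Section Euler.
Variables (n : nat) (K : fieldType).
Implicit Types p q : {mpoly K[n]}.

Lemma mderivU i j : ('X_j : {mpoly K[n]})^`M(i) = (j == i)%:R.
Proof.
rewrite mderivX mnm1E; case: eqVneq => [->|_]; last by rewrite scale0r.
by rewrite scale1r -[X in (X - _)%MM]add0m addmK mpolyX0.
Qed.

Definition mpoly_euler p := \sum_i 'X_i * p^`M(i).

Lemma mpoly_euler_linear : linear mpoly_euler.
Proof.
move=> a p q; rewrite /mpoly_euler scaler_sumr -big_split; apply: eq_bigr => i _.
by rewrite linearP mulrDr -scalerAr.
Qed.
HB.instance Definition _ :=
  GRing.isLinear.Build K _ _ _ mpoly_euler mpoly_euler_linear.

Lemma mpoly_eulerX m : mpoly_euler 'X_[m] = (mdeg m)%:R *: 'X_[m].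
Proof.
rewrite mdegE natr_sum scaler_suml; apply: eq_bigr => i _.
rewrite mderivX -scalerAr; have [->|mi] := eqVneq (m i) 0%N.
  by rewrite !scale0r.
by rewrite -mpolyXD -mnm_addU.
Qed.

Lemma mpoly_euler_homog k p : p \is k.-homog -> mpoly_euler p = k%:R *: p.
Proof.
move=> /dhomogP ph; rewrite {1}[p]mpolyE raddf_sum [in RHS](mpolyE p) scaler_sumr.
apply: eq_big_seq => m /ph /= mk.
by rewrite linearZ /= mpoly_eulerX mk !scalerA mulrC.
Qed.

End Euler.

(** * The abelian wreath product *)

Section WreathModel.
Variables (K : fieldType) (d : nat).
Local Notation S := {mpoly K[d]}.

(** The abelian wreath product, in which the image of the free metabelian
    algebra consists of the [w] with [wr_euler w = wr_lin w]. *)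
Definition wr := {ffun 'I_d -> {mpoly K[d]}}.
HB.instance Definition _ := GRing.Lmodule.on wr.
Implicit Types (u v w : wr) (q : S).

(** An element of the wreath product has a component in the abelian algebra KY_d besides its tuple.
    Here that component is read off from the constant terms of the tuple, so the tuple alone is
    kept. Brackets have no constant terms, which yields both the Jacobi identity and
    metabelianity. *)
Definition wr_lin w : S := \sum_i (w i)@_0%MM *: 'X_i.
Definition wr_euler w : S := \sum_i 'X_i * w i.
Definition wr_br u v : wr := [ffun i => wr_lin u * v i - wr_lin v * u i].
Definition wr_mul q w : wr := [ffun i => q * w i].
Definition wr_gen k : wr := [ffun i => (i == k)%:R].

Lemma wr_sumE (I : Type) (r : seq I) (P : pred I) (G : I -> wr) j :
  (\sum_(i <- r | P i) G i) j = \sum_(i <- r | P i) G i j.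
Proof. by elim/big_rec2: _ => [|i p w _ <-]; rewrite ffunE. Qed.

Lemma wr_lin_linear : linear wr_lin.
Proof.
move=> a u v; rewrite /wr_lin scaler_sumr -big_split; apply: eq_bigr => i _ /=.
by rewrite !ffunE mcoeffD mcoeffZ scalerDl scalerA.
Qed.
HB.instance Definition _ := GRing.isLinear.Build K wr _ _ wr_lin wr_lin_linear.

Lemma wr_euler_linear : linear wr_euler.
Proof.
move=> a u v; rewrite /wr_euler scaler_sumr -big_split; apply: eq_bigr => i _ /=.
by rewrite !ffunE mulrDr scalerAr.
Qed.
HB.instance Definition _ := GRing.isLinear.Build K wr _ _ wr_euler wr_euler_linear.

Lemma wr_mul_linear q : linear (wr_mul q).
Proof.
by move=> a u v; apply/ffunP => i; rewrite !ffunE mulrDr scalerAr.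
Qed.
HB.instance Definition _ q :=
  GRing.isLinear.Build K wr wr _ (wr_mul q) (wr_mul_linear q).

Lemma mcoeff0X i : ('X_i : S)@_0%MM = 0.
Proof. by rewrite mcoeffX mnm1_eq0. Qed.

Lemma mcoeff0M (p q : S) : (p * q)@_0%MM = p@_0%MM * q@_0%MM.
Proof. exact: (rmorphM (mcoeff 0)). Qed.

Lemma wr_lin0 w : (wr_lin w)@_0%MM = 0.
Proof.
by rewrite raddf_sum big1 // => i _ /=; rewrite mcoeffZ mcoeff0X mulr0.
Qed.

Lemma wr_lin_br u v : wr_lin (wr_br u v) = 0.
Proof.
rewrite /wr_lin big1 // => i _.
by rewrite ffunE mcoeffB !mcoeff0M !wr_lin0 !mul0r subrr scale0r.
Qed.

Fact wr_br_linearl w : linear (wr_br^~ w).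
Proof.
move=> a u v; apply/ffunP => i; rewrite !ffunE linearP /=.
by rewrite -!mul_mpolyC; ring.
Qed.
Fact wr_br_linearr w : linear (wr_br w).
Proof.
move=> a u v; apply/ffunP => i; rewrite !ffunE linearP /=.
by rewrite -!mul_mpolyC; ring.
Qed.
Fact wr_brxx w : wr_br w w = 0.
Proof. by apply/ffunP => i; rewrite !ffunE subrr. Qed.
Fact wr_br_jacobi u v w :
  wr_br u (wr_br v w) + wr_br v (wr_br w u) + wr_br w (wr_br u v) = 0.
Proof.
by apply/ffunP => i; rewrite !ffunE !wr_lin_br; ring.
Qed.
HB.instance Definition _ := Lmodule_isLie.Build K wr
  wr_br_linearl wr_br_linearr wr_brxx wr_br_jacobi.

Lemma wr_lbrE u v i : lbr u v i = wr_lin u * v i - wr_lin v * u i.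
Proof. by rewrite /lbr /= ffunE. Qed.

Lemma wr_metabelian : metabelian (wr : lieAlgType K).
Proof.
by move=> u v w z; apply/ffunP => i; rewrite !wr_lbrE !wr_lin_br !mul0r subrr ffunE.
Qed.

Lemma wr_lin_gen k : wr_lin (wr_gen k) = 'X_k.
Proof.
rewrite /wr_lin (bigD1 k) //= ffunE eqxx mcoeff1 eqxx scale1r big1 ?addr0 //.
by move=> i /negPf ik; rewrite ffunE ik mcoeff0 scale0r.
Qed.

Lemma wr_euler_gen k : wr_euler (wr_gen k) = 'X_k.
Proof.
rewrite /wr_euler (bigD1 k) //= ffunE eqxx mulr1 big1 ?addr0 //.
by move=> i /negPf ik; rewrite ffunE ik mulr0.
Qed.

Lemma wr_euler_br u v :
  wr_euler (lbr u v) = wr_lin u * wr_euler v - wr_lin v * wr_euler u.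
Proof.
rewrite /wr_euler !mulr_sumr -sumrB; apply: eq_bigr => i _.
by rewrite wr_lbrE; ring.
Qed.

Lemma wr_euler_mul q w : wr_euler (wr_mul q w) = q * wr_euler w.
Proof.
by rewrite /wr_euler mulr_sumr; apply: eq_bigr => i _; rewrite ffunE; ring.
Qed.

Definition magnus (f : free_metab K d) : wr := free_metab_eval wr_gen f.

Lemma magnus_gen i : magnus (free_metab_gen K i) = wr_gen i.
Proof. exact/free_metab_eval_gen/wr_metabelian. Qed.

HB.instance Definition _ := GRing.isLinear.Build K (free_metab K d) wr _ magnus
  (free_metab_eval_linear wr_gen wr_metabelian).

Lemma magnus_br f g : magnus (lbr f g) = lbr (magnus f) (magnus g).
Proof. exact/free_metab_eval_br/wr_metabelian. Qed.

(** The fundamental formula of Fox calculus. On a bracket both sides vanish, the left one because it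
    becomes the commutator of two linear forms in a commutative ring. *)
Lemma magnus_euler f : wr_euler (magnus f) = wr_lin (magnus f).
Proof.
elim/free_metab_ind: f => [|a f g IHf IHg|i|f g IHf IHg].
- by rewrite !raddf0.
- by rewrite !linearP /= IHf IHg.
- by rewrite magnus_gen wr_euler_gen wr_lin_gen.
- by rewrite magnus_br wr_euler_br IHf IHg wr_lin_br mulrC subrr.
Qed.

(** On tuples without linear part the bracket with the image of y_i is multiplication by the
    variable y_i; the claim follows by induction on monomials. *)
Lemma magnus_pact f q : is_br f -> magnus (pact f q) = wr_mul q (magnus f).
Proof.
move=> fbr; move: q; apply: mpoly_linear_ext => [a p q|a p q|m].
- by rewrite !linearP.
- by apply/ffunP => i; rewrite !ffunE mulrDl scalerAl.
have lin0 : wr_lin (magnus f) = 0.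
  by case: fbr => x [z ->]; rewrite magnus_br wr_lin_br.
elim/mnm_ind: m => [|i m IH].
  by rewrite mpolyX0 pact1; apply/ffunP => i; rewrite ffunE mul1r.
rewrite mpolyXD pactX // magnus_br magnus_gen IH.
apply/ffunP => j; rewrite wr_lbrE wr_lin_gen [wr_lin _]big1 ?mul0r ?subr0.
  by rewrite !ffunE mulrA.
move=> k _; rewrite ffunE mcoeff0M; case: fbr lin0 => x [z ->] _.
by rewrite magnus_br wr_lbrE mcoeffB !mcoeff0M !wr_lin0 !mul0r subrr mulr0 scale0r.
Qed.

End WreathModel.

(** * Injectivity and image of the Magnus embedding *)

Section MagnusEmbedding.
Variables (K : fieldType) (d : nat).
Hypothesis charK : [pchar K] =i pred0.
Local Notation F := (free_metab K d).
Local Notation S := {mpoly K[d]}.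
Local Notation wr := (wr K d).
Local Notation y := (@free_metab_gen K d).

Lemma natr_neq0 k : (k.+1%:R : K) != 0.
Proof. by have /pcharf0P -> := charK. Qed.

Lemma natr_inj : injective (fun k => k%:R : K).
Proof.
move=> x z; wlog xz : x z / (x <= z)%N => [H|].
  by case: (leqP x z) => [/H//|/ltnW/H zx /esym/zx].
move/eqP; rewrite -(subnKC xz) natrD -[X in X == _]addr0 (inj_eq (addrI _)).
by case: (z - x)%N => [|k]; rewrite ?addn0 // eq_sym (negPf (natr_neq0 k)).
Qed.

(** In characteristic 0 the elements 0, 1, ..., [size p] - 1 of K are distinct, too many roots for a
    nonzero [p]. *)
Lemma poly_eval0 (p : {poly K}) : (forall t, p.[t] = 0) -> p = 0.
Proof.
move=> p0; apply/eqP; apply: contraT => pn0.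
have := max_poly_roots pn0 (rs := [seq k%:R | k <- iota 0 (size p)]).
rewrite size_map size_iota ltnn; apply.
  by apply/allP => t _; rewrite rootE p0.
by rewrite map_inj_uniq ?iota_uniq //; apply: natr_inj.
Qed.

Lemma lbr_is_br (f g : F) : is_br (lbr f g). Proof. by exists f, g. Qed.
Local Hint Resolve lbr_is_br : core.

(** A spanning form, with all ordered pairs (k, l) and hence no uniqueness; [metab_nfP] shows that
    it reaches every element. *)
Definition metab_nf (v : 'I_d -> K) (c : 'I_d -> 'I_d -> S) : F :=
  \sum_i v i *: y i + \sum_k \sum_l pact (lbr (y k) (y l)) (c k l).

Lemma metab_nf_lin a v c v' c' : a *: metab_nf v c + metab_nf v' c' =
  metab_nf (fun i => a * v i + v' i) (fun k l => a *: c k l + c' k l).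
Proof.
rewrite /metab_nf scalerDr addrACA !scaler_sumr; congr (_ + _).
  by rewrite -big_split; apply: eq_bigr => i _; rewrite scalerDl scalerA.
rewrite -big_split; apply: eq_bigr => k _.
rewrite scaler_sumr -big_split; apply: eq_bigr => l _ /=.
by rewrite linearP.
Qed.


Lemma lbr_pact_pact (f g : F) (p q : S) :
  is_br f -> is_br g -> lbr (pact f p) (pact g q) = 0.
Proof.
move=> fbr gbr; rewrite /pact /mlift lbr_suml big1 // => m _.
rewrite lbrZl raddf_sum big1 ?scaler0 // => m' _ /=; rewrite linearZ_LR /=.
have [u [v ->]] : is_br (adm m f) by apply: adm_seq_br.
have [u' [v' ->]] : is_br (adm m' g) by apply: adm_seq_br.
by rewrite free_metabP scaler0.
Qed.

Lemma metab_nfP (f : F) : exists v c, f = metab_nf v c.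
Proof.
elim/free_metab_ind: f => [|a f g [v [c ->]] [v' [c' ->]]|i|f g].
- exists (fun=> 0), (fun _ _ => 0); rewrite /metab_nf !big1 ?addr0 // => i _.
    by rewrite big1 // => j _; rewrite raddf0.
  by rewrite scale0r.
- by eexists; eexists; apply: metab_nf_lin.
- exists (fun j => (j == i)%:R), (fun _ _ => 0); rewrite /metab_nf.
  rewrite [X in _ + X]big1 ?addr0 => [|k _]; last first.
    by rewrite big1 // => j _; rewrite raddf0.
  rewrite (bigD1 i) //= eqxx scale1r big1 ?addr0 // => j /negPf ->.
  by rewrite scale0r.
case=> [v [c ->]] [v' [c' ->]].
(* The two linear parts contribute the constants v_k v'_l; each linear part acts on the commutator
   part of the other element by multiplication with a linear form; the two commutator parts bracket
   to 0. *)
exists (fun=> 0), (fun k l => (v k * v' l) *: 1 +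
  ((\sum_i v i *: 'X_i) * c' k l - (\sum_i v' i *: 'X_i) * c k l)).
have lin_pact (w : 'I_d -> K) (h : F) q : is_br h -> lbr (\sum_i w i *: y i) (pact h q) =
    pact h ((\sum_i w i *: 'X_i) * q).
  move=> hbr; rewrite lbr_suml mulr_suml raddf_sum; apply: eq_bigr => i _ /=.
  by rewrite lbrZl -scalerAl linearZ_LR /= pactX.
have lin_sum (w : 'I_d -> K) (b : 'I_d -> 'I_d -> S) :
    lbr (\sum_i w i *: y i) (\sum_k \sum_l pact (lbr (y k) (y l)) (b k l)) =
    \sum_k \sum_l pact (lbr (y k) (y l)) ((\sum_i w i *: 'X_i) * b k l).
  rewrite raddf_sum; apply: eq_bigr => k _; rewrite raddf_sum.
  by apply: eq_bigr => l _; apply: lin_pact.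
rewrite [metab_nf v c]/metab_nf [metab_nf v' c']/metab_nf !lbrDl !raddfD /=.
rewrite (lin_sum v c').
rewrite [lbr (\sum_(k < d) \sum_(l < d) _) (\sum_(i < d) _ *: _)]lbrC (lin_sum v' c).
rewrite [X in _ + (_ + X)](_ : _ = 0) ?addr0; last first.
  rewrite lbr_suml big1 // => k _; rewrite lbr_suml big1 // => l _.
  rewrite raddf_sum big1 // => k' _; rewrite raddf_sum big1 // => l' _.
  exact: lbr_pact_pact.
rewrite /metab_nf [X in _ = X + _]big1 ?add0r => [|i _]; last by rewrite scale0r.
rewrite lbr_suml -addrA -sumrB -big_split; apply: eq_bigr => k _.
rewrite lbrZl raddf_sum -sumrB scaler_sumr -big_split; apply: eq_bigr => l _ /=.
by rewrite linearZ_LR /= scalerA raddfD raddfB /= linearZ_LR /= pact1.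
Qed.

(** The inverse of E + 1, where E is the Euler operator: the part of degree n is divided by n +
    1. *)
Definition mpoly_prim (q : S) : S :=
  mlift (fun m => (mdeg m).+1%:R^-1 *: 'X_[m]) q.
HB.instance Definition _ := GRing.Linear.copy mpoly_prim
  (mlift (fun m : 'X_{1..d} => ((mdeg m).+1%:R^-1 : K) *: 'X_[m])).

Lemma mpoly_primX m : mpoly_prim 'X_[m] = (mdeg m).+1%:R^-1 *: 'X_[m].
Proof. exact: mliftX. Qed.

(** The contraction of the Koszul complex, with the module element [y_j, y_i] in place of the wedge
    of y_j and y_i. *)
Definition magnus_inv (w : wr) : F :=
  \sum_i (w i)@_0%MM *: y i +
  \sum_i \sum_j pact (lbr (y j) (y i)) (mpoly_prim (w i))^`M(j).

Lemma magnus_inv_linear : linear magnus_inv.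
Proof.
move=> a u v; rewrite /magnus_inv scalerDr addrACA !scaler_sumr.
congr (_ + _); rewrite -big_split.
  by apply: eq_bigr => i _; rewrite !ffunE mcoeffD mcoeffZ scalerDl scalerA.
apply: eq_bigr => k _; rewrite scaler_sumr -big_split; apply: eq_bigr => l _ /=.
by rewrite !ffunE !linearP.
Qed.
HB.instance Definition _ :=
  GRing.isLinear.Build K wr _ _ magnus_inv magnus_inv_linear.

Lemma magnus_inv_gen i : magnus_inv (wr_gen K i) = y i.
Proof.
rewrite /magnus_inv (bigD1 i) //= ffunE eqxx mcoeff1 eqxx scale1r.
rewrite big1 ?addr0 => [|j /negPf ji]; last by rewrite ffunE ji mcoeff0 scale0r.
rewrite big1 ?addr0 // => j _; rewrite big1 // => k _; rewrite ffunE.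
case: eqVneq => _; last by rewrite !raddf0.
by rewrite -mpolyX0 mpoly_primX mdeg0 invr1 scale1r mpolyX0 -mpolyC1 mderivC raddf0.
Qed.

(** By linearity [q] is a monomial, of degree n say. The terms where the derivative hits [q] combine
    by the Jacobi relation into E(q) [y_k, y_l], which is n times the right side; the terms where it
    hits y_k or y_l give it twice more. [mpoly_prim] has divided by n + 2. *)
Lemma magnus_inv_koszul k l q :
  magnus_inv (wr_mul ('X_k * q) (wr_gen K l) - wr_mul ('X_l * q) (wr_gen K k)) =
  pact (lbr (y k) (y l)) q.
Proof.
have inv_mul i (p : S) : magnus_inv (wr_mul p (wr_gen K i)) = p@_0%MM *: y i +
    \sum_j pact (lbr (y j) (y i)) (mpoly_prim p)^`M(j).
  rewrite /magnus_inv (bigD1 i) //= !ffunE eqxx mulr1 big1 ?addr0; last first.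
    by move=> j /negPf ji; rewrite !ffunE ji mulr0 mcoeff0 scale0r.
  rewrite (bigD1 i) //= !ffunE eqxx mulr1 [X in _ + (_ + X)]big1 ?addr0 //.
  move=> j /negPf ji; rewrite !ffunE ji mulr0 big1 // => k' _.
  by rewrite !raddf0.
move: q; apply: mpoly_linear_ext => [a p q|a p q|m]; last 2 first.
- by rewrite linearP.
- rewrite raddfB /= !inv_mul !mcoeff0M !mcoeff0X !mul0r !scale0r !add0r.
  rewrite -!mpolyXD !mpoly_primX !mdegD !mdeg1 -sumrB.
  under eq_bigr => j _ do
    rewrite !linearZ /= -scalerDr !mpolyXD !mderivM !mderivU mderivX.
  rewrite -scaler_sumr.
  under eq_bigr => j _ do rewrite !raddfD /=.
  under eq_bigr => j _ do rewrite addrACA pact_jacobi.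
  rewrite big_split /= sumrB -raddf_sum.
  have delta i j : \sum_k' pact (lbr (y k') (y i))
    ((j == k')%:R * 'X_[m]) = pact (lbr (y j) (y i)) 'X_[m].
    rewrite (bigD1 j) //= eqxx mul1r big1 ?addr0 //.
    by move=> k'; rewrite eq_sym => /negPf ->; rewrite mul0r raddf0.
  rewrite !delta [lbr (y l) _]lbrC pactNr opprK.
  rewrite [\sum_i 'X_i * _](_ : _ = mpoly_euler 'X_[m]); last first.
    by apply: eq_bigr => i _; rewrite mderivX.
  rewrite mpoly_eulerX /= linearZ_LR /= -mulr2n -scaler_nat -scalerDl -natrD.
  rewrite scalerA mulVf ?scale1r // natr_neq0 //.
rewrite -linearP; congr magnus_inv; apply/ffunP => i; rewrite !ffunE.
by rewrite -!mul_mpolyC; ring.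
Qed.

(** By [metab_nfP] only the generators and the elements [y_k, y_l] q have to be checked, and the
    image of the latter is a Koszul boundary. *)
Lemma magnusK : cancel (@magnus K d) magnus_inv.
Proof.
move=> f; have [v [c ->]] := metab_nfP f.
rewrite /metab_nf !raddfD /= !raddf_sum; congr (_ + _); apply: eq_bigr => i _ /=.
  by rewrite !linearZ_LR /= magnus_gen magnus_inv_gen.
rewrite !raddf_sum; apply: eq_bigr => j _ /=; rewrite magnus_pact //.
rewrite -magnus_inv_koszul; congr magnus_inv; apply/ffunP => k.
by rewrite magnus_br !magnus_gen !ffunE !wr_lin_gen; ring.
Qed.

Lemma mpoly_prim_eulerE q : mpoly_euler (mpoly_prim q) + mpoly_prim q = q.
Proof.
move: q; apply: mpoly_linear_ext => [a p q|a p q|m] //.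
  by rewrite !linearP scalerDr addrACA.
rewrite mpoly_primX linearZ /= mpoly_eulerX scalerA -scalerDl -[X in _ + X]mulr1.
by rewrite -mulrDr natr1 mulVf ?scale1r // natr_neq0.
Qed.

Lemma magnus_invK w : wr_euler w = wr_lin w -> magnus (magnus_inv w) = w.
Proof.
move=> wE; rewrite /magnus_inv raddfD /= !raddf_sum; apply/ffunP => j.
rewrite ffunE !wr_sumE (bigD1 j) //= big1 ?addr0; last first.
  by move=> i /negPf ij /=; rewrite linearZ_LR /= magnus_gen !ffunE eq_sym ij scaler0.
(* Divide the part of degree n of the equation by n. On y_i w_i this has the effect of [mpoly_prim]
   on w_i, the degree being one higher; linear forms stay unchanged. There are no constant terms, so
   the value of the inverse at 0 does not enter. *)
have prim_lin : \sum_i 'X_i * mpoly_prim (w i) = wr_lin w.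
  have: mlift (fun m => (mdeg m)%:R^-1 *: ('X_[m] : S)) (wr_euler w) = wr_lin w.
    rewrite wE /wr_lin raddf_sum; apply: eq_bigr => i _ /=.
    by rewrite linearZ /= mliftX mdeg1 invr1 scale1r.
  move=> <-; rewrite /wr_euler raddf_sum; apply: eq_bigr => i _.
  move: (w i); apply: mpoly_linear_ext => [a p q|a p q|m].
  - by rewrite linearP /= mulrDr scalerAr.
  - by rewrite /= mulrDr -scalerAr linearP.
  - by rewrite mpoly_primX /= -mpolyXD mliftX mdegD mdeg1 add1n -scalerAr mpolyXD.
(* Differentiation with respect to y_j expresses the constant term of w_j as [mpoly_prim] of w_j
   plus the sum of the y_i times the j-th derivative of [mpoly_prim] of w_i. The latter sum cancels
   against the Koszul terms, and what remains is (E + 1) applied to [mpoly_prim] of w_j. *)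
have := congr1 (mderiv j) prim_lin; rewrite /wr_lin !raddf_sum /=.
rewrite [X in _ = X -> _](bigD1 j) //= linearZ /= mderivU eqxx.
rewrite [X in _ = _ + X -> _]big1 ?addr0; last first.
  by move=> i /negPf ij; rewrite linearZ /= mderivU ij scaler0.
under eq_bigr => i _ do rewrite mderivM mderivU.
rewrite big_split /= (bigD1 j) //= eqxx mul1r big1 ?addr0; last first.
  by move=> i /negPf ij; rewrite ij mul0r.
move=> D; rewrite linearZ_LR /= magnus_gen !ffunE eqxx -D -addrA.
have magnus_ij i k q : magnus (pact (lbr (y k) (y i)) q) j =
    'X_k * q * (j == i)%:R - 'X_i * q * (j == k)%:R.
  by rewrite magnus_pact // ffunE magnus_br !magnus_gen wr_lbrE !wr_lin_gen !ffunE; ring.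
have -> : \sum_(i < d) magnus
      (\sum_(k < d) pact (lbr (y k) (y i)) (mpoly_prim (w i))^`M(k)) j =
    mpoly_euler (mpoly_prim (w j)) - \sum_i 'X_i * (mpoly_prim (w i))^`M(j).
  have magnus_i i : magnus
      (\sum_(k < d) pact (lbr (y k) (y i)) (mpoly_prim (w i))^`M(k)) j =
    (\sum_k 'X_k * (mpoly_prim (w i))^`M(k)) * (j == i)%:R -
    'X_i * (mpoly_prim (w i))^`M(j).
    rewrite (raddf_sum (@magnus K d)) /= wr_sumE (eq_bigr _ (fun k _ => magnus_ij i k _)).
    rewrite sumrB -mulr_suml; congr (_ - _); rewrite (bigD1 j) //= eqxx mulr1.
    by rewrite [X in _ + X]big1 ?addr0 // => k; rewrite eq_sym => /negPf ->; rewrite mulr0.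
  rewrite (eq_bigr _ (fun i _ => magnus_i i)).
  rewrite sumrB; congr (_ - _); rewrite (bigD1 j) //= eqxx mulr1.
  by rewrite [X in _ + X]big1 ?addr0 // => k; rewrite eq_sym => /negPf ->; rewrite mulr0.
by rewrite -[RHS]mpoly_prim_eulerE; ring.
Qed.

Lemma magnus_inj : injective (@magnus K d).
Proof. exact: can_inj magnusK. Qed.

End MagnusEmbedding.

(** * Linear substitutions and invariants *)

(** The chain rule for an arbitrary derivation [D]. It serves for partial derivatives after a linear
    substitution and for the derivative along a polynomial curve. *)
Lemma mpoly_chain (n : nat) (K : fieldType) (B : comAlgType K)
    (th : {rmorphism {mpoly K[n]} -> B}) (D : {linear B -> B}) :
  (forall c q, th (c *: q) = c *: th q) ->
  (forall p q, D (p * q) = D p * q + p * D q) ->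
  forall q, D (th q) = \sum_i th q^`M(i) * D (th 'X_i).
Proof.
move=> thZ DM; apply: mpoly_linear_ext => [a p q|a p q|m].
- by rewrite rmorphD thZ linearP.
- rewrite scaler_sumr -big_split; apply: eq_bigr => i _ /=.
  by rewrite linearP rmorphD thZ mulrDl scalerAl.
have D1 : D 1 = 0.
  by have := DM 1 1; rewrite !mulr1 mul1r -[LHS]addr0 => /addrI.
elim/mnm_ind: m => [|i m IH].
  rewrite mpolyX0 rmorph1 D1 big1 // => i _.
  by rewrite -mpolyC1 mderivC rmorph0 mul0r.
rewrite mpolyXD rmorphM DM IH mulr_sumr.
under [RHS]eq_bigr => j _ do
  rewrite mderivM mderivU rmorphD !rmorphM rmorph_nat mulrDl.
rewrite [RHS]big_split /=; congr (_ + _).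
  rewrite (bigD1 i) //= eqxx mul1r mulrC big1 ?addr0 // => j.
  by rewrite eq_sym => /negPf ->; rewrite !mul0r.
by apply: eq_bigr => j _; rewrite mulrA.
Qed.

Section LinearSubstitution.
Variables (K : fieldType) (d : nat).
Local Notation S := {mpoly K[d]}.
Local Notation wr := (wr K d).
Implicit Types (v : 'rV[K]_d) (P : 'I_d -> 'rV[K]_d) (q : S) (w : wr).

Definition mlin v : S := \sum_i v 0 i *: 'X_i.
Definition wlin v : wr := [ffun i => (v 0 i)%:MP].
(** [P] lists the images of the generators under a linear endomorphism of KY_d, which need not be
    invertible: besides group elements, a projection onto trivial summands occurs. [row_subst],
    [msub], [wsub] and [metab_sub] are the maps it induces on KY_d, on polynomials, on the wreath
    product and on F_d. *)
Definition row_subst P v := \sum_i v 0 i *: P i.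
Definition msub P q : S := q \mPo [tuple mlin (P i) | i < d].
Definition wsub P w : wr := \sum_i wr_mul (msub P (w i)) (wlin (P i)).
Definition wgrad q : wr := [ffun i => q^`M(i)].

HB.instance Definition _ P := GRing.RMorphism.copy (msub P)
  (comp_mpoly [tuple mlin (P i) | i < d]).
HB.instance Definition _ P := GRing.Linear.copy (msub P)
  (comp_mpoly [tuple mlin (P i) | i < d]).

Lemma mlin_linear : linear mlin.
Proof.
move=> a u v; rewrite /mlin scaler_sumr -big_split; apply: eq_bigr => i _ /=.
by rewrite !mxE scalerDl scalerA.
Qed.
HB.instance Definition _ := GRing.isLinear.Build K _ _ _ mlin mlin_linear.

Lemma wlin_linear : linear wlin.
Proof.
move=> a u v; apply/ffunP => i; rewrite !ffunE !mxE mpolyCD.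
by rewrite -mul_mpolyC -mpolyCM.
Qed.
HB.instance Definition _ := GRing.isLinear.Build K _ wr _ wlin wlin_linear.

Lemma msubX P i : msub P 'X_i = mlin (P i).
Proof. by rewrite /msub comp_mpolyXU -tnth_nth tnth_mktuple. Qed.

Lemma msub_lin P v : msub P (mlin v) = mlin (row_subst P v).
Proof.
rewrite !raddf_sum; apply: eq_bigr => i _ /=.
by rewrite !linearZ /= msubX.
Qed.

Lemma wsubE P w j : wsub P w j = \sum_i msub P (w i) * (P i 0 j)%:MP.
Proof. by rewrite wr_sumE; apply: eq_bigr => i _; rewrite !ffunE. Qed.

Lemma wsub_linear P : linear (wsub P).
Proof.
move=> a u v; apply/ffunP => j; rewrite 2!ffunE !wsubE.
rewrite scaler_sumr -big_split; apply: eq_bigr => i _ /=.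
by rewrite !ffunE linearP mulrDl scalerAl.
Qed.
HB.instance Definition _ P := GRing.isLinear.Build K wr wr _ (wsub P) (wsub_linear P).

Lemma wsub_mul P q w : wsub P (wr_mul q w) = wr_mul (msub P q) (wsub P w).
Proof.
apply/ffunP => j; rewrite [RHS]ffunE !wsubE mulr_sumr; apply: eq_bigr => i _.
by rewrite ffunE rmorphM mulrA.
Qed.

Lemma wsub_lin P v : wsub P (wlin v) = wlin (row_subst P v).
Proof.
apply/ffunP => j; rewrite wsubE ffunE summxE raddf_sum; apply: eq_bigr => i _ /=.
by rewrite ffunE mxE /msub comp_mpolyC mpolyCM.
Qed.

Lemma wr_euler_lin v : wr_euler (wlin v) = mlin v.
Proof. by apply: eq_bigr => i _; rewrite ffunE mulrC mul_mpolyC. Qed.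

Lemma wr_lin_lin v : wr_lin (wlin v) = mlin v.
Proof. by apply: eq_bigr => i _; rewrite ffunE mcoeffC eqxx mulr1. Qed.

Lemma wr_euler_sub P w : wr_euler (wsub P w) = msub P (wr_euler w).
Proof.
rewrite raddf_sum [RHS]raddf_sum; apply: eq_bigr => i _ /=.
by rewrite wr_euler_mul wr_euler_lin rmorphM /= msubX mulrC.
Qed.

Lemma mlin_coef0 v : (mlin v)@_0%MM = 0.
Proof. by rewrite raddf_sum big1 // => i _; rewrite /= mcoeffZ mcoeff0X mulr0. Qed.

Lemma msub_coef0 P q : (msub P q)@_0%MM = q@_0%MM.
Proof.
move: q; apply: (@mpoly_linear_ext _ _ K^o) => [a p q|a p q|m].
- by rewrite linearP mcoeffD mcoeffZ.
- by rewrite mcoeffD mcoeffZ.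
elim/mnm_ind: m => [|i m _]; first by rewrite mpolyX0 rmorph1.
by rewrite mpolyXD rmorphM /= !mcoeff0M msubX mlin_coef0 mcoeff0X !mul0r.
Qed.

Lemma wr_lin_sub P w : wr_lin (wsub P w) = msub P (wr_lin w).
Proof.
have wr_linE u : wr_lin u = mlin (\row_i (u i)@_0%MM).
  by apply: eq_bigr => i _; rewrite mxE.
rewrite !wr_linE msub_lin; congr mlin; apply/rowP => j.
rewrite mxE wsubE summxE raddf_sum; apply: eq_bigr => i _ /=.
by rewrite mcoeff0M msub_coef0 mcoeffC eqxx mulr1 !mxE.
Qed.

Lemma wsub_br P u w : wsub P (lbr u w) = lbr (wsub P u) (wsub P w).
Proof.
have lbrE x z : lbr x z = wr_mul (wr_lin x) z - wr_mul (wr_lin z) x :> wr.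
  by apply/ffunP => i; rewrite wr_lbrE !ffunE.
by rewrite !lbrE raddfB /= !wsub_mul !wr_lin_sub.
Qed.

Lemma magnus_lin v : magnus (free_metab_lin v) = wlin v.
Proof.
rewrite raddf_sum; apply/ffunP => j; rewrite wr_sumE ffunE (bigD1 j) //=.
rewrite big1 ?addr0 => [|i /negPf ij]; rewrite linearZ_LR /= magnus_gen !ffunE.
  by rewrite eqxx -mul_mpolyC mulr1.
by rewrite eq_sym ij scaler0.
Qed.

Definition metab_sub P (f : free_metab K d) : free_metab K d :=
  free_metab_eval (fun i => free_metab_lin (P i)) f.

(** Both sides are Lie homomorphisms in [f], so agreement on generators suffices. For the
    substitution given by a group element this is the equivariance of the embedding. *)
Lemma magnus_sub P f : magnus (metab_sub P f) = wsub P (magnus f).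
Proof.
have mF := @free_metabP K d.
have lin := free_metab_eval_linear (fun i => free_metab_lin (P i)) mF.
elim/free_metab_ind: f => [|a f g IHf IHg|i|f g IHf IHg].
- have := lin (-1) 0 0; rewrite !scaleN1r !addNr -/(metab_sub P 0) => ->.
  by rewrite !raddf0.
- by rewrite /metab_sub lin !linearP /= IHf IHg.
- rewrite /metab_sub free_metab_eval_gen // magnus_lin magnus_gen.
  rewrite (_ : wr_gen K i = wlin (delta_mx 0 i)) ?wsub_lin; last first.
    by apply/ffunP => j; rewrite !ffunE mxE eqxx /= mpolyC_nat.
  congr wlin; rewrite /row_subst (bigD1 i) //= mxE !eqxx scale1r big1 ?addr0 //.
  by move=> j /negPf ji; rewrite mxE ji andbF scale0r.
- by rewrite /metab_sub free_metab_eval_br // !magnus_br wsub_br IHf IHg.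
Qed.

Lemma mderiv_lin j v : (mlin v)^`M(j) = (v 0 j)%:MP.
Proof.
rewrite raddf_sum (bigD1 j) //= big1 ?addr0 => [|i /negPf ij].
  by rewrite linearZ /= mderivU eqxx -mul_mpolyC mulr1.
by rewrite linearZ /= mderivU ij scaler0.
Qed.

Lemma wsub_grad P q : wsub P (wgrad q) = wgrad (msub P q).
Proof.
apply/ffunP => j; rewrite wsubE ffunE.
have msubZ c p : msub P (c *: p) = c *: msub P p by rewrite linearZ.
have /= -> := mpoly_chain msubZ (@mderivM _ _ j) q.
by apply: eq_bigr => i _; rewrite ffunE msubX mderiv_lin.
Qed.

Lemma wr_euler_grad q : wr_euler (wgrad q) = mpoly_euler q.
Proof. by apply: eq_bigr => i _; rewrite ffunE. Qed.

Lemma mpoly_euler_sub P q : mpoly_euler (msub P q) = msub P (mpoly_euler q).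
Proof. by rewrite -!wr_euler_grad -wsub_grad wr_euler_sub. Qed.

End LinearSubstitution.

(** * Invariant fields and a criterion for infinite generation *)

Section Invariants.
Variables (K : fieldType) (d : nat).
Hypothesis charK : [pchar K] =i pred0.
Variable (rho : SL2 K -> 'rV[K]_d -> 'rV[K]_d).
Hypothesis rhoP : linear_action rho.
Local Notation S := {mpoly K[d]}.
Local Notation wr := (wr K d).
Implicit Types (g : SL2 K) (v : 'rV[K]_d) (q h : S) (w : wr).

Definition rho_basis g (i : 'I_d) := rho g (delta_mx 0 i).
Definition poly_invariant q := forall g, msub (rho_basis g) q = q.
Definition wr_invariant w := forall g, wsub (rho_basis g) w = w.
Definition rho_fixed v := forall g, rho g v = v.

Lemma rho_linear g : linear (rho g). Proof. by case: rhoP. Qed.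

Lemma rho_0 g : rho g 0 = 0.
Proof. by have := rho_linear g (-1) 0 0; rewrite !scaleN1r !addNr. Qed.

Lemma rho_sum g (I : Type) (r : seq I) (c : I -> K) (u : I -> 'rV[K]_d) :
  rho g (\sum_(i <- r) c i *: u i) = \sum_(i <- r) c i *: rho g (u i).
Proof.
elim: r => [|i r IH]; first by rewrite !big_nil rho_0.
by rewrite !big_cons rho_linear IH.
Qed.

Lemma row_subst_rho g v : row_subst (rho_basis g) v = rho g v.
Proof. by rewrite {2}(row_sum_delta v) rho_sum. Qed.

Lemma msub_rho g v : msub (rho_basis g) (mlin v) = mlin (rho g v).
Proof. by rewrite msub_lin row_subst_rho. Qed.

Lemma wsub_rho g v : wsub (rho_basis g) (wlin v) = wlin (rho g v).
Proof. by rewrite wsub_lin row_subst_rho. Qed.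

Lemma metab_invP f : free_metab_inv rho f <-> wr_invariant (magnus f).
Proof.
split=> fI g; first by rewrite -magnus_sub; congr magnus; exact: (fI g).
by apply: (magnus_inj charK); exact: etrans (magnus_sub _ f) (fI g).
Qed.

Definition wr_coef0 w : 'rV[K]_d := \row_i (w i)@_0%MM.

Lemma wr_lin_coef0 w : wr_lin w = mlin (wr_coef0 w).
Proof. by apply: eq_bigr => i _; rewrite mxE. Qed.

Lemma mlin_inj : injective (@mlin K d).
Proof.
move=> u v /(congr1 (fun q j => (q^`M(j))@_0%MM)) /= uv; apply/rowP => j.
by have /(congr1 (@^~ j)) := uv; rewrite !mderiv_lin !mcoeffC eqxx !mulr1.
Qed.

Lemma wr_invariant_coef0 w : wr_invariant w -> rho_fixed (wr_coef0 w).
Proof.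
move=> wI g; apply: mlin_inj; rewrite -msub_rho -!wr_lin_coef0 -wr_lin_sub.
by rewrite wI.
Qed.

Lemma poly_invariantX q n : poly_invariant q -> poly_invariant (q ^+ n).
Proof. by move=> qI g; rewrite rmorphXn /= qI. Qed.

Lemma wr_invariant_mul q w :
  poly_invariant q -> wr_invariant w -> wr_invariant (wr_mul q w).
Proof. by move=> qI wI g; rewrite wsub_mul qI wI. Qed.

Lemma wr_lin_mul q w : wr_lin (wr_mul q w) = q@_0%MM *: wr_lin w.
Proof.
rewrite /wr_lin scaler_sumr; apply: eq_bigr => i _.
by rewrite ffunE mcoeff0M scalerA.
Qed.

Section Curve.
Variable (sg : 'I_d -> {poly K}).

(** The restriction of [q] to the polynomial curve [sg] in the dual of KY_d, a polynomial in the
    parameter of the curve. *)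
Definition curve q : {poly K} := mmap (@polyC K) sg q.
HB.instance Definition _ := GRing.RMorphism.copy curve (mmap (@polyC K) sg).

Lemma curveZ c q : curve (c *: q) = c *: curve q.
Proof. by rewrite /curve mmapZ mul_polyC. Qed.

Lemma curve_linear : linear curve.
Proof. by move=> a p q; rewrite rmorphD /= curveZ. Qed.
HB.instance Definition _ := GRing.isLinear.Build K S _ _ curve curve_linear.

Lemma curveX i : curve 'X_i = sg i.
Proof. by rewrite /curve mmapX mmap1U. Qed.

Lemma curve_lin v : curve (mlin v) = \sum_i v 0 i *: sg i.
Proof. by rewrite raddf_sum; apply: eq_bigr => i _ /=; rewrite curveZ curveX. Qed.

(* For [w] in the image of F_d^G the factor [wr_lin w] comes from a vector of
   V^G, hence is constant along the curve: brackets do not raise the degree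
   along it, while multiplication of [w] by powers of [h] does. *)
Lemma not_fin_gen h w :
  (forall v, rho_fixed v -> (size (curve (mlin v)) <= 1)%N) ->
  poly_invariant h -> (1 < size (curve h))%N ->
  wr_invariant w -> wr_lin w = 0 -> wr_euler w = 0 -> (exists i, curve (w i) != 0) ->
  ~ lie_fin_gen (free_metab_inv rho).
Proof.
move=> fixC hI hC wI wl we [i wi] [s sE].
(* A common bound for the sizes along the curve of all components of the generators. It persists
   under linear combinations and, the linear parts being constant along the curve, under
   brackets. *)
pose N := \max_(u <- s) \max_(j < d) size (curve (magnus u j)).
have bound u : free_metab_inv rho u ->
    forall j, (size (curve (magnus u j)) <= N)%N.
  rewrite sE; elim=> {u} [u su||a u v _ IHu _ IHv|u v us IHu vs IHv] j.
  - apply: leq_trans (_ : \max_(j < d) size (curve (magnus u j)) <= _)%N.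
      exact: leq_bigmax.
    exact: leq_bigmax_seq.
  - by rewrite linear0 ffunE raddf0 size_poly0.
  - rewrite linearP !ffunE linearP.
    rewrite (leq_trans (size_polyD _ _)) // geq_max IHv andbT.
    exact: leq_trans (size_scale_leq _ _) (IHu j).
  rewrite -sE in us vs; have lin_const x : free_metab_inv rho x ->
      exists c, curve (wr_lin (magnus x)) = c%:P.
    move=> /metab_invP /wr_invariant_coef0 /fixC.
    by rewrite -wr_lin_coef0 => /size1_polyC ->; eexists.
  have [a ua] := lin_const _ us; have [b vb] := lin_const _ vs.
  rewrite magnus_br wr_lbrE rmorphB !rmorphM /= ua vb !mul_polyC -scaleNr.
  rewrite (leq_trans (size_polyD _ _)) // geq_max.
  by rewrite !(leq_trans (size_scale_leq _ _)).
(* This invariant violates the bound: [h] has degree at least 1 along the curve, so its power raises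
   the size of the nonzero restriction of [w i] by at least [N]. *)
pose f := magnus_inv (wr_mul (h ^+ N) w).
have fE : magnus f = wr_mul (h ^+ N) w.
  by apply: magnus_invK; rewrite // wr_euler_mul wr_lin_mul we wl mulr0 scaler0.
have /bound/(_ i) : free_metab_inv rho f.
  by apply/metab_invP; rewrite fE; apply: wr_invariant_mul => //; apply: poly_invariantX.
have h0 : curve h != 0 by rewrite -size_poly_gt0 (ltn_trans _ hC).
have hN := expf_neq0 N h0; rewrite fE ffunE rmorphM rmorphXn /= size_mul //.
have := size_exp (curve h) N; move: hN wi hC; rewrite -!size_poly_gt0.
case: (size (curve h)) => [|[|k]] //=.
by move: (size _) (size _) => a b; rewrite mulSn; lia.
Qed.

(** The pairing of the field along the curve with the velocity of the curve. It detects that a field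
    does not vanish on the curve and turns gradients into derivatives. *)
Definition contract w : {poly K} := \sum_i curve (w i) * (sg i)^`().

Lemma contract_neq0 w : contract w != 0 -> exists i, curve (w i) != 0.
Proof.
move=> w0; apply/existsP; apply: contraNT w0; rewrite negb_exists => /forallP w0.
by rewrite /contract big1 // => i _; have /negbNE/eqP -> := w0 i; rewrite mul0r.
Qed.

Lemma contract_linear : linear contract.
Proof.
move=> a u v; rewrite /contract scaler_sumr -big_split; apply: eq_bigr => i _ /=.
by rewrite !ffunE linearP mulrDl scalerAl.
Qed.
HB.instance Definition _ := GRing.isLinear.Build K wr _ _ contract contract_linear.

Lemma contract_mul q w : contract (wr_mul q w) = curve q * contract w.
Proof.
by rewrite /contract mulr_sumr; apply: eq_bigr => i _; rewrite ffunE rmorphM mulrA.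
Qed.

Lemma contract_lin v : contract (wlin v) = (curve (mlin v))^`().
Proof.
rewrite curve_lin raddf_sum; apply: eq_bigr => i _ /=.
by rewrite ffunE /curve mmapC mul_polyC linearZ.
Qed.

Lemma contract_grad q : contract (wgrad q) = (curve q)^`().
Proof.
have /= -> := mpoly_chain curveZ (@derivM K) q.
by apply: eq_bigr => i _; rewrite ffunE curveX.
Qed.

End Curve.
End Invariants.

(** * Symmetric powers of the natural module *)

Section SymPowBasis.
Variables (K : fieldType).
Implicit Types (g : SL2 K) (n i j k : nat).

(** The image of X_0^i X_1^(n-i) under [g], dehomogenized by X_1 = 1. *)
Definition sl2_row g n i : {poly K} :=
  ((SL2_mx g 0 0)%:P * 'X + (SL2_mx g 1 0)%:P) ^+ i *
  ((SL2_mx g 0 1)%:P * 'X + (SL2_mx g 1 1)%:P) ^+ (n - i).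

(** The matrix of [g] on [S^n(K^2)] in the basis [X_0^i X_1^(n-i)]. *)
Definition sl2_coef g n i j : K := (sl2_row g n i)`_j.

Lemma size_sl2_row g n i : (i <= n)%N -> (size (sl2_row g n i) <= n.+1)%N.
Proof.
move=> le_in.
have size_lin (a b : K) k : (size ((a%:P * 'X + b%:P) ^+ k) <= k.+1)%N.
  apply: leq_trans (size_poly_exp_leq _ _) _; rewrite ltnS -[leqRHS]mul1n leq_mul2r.
  apply/orP; right; rewrite -subn1 leq_subLR.
  apply: leq_trans (size_polyD _ _) _; rewrite geq_max.
  rewrite mul_polyC (leq_trans (size_scale_leq _ _)) ?size_polyX //= size_polyC.
  by case: eqP.
apply: leq_trans (size_polyMleq _ _) _.
have := size_lin (SL2_mx g 0 0) (SL2_mx g 1 0) i.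
have := size_lin (SL2_mx g 0 1) (SL2_mx g 1 1) (n - i)%N.
by move: (size _) (size _); lia.
Qed.

Lemma sl2_rowM g a b i j : (i <= a)%N -> (j <= b)%N ->
  sl2_row g (a + b) (i + j) = sl2_row g a i * sl2_row g b j.
Proof.
move=> ia jb; rewrite /sl2_row (_ : a + b - (i + j) = (a - i) + (b - j))%N; last lia.
by rewrite !exprD; ring.
Qed.

Lemma sl2_rowE g n i : (i <= n)%N ->
  sl2_row g n i = \sum_(j < n.+1) sl2_coef g n i j *: 'X^j.
Proof.
move=> le_in; rewrite -[LHS]coefK poly_def.
rewrite (big_ord_widen _ (fun j => (sl2_row g n i)`_j *: 'X^j) (size_sl2_row g le_in)).
rewrite big_mkcond; apply: eq_bigr => j _; case: ltnP => // sz.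
by rewrite /sl2_coef nth_default ?scale0r.
Qed.

Definition dehom (q : {mpoly K[2]}) : {poly K} :=
  mmap (@polyC K) (fun i : 'I_2 => if i == 0 then 'X else 1) q.
HB.instance Definition _ := GRing.RMorphism.copy dehom
  (mmap (@polyC K) (fun i : 'I_2 => if i == 0 then 'X else 1)).
Lemma dehomZ c q : dehom (c *: q) = c *: dehom q.
Proof. by rewrite /dehom mmapZ mul_polyC. Qed.
Lemma dehom_linear : linear dehom.
Proof. by move=> a p q; rewrite rmorphD /= dehomZ. Qed.
HB.instance Definition _ := GRing.isLinear.Build K _ _ _ dehom dehom_linear.

Lemma dehomX (i : 'I_2) : dehom 'X_i = if i == 0 then 'X else 1.
Proof. by rewrite /dehom mmapX mmap1U. Qed.

Definition sym_mon n k : {mpoly K[2]} := 'X_0 ^+ k * 'X_1 ^+ (n - k).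

Lemma sym_mon_homog n k : (k <= n)%N -> sym_mon n k \is n.-homog.
Proof.
have Xh (i : 'I_2) j : ('X_i : {mpoly K[2]}) ^+ j \is j.-homog.
  by rewrite -[j in j.-homog]mul1n; apply: dhomogMn; rewrite dhomogX /= mdeg1.
by move=> kn; rewrite -[n in n.-homog](subnKC kn); apply: dhomogM.
Qed.

Lemma dehom_homog n (q : {mpoly K[2]}) : q \is n.-homog ->
  q = \sum_(k < n.+1) (dehom q)`_k *: sym_mon n k.
Proof.
move=> /dhomogP qh; rewrite [LHS]mpolyE.
under [RHS]eq_bigr => k _ do rewrite {1}[q]mpolyE raddf_sum coef_sum scaler_suml.
rewrite exchange_big; apply: eq_big_seq => m /qh /= mn /=.
have mn2 : (m 0%R + m 1%R = n)%N.
  rewrite -mn mdegE !big_ord_recl big_ord0 addn0.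
  by congr (m _ + m _)%N; apply/val_inj.
have Xm : 'X_[m] = sym_mon n (m 0).
  rewrite mpolyXE_id !big_ord_recl big_ord0 mulr1 /sym_mon -mn2 addKn.
  by congr (_ * 'X__ ^+ m _); apply/val_inj.
have m0 : (m 0%R < n.+1)%N by rewrite ltnS -mn2 leq_addr.
rewrite (bigD1 (Ordinal m0)) //= dehomZ Xm /sym_mon rmorphM !rmorphXn /= !dehomX /=.
rewrite expr1n mulr1 coefZ coefXn eqxx mulr1 big1 ?addr0 // => k.
by rewrite -val_eqE /= => /negPf km; rewrite coefZ coefXn km mulr0 scale0r.
Qed.

(** For k > n the monomial is not homogeneous of degree n, and the default 0 is taken. *)
Definition sym_e n k : dhomog 2 K n := insubd 0 (sym_mon n k).
Definition sym_co n k (f : dhomog 2 K n) : K := (dehom (val f))`_k.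

Lemma val_sym_e n k : (k <= n)%N -> val (sym_e n k) = sym_mon n k.
Proof. by move=> kn; rewrite val_insubd sym_mon_homog. Qed.

Lemma sym_co_linear n k : linear_for *%R (@sym_co n k).
Proof. by move=> a f h; rewrite /sym_co /= linearP coefD coefZ. Qed.

Lemma sym_co_e n k j : (k <= n)%N -> sym_co j (sym_e n k) = (j == k)%:R.
Proof.
move=> kn; rewrite /sym_co val_sym_e // /sym_mon rmorphM !rmorphXn /= !dehomX /=.
by rewrite expr1n mulr1 coefXn.
Qed.

Lemma sym_coP n (f : dhomog 2 K n) : f = \sum_(k < n.+1) sym_co k f *: sym_e n k.
Proof.
apply/val_inj; rewrite /= raddf_sum [LHS](dehom_homog (valP f)).
by apply: eq_bigr => k _ /=; rewrite val_sym_e // -ltnS.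
Qed.

Lemma sym_act_e g n i : (i <= n)%N ->
  sym_act g (sym_e n i) = \sum_(j < n.+1) sl2_coef g n i j *: sym_e n j.
Proof.
move=> le_in; rewrite [LHS]sym_coP; apply: eq_bigr => j _; congr (_ *: _).
rewrite /sym_co /sl2_coef /= val_sym_e //; congr (_`_j).
rewrite /sym_mon rmorphM !rmorphXn /= !comp_mpolyXU -!tnth_nth !tnth_mktuple.
rewrite rmorphM !rmorphXn /= !big_ord_recl !big_ord0 !addr0 !rmorphD /= !dehomZ !dehomX /=.
have -> : lift ord0 ord0 = 1 :> 'I_2 by apply/val_inj.
by rewrite -!mul_polyC !mulr1.
Qed.

End SymPowBasis.

(** * Matrix coefficients of symmetric powers and their invariant tensor *)

Section SL2Elements.
Variable K : fieldType.

Definition mx22 (a b c e : K) : 'M[K]_2 :=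
  \matrix_(i, j) if i == 0 then (if j == 0 then a else b)
                 else (if j == 0 then c else e).

Lemma det_mx2 (R : comNzRingType) (M : 'M[R]_2) :
  \det M = M 0 0 * M 1 1 - M 0 1 * M 1 0.
Proof.
rewrite (expand_det_row _ 0) !big_ord_recl big_ord0 addr0 /cofactor !det_mx11 !mxE.
have -> : lift ord0 ord0 = 1 :> 'I_2 by apply/val_inj.
rewrite expr0 expr1 mul1r mulN1r mulrN.
by congr (_ * M _ _ - _ * M _ _); apply/val_inj.
Qed.

Lemma det_mx22 a b c e : a * e - b * c = 1 -> \det (mx22 a b c e) == 1.
Proof. by rewrite det_mx2 !mxE => ->. Qed.

Definition sl2 a b c e (abce : a * e - b * c = 1) : SL2 K :=
  SL2Of (det_mx22 abce).

Lemma SL2_detE (g : SL2 K) :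
  SL2_mx g 0 0 * SL2_mx g 1 1 - SL2_mx g 0 1 * SL2_mx g 1 0 = 1.
Proof. by rewrite -det_mx2 (eqP (SL2_det g)). Qed.

Lemma sl2_rowS a b c e (abce : a * e - b * c = 1) n i :
  sl2_row (sl2 abce) n i =
  (a%:P * 'X + c%:P) ^+ i * (b%:P * 'X + e%:P) ^+ (n - i).
Proof. by rewrite /sl2_row /= !mxE. Qed.

Lemma sl2_row_diag a b (ab : a * b - 0 * 0 = 1) n i :
  sl2_row (sl2 ab) n i = (a ^+ i * b ^+ (n - i))%:P * 'X^i.
Proof.
rewrite sl2_rowS !rmorph0 mul0r add0r addr0 exprMn -!rmorphXn /= rmorphM /=.
by rewrite mulrAC.
Qed.

(** The coefficient of e_i tensor e_(n-i) in the invariant tensor of S^n tensor S^n. *)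
Definition sl2_sign n i : K := (-1) ^+ i * 'C(n, i)%:R.

(* The invariance of the n-th power of the determinant form, in coordinates. *)
Lemma sl2_coef_pairing (g : SL2 K) n (k l : 'I_n.+1) :
  \sum_(i < n.+1) sl2_sign n i * (sl2_coef g n i k * sl2_coef g n (n - i) l) =
  sl2_sign n k * (n - k == l)%N%:R.
Proof.
pose A := (SL2_mx g 0 0)%:P * 'X + (SL2_mx g 1 0)%:P.
pose B := (SL2_mx g 0 1)%:P * 'X + (SL2_mx g 1 1)%:P.
pose up := map_poly (@polyC K).
have sgn_poly (M N : {poly {poly K}}) : (M - N) ^+ n =
    \sum_(i < n.+1) (sl2_sign n i)%:P%:P * (N ^+ i * M ^+ (n - i)).
  rewrite exprBn; apply: eq_bigr => i _.
  rewrite /sl2_sign !rmorphM !rmorphXn !rmorphN1 !rmorph_nat -mulr_natr; ring.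
(* With s the inner and t the outer variable this is A(t) B(s) - A(s) B(t) = t - s, the invariance
   of the determinant form. The coefficients of s^k t^l in the n-th powers of the two sides are then
   compared. *)
have E : (B%:P * up A - A%:P * up B) = 'X - 'X%:P :> {poly {poly K}}.
  have := congr1 (fun x : K => x%:P%:P : {poly {poly K}}) (SL2_detE g).
  rewrite /up /A /B !rmorphB !rmorphD !rmorphM !rmorph1 /= !map_polyX !map_polyC /=.
  move: (_%:P%:P) (_%:P%:P) (_%:P%:P) (_%:P%:P) => a e b c abce.
  by rewrite -['X - _]mul1r -abce; ring.
have := sgn_poly (B%:P * up A) (A%:P * up B); rewrite E sgn_poly.
move/(congr1 (fun Q : {poly {poly K}} => Q`_l`_k)); rewrite !coef_sum /=.
have -> : \sum_(i < n.+1) ((sl2_sign n i)%:P%:P *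
    ('X%:P ^+ i * 'X ^+ (n - i)))`_l`_k = sl2_sign n k * (n - k == l)%N%:R.
  rewrite (bigD1 k) //= big1 ?addr0 => [|i ik].
    rewrite -rmorphXn /= mulrA -polyCM coefCM coefXn mulr_natr.
    rewrite eq_sym; case: eqVneq => _; rewrite ?mulr1n ?mulr0n ?coef0 ?mulr0 //.
    by rewrite coefCM coefXn eqxx.
  rewrite -rmorphXn /= mulrA -polyCM coefCM coefXn mulr_natr.
  case: eqVneq => _; rewrite ?mulr0n ?coef0 // mulr1n coefCM coefXn.
  by rewrite -val_eqE /= eq_sym in ik; rewrite (negPf ik) mulr0.
move=> ->; apply: eq_bigr => i _.
rewrite coefCM coefCM; congr (_ * _).
rewrite !exprMn mulrACA -!(rmorphXn (@polyC _)) -(rmorphM (@polyC _)) /=.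
rewrite -!(rmorphXn up) -(rmorphM up) /= coefCM coef_map /= coefMC.
by rewrite [B ^+ i * _]mulrC /sl2_coef /sl2_row subKn // -ltnS.
Qed.

(** Here [F] gives the values of a bilinear map on pairs of basis vectors, with values in any vector
    space, so that quadratic invariants and vector fields are covered at once. *)
Lemma sl2_pairing (V : lmodType K) (F : nat -> nat -> V) (g : SL2 K) n :
  \sum_(i < n.+1) sl2_sign n i *: (\sum_(k < n.+1) \sum_(l < n.+1)
    (sl2_coef g n i k * sl2_coef g n (n - i) l) *: F k l) =
  \sum_(k < n.+1) sl2_sign n k *: F k (n - k)%N.
Proof.
under eq_bigr do rewrite scaler_sumr.
rewrite exchange_big; apply: eq_bigr => k _ /=.
under eq_bigr do rewrite scaler_sumr.
rewrite exchange_big /=.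
have lt_nk : (n - k < n.+1)%N by rewrite ltnS leq_subr.
rewrite (bigD1 (Ordinal lt_nk)) //= [X in _ + X]big1 ?addr0 => [|l].
  under eq_bigr do rewrite scalerA.
  by rewrite -scaler_suml (sl2_coef_pairing g k (Ordinal lt_nk)) eqxx mulr1.
rewrite -val_eqE /= => nkl; under eq_bigr do rewrite scalerA.
by rewrite -scaler_suml sl2_coef_pairing eq_sym (negPf nkl) mulr0 scale0r.
Qed.

(** The equivariance of the multiplication from S^a tensor S^b to S^(a+b), in coordinates; [Phi] is
    the linear map sending the power s of the variable to [F s]. *)
Lemma sl2_coefM (V : lmodType K) (F : nat -> V) (g : SL2 K) a b i j :
  (i <= a)%N -> (j <= b)%N ->
  \sum_(s < (a + b).+1) sl2_coef g (a + b) (i + j) s *: F s =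
  \sum_(k < a.+1) \sum_(l < b.+1)
    (sl2_coef g a i k * sl2_coef g b j l) *: F (k + l)%N.
Proof.
move=> ia jb; pose Phi (p : {poly K}) := \sum_(s < (a + b).+1) p`_s *: F s.
have Phi_sum (I : Type) (r : seq I) (G : I -> {poly K}) :
    Phi (\sum_(k <- r) G k) = \sum_(k <- r) Phi (G k).
  rewrite /Phi exchange_big; apply: eq_bigr => s _.
  by rewrite coef_sum scaler_suml.
rewrite -[LHS]/(Phi (sl2_row g (a + b) (i + j))) sl2_rowM // !sl2_rowE //.
rewrite mulr_suml Phi_sum; apply: eq_bigr => k _.
rewrite mulr_sumr Phi_sum; apply: eq_bigr => l _.
rewrite -scalerAl -scalerAr scalerA -exprD.
have lt_kl : (k + l < (a + b).+1)%N by rewrite ltnS leq_add // -ltnS.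
rewrite /Phi (bigD1 (Ordinal lt_kl)) //= coefZ coefXn eqxx mulr1 big1 ?addr0 //.
by move=> s; rewrite -val_eqE /= => /negPf sl; rewrite coefZ coefXn sl mulr0 scale0r.
Qed.

Hypothesis charK : [pchar K] =i pred0.

(** S^n has no nonzero fixed vector for n > 0. The diagonal matrix with entries 2 and 1/2 leaves
    only the coordinate with 2i = n, and a unipotent matrix kills that one. *)
Lemma sl2_fixed_coef n (c : nat -> K) : (0 < n)%N ->
  (forall g j, (j <= n)%N -> \sum_(i < n.+1) c i * sl2_coef g n i j = c j) ->
  forall i, (i <= n)%N -> c i = 0.
Proof.
move=> n0 cfix.
have two0 : (2%:R : K) != 0 by apply: natr_neq0.
have two : (2%:R : K) * 2%:R^-1 - 0 * 0 = 1 by rewrite mulr0 subr0 mulfV.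
have c0 i : (i <= n)%N -> (i + i != n)%N -> c i = 0.
  move=> le_in iin; have lt_in : (i < n.+1)%N by [].
  have := cfix (sl2 two) i le_in.
  under eq_bigr => j _ do rewrite /sl2_coef sl2_row_diag coefCM coefXn.
  rewrite (bigD1 (Ordinal lt_in)) //= eqxx mulr1 big1 ?addr0; last first.
    by move=> j; rewrite -val_eqE /= eq_sym => /negPf ->; rewrite !mulr0.
  move/eqP; rewrite -subr_eq0 -[X in _ - X]mulr1 -mulrBr mulf_eq0 => /orP[/eqP->//|].
  rewrite exprVn subr_eq0 -(inj_eq (mulIf (expf_neq0 (n - i) two0))) mul1r.
  rewrite mulfVK ?expf_neq0 // -!natrX.
  by move/eqP/(natr_inj charK)/eqP; rewrite eqn_exp2l //; lia.
move=> i le_in; have [iin|] := eqVneq (i + i)%N n; last exact: c0.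
have uni : (1 : K) * 1 - 0 * 1 = 1 by rewrite mul0r subr0 mulr1.
(* For this unipotent element every coefficient at j = 0 is 1, so the sum of all c_i is c_0, which
   is already known to be 0. *)
have := cfix (sl2 uni) 0 (leq0n _).
have row j : sl2_row (sl2 uni) n j = ('X + 1) ^+ j.
  by rewrite sl2_rowS !rmorph0 !rmorph1 mul0r add0r mul1r expr1n mulr1.
under eq_bigr => j _ do rewrite /sl2_coef row -horner_coef0 hornerE !hornerE /=.
have lt_in : (i < n.+1)%N by [].
rewrite (bigD1 (Ordinal lt_in)) //= expr1n mulr1 big1 ?addr0; last first.
  move=> j; rewrite -val_eqE /= => ji.
  by rewrite c0 ?mul0r //; [rewrite -ltnS | apply: contra_neq ji; lia].
by move=> ->; apply: c0 => //; lia.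
Qed.

End SL2Elements.

(** * Copies of symmetric powers inside KY_d *)

Section Components.
Variables (K : fieldType) (d : nat).
Hypothesis charK : [pchar K] =i pred0.
Variable (rho : SL2 K -> 'rV[K]_d -> 'rV[K]_d).
Hypothesis rhoP : linear_action rho.
Local Notation S := {mpoly K[d]}.
Local Notation wr := (wr K d).
Implicit Types (g : SL2 K) (v : 'rV[K]_d) (e : nat -> 'rV[K]_d).
Implicit Types (x : nat -> 'I_d -> K).

Definition pairv v (xi : 'I_d -> K) := \sum_k v 0 k * xi k.

(** [e 0 .. e p] is the standard basis of a copy of S^p(K^2) in V and [x 0 ..
    x p] are the coordinate forms of a projection of V onto that copy. *)
Definition component p e x :=
  [/\ forall g i, (i <= p)%N ->
        rho g (e i) = \sum_(j < p.+1) sl2_coef g p i j *: e j,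
      forall i j, (i <= p)%N -> (j <= p)%N -> pairv (e j) (x i) = (i == j)%:R
    & (0 < p)%N -> forall v, rho_fixed rho v -> forall i, (i <= p)%N ->
        pairv v (x i) = 0].

Definition sub_basis p (inj : dhomog 2 K p -> 'rV[K]_d) i := inj (sym_e K p i).
Definition sub_coord p (prj : 'rV[K]_d -> dhomog 2 K p) i (k : 'I_d) :=
  sym_co i (prj (delta_mx 0 k)).

Lemma lin_sum (U W : lmodType K) (f : U -> W) (I : Type) (r : seq I)
    (c : I -> K) (u : I -> U) : linear f ->
  f (\sum_(i <- r) c i *: u i) = \sum_(i <- r) c i *: f (u i).
Proof.
move=> lf; have f0 : f 0 = 0 by have := lf (-1) 0 0; rewrite !scaleN1r !addNr.
by elim: r => [|i r IH]; rewrite ?big_nil // !big_cons lf IH.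
Qed.

Lemma sym_co_sum p j (I : Type) (r : seq I) (c : I -> K)
    (u : I -> dhomog 2 K p) :
  sym_co j (\sum_(i <- r) c i *: u i) = \sum_(i <- r) c i * sym_co j (u i).
Proof.
have lco := @sym_co_linear K p j; have co0 : @sym_co K p j 0 = 0.
  by have := lco (-1) 0 0; rewrite !scaleN1r !addNr mulN1r addNr.
by elim: r => [|i r IH]; rewrite ?big_nil // !big_cons lco IH.
Qed.

Lemma pairv_sub p (prj : 'rV[K]_d -> dhomog 2 K p) v i :
  linear prj -> pairv v (sub_coord prj i) = sym_co i (prj v).
Proof. by move=> lp; rewrite {2}(row_sum_delta v) (lin_sum _ _ _ lp) sym_co_sum. Qed.

(** The last clause of [component] holds because an equivariant projection maps fixed vectors to
    fixed vectors of S^p, which vanish for p > 0. *)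
Lemma component_sub p (inj : dhomog 2 K p -> 'rV[K]_d) prj :
  linear inj -> linear prj -> cancel inj prj ->
  (forall g w, inj (sym_act g w) = rho g (inj w)) ->
  (forall g v, prj (rho g v) = sym_act g (prj v)) ->
  component p (sub_basis inj) (sub_coord prj).
Proof.
move=> li lp injK ei ep; split=> [g i ip|i j ip jp|p0 v vfix i ip].
- by rewrite /sub_basis -ei sym_act_e // (lin_sum _ _ _ li).
- by rewrite pairv_sub // injK sym_co_e.
rewrite pairv_sub //.
apply: (@sl2_fixed_coef _ charK p (fun i => sym_co i (prj v))) => // g j jp.
rewrite -[in RHS](vfix g) ep {2}[prj v]sym_coP.
have la : linear (@sym_act K p g) by case: (@sym_actP K p).
rewrite (lin_sum _ _ _ la) sym_co_sum; apply: eq_bigr => k _; congr (_ * _).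
have kp : (k <= p)%N by rewrite -ltnS.
have lt_jp : (j < p.+1)%N by [].
rewrite sym_act_e // sym_co_sum (bigD1 (Ordinal lt_jp)) //= big1 ?addr0 => [|l].
  by rewrite sym_co_e // eqxx mulr1.
by rewrite -val_eqE /= eq_sym => /negPf lj; rewrite sym_co_e ?lj ?mulr0 // -ltnS.
Qed.

End Components.

(** * Isomorphisms of modules and rearrangement of direct sums *)

Section GModuleIso.
Variables (G : groupType) (K : fieldType).
Implicit Types M N P : gmodule G K.

Lemma gm_iso_refl M : gm_iso M M.
Proof. by exists id; split=> //; exists id. Qed.

Lemma gm_iso_inv M N : gm_iso M N -> exists (f : M -> N) (h : N -> M),
  [/\ linear f, linear h, cancel f h, cancel h f &
    (forall g v, f (gm_act g v) = gm_act g (f v)) /\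
    (forall g v, h (gm_act g v) = gm_act g (h v))].
Proof.
move=> [f [lf [h fK hK] ef]]; exists f, h; split=> //.
  by move=> a u v; apply: (can_inj fK); rewrite lf !hK.
by split=> // g v; apply: (can_inj fK); rewrite ef !hK.
Qed.

Lemma gm_iso_sym M N : gm_iso M N -> gm_iso N M.
Proof.
move=> /gm_iso_inv[f [h [lf lh fK hK [ef eh]]]].
by exists h; split=> //; exists f.
Qed.

Lemma gm_iso_trans N M P : gm_iso M N -> gm_iso N P -> gm_iso M P.
Proof.
move=> [f [lf bf ef]] [h [lh bh eh]]; exists (h \o f); split=> /=.
- by move=> a u v; rewrite /= lf lh.
- exact: bij_comp.
- by move=> g v; rewrite ef eh.
Qed.

Lemma gm_iso_sum M N P : gm_iso N P -> gm_iso (gm_sum M N) (gm_sum M P).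
Proof.
move=> /gm_iso_inv[f [h [lf lh fK hK [ef _]]]].
exists (fun v => (v.1, f v.2)); split=> /=.
- by move=> a [u1 u2] [v1 v2]; rewrite /= lf.
- by exists (fun v => (v.1, h v.2)) => -[v1 v2] /=; rewrite ?fK ?hK.
- by move=> g [v1 v2] /=; rewrite ef.
Qed.

Lemma gm_iso_sumCA M N P : gm_iso (gm_sum M (gm_sum N P)) (gm_sum N (gm_sum M P)).
Proof.
exists (fun v => (v.2.1, (v.1, v.2.2))); split=> /=.
- by move=> a [u1 [u2 u3]] [v1 [v2 v3]].
- by exists (fun v => (v.2.1, (v.1, v.2.2))) => -[v1 [v2 v3]].
- by move=> g [v1 [v2 v3]].
Qed.

Lemma gm_iso_sum0 M : gm_iso (gm_sum M (gm0 G K)) M.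
Proof.
exists fst; split=> [a [u1 u2] [v1 v2]||g [v1 v2]] //=.
exists (fun v => (v, 0)) => //= -[v1 v2] /=.
by congr pair; apply/rowP => -[].
Qed.

End GModuleIso.

Lemma sym_pow_sum_rem (K : fieldType) p ps : p \in ps ->
  gm_iso (sym_pow_sum K ps) (sym_pow_sum K (p :: rem p ps)).
Proof.
elim: ps => // q ps IH; rewrite inE /= eq_sym; case: eqVneq => [->|_] //= pps.
  exact: gm_iso_refl.
exact: gm_iso_trans (gm_iso_sum (sym_pow K q) (IH pps)) (gm_iso_sumCA _ _ _).
Qed.

Section ComponentsOfSum.
Variables (K : fieldType) (d : nat).
Hypothesis charK : [pchar K] =i pred0.
Variable (rho : SL2 K -> 'rV[K]_d -> 'rV[K]_d).
Hypothesis rhoP : linear_action rho.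

Lemma sum_component p M : gm_iso (GModule rhoP) (gm_sum (sym_pow K p) M) ->
  exists e x (h : M -> 'rV[K]_d), [/\ component rho p e x, linear h,
    forall g u, rho g (h u) = h (gm_act g u)
  & forall v, exists u, v - \sum_(i < p.+1) pairv v (x i) *: e i = h u].
Proof.
move=> /gm_iso_inv[f [h [lf lh fK hK [ef eh]]]].
pose inj (w : dhomog 2 K p) : 'rV[K]_d := h (w, 0).
pose prj (v : 'rV[K]_d) : dhomog 2 K p := (f v).1.
have linj : linear inj.
  by move=> a u v; rewrite /inj -lh; congr h; congr pair; rewrite /= scaler0 addr0.
have lprj : linear prj by move=> a u v; rewrite /prj lf.
exists (sub_basis inj), (sub_coord prj), (fun u => h (0, u)); split.
- apply: component_sub => //.
  + by move=> w; rewrite /inj /prj hK.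
  + move=> g w; rewrite -[rho g _]/(@gm_act _ _ (GModule rhoP) g (h (w, 0))) -eh.
    congr h; congr pair => /=; case: (gm_actP M) => la _ _.
    by have := la g (-1) 0 0; rewrite !scaleN1r !addNr.
  + by move=> g v; rewrite /prj -[rho g v]/(@gm_act _ _ (GModule rhoP) g v) ef.
- by move=> a u v; rewrite -lh; congr h; congr pair; rewrite /= scaler0 addr0.
- move=> g u; rewrite -[rho g _]/(@gm_act _ _ (GModule rhoP) g (h (0, u))) -eh.
  congr h; congr pair => /=; case: (gm_actP (sym_pow K p)) => la _ _.
  by have := la g (-1) 0 0; rewrite !scaleN1r !addNr.
move=> v; exists (f v).2; under eq_bigr do rewrite pairv_sub //.
rewrite -(lin_sum _ _ _ linj) -sym_coP /inj /prj -{1}[v]fK addrC -scaleN1r -lh.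
case: (f v) => w u; congr h; congr pair.
  by have : -1 *: w + w = 0 by rewrite scaleN1r addNr.
by have : -1 *: 0 + u = u by rewrite scaler0 add0r.
Qed.

Lemma sum_component2 p q M :
  gm_iso (GModule rhoP) (gm_sum (sym_pow K p) (gm_sum (sym_pow K q) M)) ->
  exists e x e' x', [/\ component rho p e x, component rho q e' x',
    forall i j, pairv (e' j) (x i) = 0 & forall i j, pairv (e j) (x' i) = 0].
Proof.
move=> /gm_iso_inv[f [h [lf lh fK hK [ef eh]]]].
have act0 (N : gmodule (SL2 K) K) g : @gm_act _ _ N g 0 = 0.
  case: (gm_actP N) => la _ _.
  by have := la g (-1) 0 0; rewrite !scaleN1r !addNr.
have zz (N : lmodType K) (a : K) : 0 = a *: 0 + 0 :> N by rewrite scaler0 addr0.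
pose inj (w : dhomog 2 K p) : 'rV[K]_d := h (w, (0, 0)).
pose prj (v : 'rV[K]_d) : dhomog 2 K p := (f v).1.
pose inj' (w : dhomog 2 K q) : 'rV[K]_d := h (0, (w, 0)).
pose prj' (v : 'rV[K]_d) : dhomog 2 K q := (f v).2.1.
have lprj : linear prj by move=> a u v; rewrite /prj lf.
have lprj' : linear prj' by move=> a u v; rewrite /prj' lf.
exists (sub_basis inj), (sub_coord prj), (sub_basis inj'), (sub_coord prj').
have co0 n i : @sym_co K n i 0 = 0 by rewrite /sym_co /= rmorph0 coef0.
split; last 2 first.
- by move=> i j; rewrite pairv_sub // /prj /sub_basis /inj' hK co0.
- by move=> i j; rewrite pairv_sub // /prj' /sub_basis /inj hK co0.
- apply: component_sub => //.
  + move=> a u v; rewrite /inj -lh; congr h.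
    by congr (_, (_, _)); exact: zz.
  + by move=> w; rewrite /inj /prj hK.
  + move=> g w; rewrite -[rho g _]/(@gm_act _ _ (GModule rhoP) g (h (w, (0, 0)))).
    by rewrite -eh; congr h; congr (_, (_, _)); rewrite [RHS](act0 (sym_pow K q), act0 M).
  + by move=> g v; rewrite /prj -[rho g v]/(@gm_act _ _ (GModule rhoP) g v) ef.
- apply: component_sub => //.
  + move=> a u v; rewrite /inj' -lh; congr h.
    by congr (_, (_, _)); exact: zz.
  + by move=> w; rewrite /inj' /prj' hK.
  + move=> g w; rewrite -[rho g _]/(@gm_act _ _ (GModule rhoP) g (h (0, (w, 0)))).
    by rewrite -eh; congr h; congr (_, (_, _)); rewrite [RHS](act0 (sym_pow K p), act0 M).
  + by move=> g v; rewrite /prj' -[rho g v]/(@gm_act _ _ (GModule rhoP) g v) ef.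
Qed.

End ComponentsOfSum.

(** * Explicit invariants *)

Section ExplicitInvariants.
Variables (K : fieldType) (d : nat).
Hypothesis charK : [pchar K] =i pred0.
Variable (rho : SL2 K -> 'rV[K]_d -> 'rV[K]_d).
Hypothesis rhoP : linear_action rho.
Local Notation S := {mpoly K[d]}.
Local Notation wr := (wr K d).
Implicit Types (g : SL2 K) (e : nat -> 'rV[K]_d) (x : nat -> 'I_d -> K).
Local Notation sign := (sl2_sign K).

Lemma mlin_homog v : mlin v \is [in K[d], 1.-homog].
Proof. by apply: rpred_sum => i _; apply: rpredZ; rewrite dhomogX /= mdeg1. Qed.

Definition biform p e e' : S :=
  \sum_(i < p.+1) sign p i *: (mlin (e i) * mlin (e' (p - i)%N)).
(** For odd p this is the Magnus image of half the sum of the [sign p i] [e_(p-i), e_i], that is,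
    the invariant symplectic form as a linear vector field. *)
Definition wedge_form p e : wr :=
  \sum_(i < p.+1) sign p i *: wr_mul (mlin (e (p - i)%N)) (wlin (e i)).
Definition hankel a b e : 'M[S]_(a.+1, b.+1) := \matrix_(i, j) mlin (e (i + j)%N).

Lemma sl2_sign_rev p i : (i <= p)%N -> sign p (p - i) = (-1) ^+ p * sign p i.
Proof.
move=> ip; rewrite /sl2_sign bin_sub // mulrA; congr (_ * _).
have -> : (-1) ^+ p = (-1) ^+ (p - i) * (-1) ^+ i :> K by rewrite -exprD subnK.
by rewrite -mulrA -expr2 sqrr_sign mulr1.
Qed.

Lemma sl2_sign_neq0 p i : (i <= p)%N -> sign p i != 0.
Proof.
move=> ip; rewrite /sl2_sign mulf_neq0 ?signr_eq0 //.
by rewrite -(prednK (_ : 0 < 'C(p, i))%N) ?bin_gt0 // natr_neq0.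
Qed.

Lemma component_msub p e x g i : component rho p e x -> (i <= p)%N ->
  msub (rho_basis rho g) (mlin (e i)) = \sum_(j < p.+1) sl2_coef g p i j *: mlin (e j).
Proof.
case=> eT _ _ ip; rewrite msub_rho // eT //.
by rewrite (lin_sum _ _ _ (@mlin_linear K d)).
Qed.

Lemma biform_inv p e x e' x' : component rho p e x -> component rho p e' x' ->
  poly_invariant rho (biform p e e').
Proof.
move=> ce ce' g.
rewrite /biform -[RHS](sl2_pairing (fun k l => mlin (e k) * mlin (e' l)) g).
rewrite raddf_sum; apply: eq_bigr => i _ /=; rewrite linearZ /=; congr (_ *: _).
have ip : (i <= p)%N by rewrite -ltnS.
rewrite rmorphM /= (component_msub _ ce) // (component_msub _ ce') ?leq_subr //.
rewrite mulr_suml; apply: eq_bigr => k _; rewrite mulr_sumr; apply: eq_bigr => l _.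
by rewrite -scalerAl -scalerAr scalerA.
Qed.

Lemma wedge_form_inv p e x : component rho p e x -> wr_invariant rho (wedge_form p e).
Proof.
move=> ce g; pose F k l : wr := wr_mul (mlin (e l)) (wlin (e k)).
rewrite /wedge_form -[RHS](sl2_pairing F g).
rewrite raddf_sum; apply: eq_bigr => i _ /=; rewrite linearZ_LR /=; congr (_ *: _).
have ip : (i <= p)%N by rewrite -ltnS.
rewrite wsub_mul (component_msub _ ce) ?leq_subr // wsub_rho //.
case: (ce) => eT _ _; rewrite eT // (lin_sum _ _ _ (@wlin_linear K d)).
apply/ffunP => m; rewrite ffunE !wr_sumE mulr_sumr; apply: eq_bigr => k _.
rewrite wr_sumE mulr_suml; apply: eq_bigr => l _.
by rewrite /F !ffunE -!mul_mpolyC mpolyCM; ring.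
Qed.

Lemma wr_lin_wedge_form p e : wr_lin (wedge_form p e) = 0.
Proof.
rewrite raddf_sum big1 // => i _ /=.
by rewrite linearZ_LR /= wr_lin_mul mlin_coef0 scale0r scaler0.
Qed.

(** Reversing the summation index changes the sign of each coefficient when p is odd, so the sum is
    its own negative. *)
Lemma wr_euler_wedge_form p e : odd p -> wr_euler (wedge_form p e) = 0.
Proof.
move=> po; rewrite raddf_sum /=.
under eq_bigr => i _ do rewrite linearZ_LR /= wr_euler_mul wr_euler_lin.
set s := \sum_(i < _) _; have s_opp : s = - s.
  rewrite {1}/s (reindex_inj rev_ord_inj) -sumrN; apply: eq_bigr => i _ /=.
  have ip : (i <= p)%N by rewrite -ltnS.
  rewrite subSS sl2_sign_rev // -signr_odd po expr1 mulN1r scaleNr subKn //.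
  by rewrite mulrC.
apply/eqP; have := natr_neq0 charK 1.
have : 2%:R *: s = 0 by rewrite scaler_nat mulr2n {1}s_opp addNr.
by move/eqP; rewrite scaler_eq0 => /orP[->|].
Qed.

Lemma biform_homog p e e' : biform p e e' \is 2.-homog.
Proof.
by apply: rpred_sum => i _; apply: rpredZ; apply: (@dhomogM _ _ _ 1 _ 1); apply: mlin_homog.
Qed.

Definition sl2_mx_on p g : 'M[S]_p.+1 :=
  \matrix_(i, j) (sl2_coef g p i j)%:MP.
Definition sign_mx p : 'M[S]_p.+1 :=
  \matrix_(i, j) ((p - i == j)%N%:R * sign p i)%:MP.

Lemma sl2_mx_on_form p g :
  (sl2_mx_on p g)^T *m sign_mx p *m sl2_mx_on p g = sign_mx p.
Proof.
apply/matrixP => k l; rewrite -mulmxA !mxE mulrC -(sl2_coef_pairing g) raddf_sum.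
apply: eq_bigr => i _; rewrite !mxE.
have lt_pi : (p - i < p.+1)%N by rewrite ltnS leq_subr.
rewrite (bigD1 (Ordinal lt_pi)) //= !mxE eqxx mul1r big1 ?addr0 => [|j].
  by rewrite -!mpolyCM; congr _%:MP; ring.
by rewrite -val_eqE /= !mxE eq_sym => /negPf ->; rewrite mul0r mpolyC0 mul0r.
Qed.

Lemma sign_mx_det_neq0 p : \det (sign_mx p) != 0.
Proof.
pose J' : 'M[S]_p.+1 := \matrix_(i, j) ((p - i == j)%N%:R * (sign p j)^-1)%:MP.
have JJ' : sign_mx p *m J' = 1%:M.
  apply/matrixP => i k; rewrite !mxE.
  have ip : (i <= p)%N by rewrite -ltnS.
  have lt_pi : (p - i < p.+1)%N by rewrite ltnS leq_subr.
  rewrite (bigD1 (Ordinal lt_pi)) //= !mxE eqxx mul1r big1 ?addr0 => [|j].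
    rewrite /= subKn // -mpolyCM val_eqE.
    case: eqVneq => [->|_]; last by rewrite mul0r mulr0 mpolyC0.
    by rewrite mul1r mulfV ?mpolyC1 // sl2_sign_neq0 // -ltnS.
  by rewrite -val_eqE /= !mxE eq_sym => /negPf ->; rewrite mul0r mpolyC0 mul0r.
have := congr1 determinant JJ'; rewrite det_mulmx det1 => dd.
by apply: contra_eq_neq dd => ->; rewrite mul0r eq_sym oner_neq0.
Qed.

(** Take determinants in [sl2_mx_on_form]. The square is what occurs below: the Hankel and
    transvectant determinants pick up this factor twice. *)
Lemma sl2_mx_on_det p g : \det (sl2_mx_on p g) * \det (sl2_mx_on p g) = 1.
Proof.
have := congr1 determinant (sl2_mx_on_form p g).
rewrite !det_mulmx det_tr mulrAC -[RHS]mul1r.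
exact/mulIf/sign_mx_det_neq0.
Qed.

Lemma hankel_sub a b e x g : component rho (a + b) e x ->
  map_mx (msub (rho_basis rho g)) (hankel a b e) =
  sl2_mx_on a g *m hankel a b e *m (sl2_mx_on b g)^T.
Proof.
move=> ce; apply/matrixP => i j; rewrite !mxE.
have ia : (i <= a)%N by rewrite -ltnS.
have jb : (j <= b)%N by rewrite -ltnS.
rewrite (component_msub _ ce) ?leq_add // (sl2_coefM (fun s => mlin (e s))) //.
rewrite exchange_big; apply: eq_bigr => l _; rewrite !mxE mulr_suml.
apply: eq_bigr => k _; rewrite !mxE -mul_mpolyC mpolyCM; ring.
Qed.

Lemma hankel_det_inv m e x : component rho (m + m) e x ->
  poly_invariant rho (\det (hankel m m e)).
Proof.
move=> ce g; rewrite -(det_map_mx (msub (rho_basis rho g))) (hankel_sub _ ce).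
rewrite !det_mulmx det_tr mulrAC.
by rewrite sl2_mx_on_det mul1r.
Qed.

(** The Gram matrix of the transvectant (f, f)_b. *)
Definition transvectant a b e : 'M[S]_a.+1 :=
  hankel a b e *m sign_mx b *m (hankel a b e)^T.

(** A group element acts on the Hankel matrix through its matrices on S^a and S^b; the latter is
    absorbed by the invariant form on S^b. *)
Lemma transvectant_det_inv a b e x : component rho (a + b) e x ->
  poly_invariant rho (\det (transvectant a b e)).
Proof.
move=> ce g.
have TJ : map_mx (msub (rho_basis rho g)) (sign_mx b) = sign_mx b.
  by apply/matrixP => i j; rewrite !mxE /msub comp_mpolyC.
rewrite -(det_map_mx (msub (rho_basis rho g))) /transvectant !map_mxM -map_trmx TJ.
rewrite (hankel_sub _ ce).
set Ta := sl2_mx_on a g; set Tb := sl2_mx_on b g; set H := hankel a b e.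
have -> : Ta *m H *m Tb^T *m sign_mx b *m (Ta *m H *m Tb^T)^T =
    Ta *m (H *m (Tb^T *m sign_mx b *m Tb) *m H^T) *m Ta^T.
  by rewrite !trmx_mul trmxK !mulmxA.
by rewrite sl2_mx_on_form 2!det_mulmx det_tr mulrAC sl2_mx_on_det mul1r.
Qed.

Lemma hankel_det_homog m e : \det (hankel m m e) \is m.+1.-homog.
Proof.
apply: rpred_sum => s _; rewrite -(rmorph_sign (@mpolyC d K)) mul_mpolyC.
apply: rpredZ.
have prod_homog r :
    \prod_(i <- r) hankel m m e i (perm.fun_of_perm s i) \is (size r).-homog.
  elim: r => [|i r IH]; first by rewrite big_nil dhomog1.
  by rewrite big_cons mxE /= -(add1n (size r)); apply: dhomogM IH; apply: mlin_homog.
have sz : size (index_enum 'I_m.+1) = m.+1.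
  by rewrite -[RHS]size_enum_ord enumT /index_enum; case: index_enum_key.
by have := prod_homog (index_enum 'I_m.+1); rewrite sz.
Qed.

End ExplicitInvariants.

(** * Infinitely generated cases *)

Lemma sum_ends (V : nmodType) p (F : nat -> V) : (0 < p)%N ->
  (forall i, (0 < i < p)%N -> F i = 0) -> \sum_(i < p.+1) F i = F 0%N + F p.
Proof.
case: p => // p _ F0; rewrite big_ord_recl big_ord_recr /= big1 ?add0r // => i _.
by apply: F0; rewrite /= ltnS ltn_ord.
Qed.

Section NotFinGen.
Variables (K : fieldType) (d : nat).
Hypothesis charK : [pchar K] =i pred0.
Variable (rho : SL2 K -> 'rV[K]_d -> 'rV[K]_d).
Hypothesis rhoP : linear_action rho.
Local Notation S := {mpoly K[d]}.
Local Notation wr := (wr K d).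
Implicit Types (g : SL2 K) (e : nat -> 'rV[K]_d) (x : nat -> 'I_d -> K).
Implicit Types (c : nat -> {poly K}) (h : S).
Local Notation sign := (sl2_sign K).

Definition cross_grad h1 h2 : wr :=
  wr_mul (mpoly_euler h2) (wgrad h1) - wr_mul (mpoly_euler h1) (wgrad h2).

Lemma mpoly_euler_coef0 h : (mpoly_euler h)@_0%MM = 0.
Proof.
by rewrite raddf_sum big1 // => i _; rewrite /= mcoeff0M mcoeff0X mul0r.
Qed.

Lemma wr_lin_cross_grad h1 h2 : wr_lin (cross_grad h1 h2) = 0.
Proof. by rewrite raddfB /= !wr_lin_mul !mpoly_euler_coef0 !scale0r subrr. Qed.

Lemma wr_euler_cross_grad h1 h2 : wr_euler (cross_grad h1 h2) = 0.
Proof. by rewrite raddfB /= !wr_euler_mul !wr_euler_grad mulrC subrr. Qed.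

Lemma cross_grad_inv h1 h2 : poly_invariant rho h1 -> poly_invariant rho h2 ->
  wr_invariant rho (cross_grad h1 h2).
Proof.
move=> I1 I2 g; rewrite raddfB /= !wsub_mul !wsub_grad -!mpoly_euler_sub.
by rewrite I1 I2.
Qed.

Lemma contract_cross_grad sg h1 h2 : contract sg (cross_grad h1 h2) =
  curve sg (mpoly_euler h2) * (curve sg h1)^`() -
  curve sg (mpoly_euler h1) * (curve sg h2)^`().
Proof. by rewrite raddfB /= !contract_mul !contract_grad. Qed.

Lemma curve_biform sg p e e' : curve sg (biform p e e') =
  \sum_(i < p.+1) sign p i *:
    (curve sg (mlin (e i)) * curve sg (mlin (e' (p - i)%N))).
Proof.
rewrite raddf_sum; apply: eq_bigr => i _ /=.
by rewrite curveZ rmorphM.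
Qed.

Lemma contract_wedge_form sg p e : contract sg (wedge_form p e) =
  \sum_(i < p.+1) sign p i *:
    (curve sg (mlin (e (p - i)%N)) * (curve sg (mlin (e i)))^`()).
Proof.
rewrite raddf_sum; apply: eq_bigr => i _ /=.
by rewrite linearZ_LR /= contract_mul contract_lin.
Qed.

(** The curve on which the basis forms of two components take the prescribed values [c] and [c']. A
    single component is treated with q = 0 and [x'] = 0. *)
Definition comp_curve p q x x' c c' (k : 'I_d) :=
  \sum_(s < p.+1) x s k *: c s + \sum_(s < q.+1) x' s k *: c' s.

Lemma curve_comp p q x x' c c' v :
  curve (comp_curve p q x x' c c') (mlin v) =
  \sum_(s < p.+1) pairv v (x s) *: c s + \sum_(s < q.+1) pairv v (x' s) *: c' s.
Proof.
have pairZ r (y : nat -> 'I_d -> K) b : \sum_(s < r.+1) pairv v (y s) *: b s =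
    \sum_k v 0 k *: (\sum_(s < r.+1) y s k *: b s) :> {poly K}.
  under [RHS]eq_bigr do rewrite scaler_sumr.
  rewrite exchange_big; apply: eq_bigr => s _; rewrite scaler_suml.
  by apply: eq_bigr => k _; rewrite scalerA.
rewrite curve_lin !pairZ -big_split; apply: eq_bigr => k _.
by rewrite /comp_curve scalerDr.
Qed.

Lemma curve_comp_l p q e x x' c c' i : component rho p e x ->
  (forall i j, pairv (e j) (x' i) = 0) -> (i <= p)%N ->
  curve (comp_curve p q x x' c c') (mlin (e i)) = c i.
Proof.
case=> _ ex _ ex' ip; rewrite curve_comp [X in _ + X]big1 ?addr0; last first.
  by move=> s _; rewrite ex' scale0r.
rewrite -ltnS in ip; rewrite (bigD1 (Ordinal ip)) //= ex // eqxx scale1r.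
rewrite big1 ?addr0 // => s; rewrite -val_eqE /= => /negPf si.
by rewrite ex ?si ?scale0r // -ltnS.
Qed.

Lemma comp_curveC p q x x' c c' k :
  comp_curve p q x x' c c' k = comp_curve q p x' x c' c k.
Proof. exact: addrC. Qed.

Lemma curve_comp_r p q e x x' c c' i : component rho q e x' ->
  (forall i j, pairv (e j) (x i) = 0) -> (i <= q)%N ->
  curve (comp_curve p q x x' c c') (mlin (e i)) = c' i.
Proof.
move=> ce ex iq; rewrite -(curve_comp_l p c' c ce ex iq) !curve_lin.
by apply: eq_bigr => k _; rewrite comp_curveC.
Qed.

(** A fixed vector has no coordinates in the first component because p > 0, and the second one
    contributes only constants. *)
Lemma curve_comp_fixed p q e x x' c c' v : component rho p e x -> (0 < p)%N ->
  (forall i, (i <= q)%N -> pairv v (x' i) = 0 \/ (size (c' i) <= 1)%N) ->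
  rho_fixed rho v -> (size (curve (comp_curve p q x x' c c') (mlin v)) <= 1)%N.
Proof.
move=> [_ _ fx] p0 fx' vf; rewrite curve_comp big1 ?add0r => [|s _]; last first.
  by rewrite fx ?scale0r // -ltnS.
apply: leq_trans (size_sum _ _ _) _; apply/bigmax_leqP => s _.
have [|->|] := fx' s; first by rewrite -ltnS.
  by rewrite scale0r size_poly0.
exact: leq_trans (size_scale_leq _ _).
Qed.

(** Values for a binary form with only its two extreme coefficients; on them the invariant pairings
    reduce to two terms. *)
Definition ends p (a b : {poly K}) i := if i == 0%N then a else if i == p then b else 0.

Lemma ends_mid p a b i : (0 < i < p)%N -> ends p a b i = 0.
Proof. by rewrite /ends; case: eqVneq => [->//|_]; case: eqVneq => [->|//]; rewrite ltnn andbF. Qed.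
Lemma ends_l p a b : ends p a b 0%N = a. Proof. by []. Qed.
Lemma ends_r p a b : (0 < p)%N -> ends p a b p = b.
Proof. by rewrite /ends; case: p => // p _; rewrite eqxx. Qed.

Lemma sl2_sign0 p : sign p 0 = 1. Proof. by rewrite /sl2_sign bin0 expr0 mulr1. Qed.
Lemma sl2_signn p : sign p p = (-1) ^+ p. Proof. by rewrite /sl2_sign binn mulr1. Qed.

Lemma sign_sum_ends p c c' : (0 < p)%N -> (forall i, (0 < i < p)%N -> c i = 0) ->
  \sum_(i < p.+1) sign p i *: (c i * c' (p - i)%N) =
  c 0%N * c' p + (-1) ^+ p *: (c p * c' 0%N).
Proof.
move=> p0 cm; rewrite (sum_ends (F := fun i => sign p i *: (c i * c' (p - i)%N))) //.
  by rewrite sl2_sign0 sl2_signn scale1r subn0 subnn.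
by move=> i ip; rewrite cm // mul0r scaler0.
Qed.

Lemma curve_biform_ends sg p e e' c c' : (0 < p)%N ->
  (forall i, (i <= p)%N -> curve sg (mlin (e i)) = c i) ->
  (forall i, (i <= p)%N -> curve sg (mlin (e' i)) = c' i) ->
  (forall i, (0 < i < p)%N -> c i = 0) ->
  curve sg (biform p e e') = c 0%N * c' p + (-1) ^+ p *: (c p * c' 0%N).
Proof.
move=> p0 ec ec' cm; rewrite curve_biform -sign_sum_ends //.
by apply: eq_bigr => i _; rewrite ec ?ec' ?leq_subr // -ltnS.
Qed.

Lemma contract_wedge_ends sg p e c : (0 < p)%N ->
  (forall i, (i <= p)%N -> curve sg (mlin (e i)) = c i) ->
  (forall i, (0 < i < p)%N -> c i = 0) ->
  contract sg (wedge_form p e) =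
  (c 0%N)^`() * c p + (-1) ^+ p *: ((c p)^`() * c 0%N).
Proof.
move=> p0 ec cm; rewrite contract_wedge_form.
rewrite -(@sign_sum_ends p (fun i => (c i)^`()) c) // => [|i ip].
  by apply: eq_bigr => i _; rewrite !ec ?leq_subr 1?mulrC // -ltnS.
by rewrite cm // deriv0.
Qed.

Lemma size_2X : size (2%:R *: 'X : {poly K}) = 2%N.
Proof. by rewrite size_scale ?size_polyX // natr_neq0. Qed.

Local Notation X := ('X : {poly K}).

(** The field is the symplectic form of V_p and the multiplier the quadratic invariant of V_q. On
    the curve with extreme values t and 1 in both components the multiplier is 2t, and the
    contraction of the field is 1. *)
Lemma odd_even_not_fin_gen p q e x e' x' :
  component rho p e x -> component rho q e' x' -> odd p -> ~~ odd q -> (0 < q)%N ->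
  (forall i j, pairv (e' j) (x i) = 0) -> (forall i j, pairv (e j) (x' i) = 0) ->
  ~ lie_fin_gen (free_metab_inv rho).
Proof.
move=> ce ce' po qe q0 e'x ex'; have p0 : (0 < p)%N by case: p po {ce}.
pose sg := comp_curve p q x x' (ends p X 1) (ends q X 1).
have ec i : (i <= p)%N -> curve sg (mlin (e i)) = ends p X 1 i by apply: curve_comp_l.
have ec' i : (i <= q)%N -> curve sg (mlin (e' i)) = ends q X 1 i.
  exact: curve_comp_r.
apply: (@not_fin_gen _ _ charK _ rhoP sg (biform q e' e') (wedge_form p e)).
- move=> v vf; apply: (curve_comp_fixed (e := e)) => // i iq.
  by case: ce' => _ _ fx; left; apply: fx.
- by apply: biform_inv; eassumption.
- rewrite (curve_biform_ends q0 ec' ec' (@ends_mid q X 1)) ends_l ends_r //.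
  by rewrite -signr_odd (negPf qe) expr0 scale1r mulr1 mul1r -mulr2n -scaler_nat size_2X.
- by apply: wedge_form_inv; eassumption.
- exact: wr_lin_wedge_form.
- exact: wr_euler_wedge_form.
apply: contract_neq0.
rewrite (contract_wedge_ends p0 ec (@ends_mid p X 1)) ends_l ends_r // derivX.
by rewrite derivC mul0r scaler0 addr0 mul1r oner_neq0.
Qed.

Lemma pairv0 (v : 'rV[K]_d) : pairv v (fun=> 0) = 0.
Proof. by rewrite /pairv big1 // => k _; rewrite mulr0. Qed.

(** The field is the symplectic form of V_p; the multiplier is the determinant of the quadratic form
    (f, f)_(p-1). *)
Lemma odd_not_fin_gen p e x : component rho p e x -> odd p -> (2 < p)%N ->
  ~ lie_fin_gen (free_metab_inv rho).
Proof.
move=> ce po p2; have p0 : (0 < p)%N by lia.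
pose sg := comp_curve p 0 x (fun _ _ => 0) (ends p X 1) (fun=> 0).
have ec i : (i <= p)%N -> curve sg (mlin (e i)) = ends p X 1 i.
  by apply: curve_comp_l => // *; apply: pairv0.
have p1 : (1 + p.-1)%N = p by lia.
have ce1 : component rho (1 + p.-1) e x by rewrite p1.
have odd1 : odd p.-1 = false by case: p po {p2 p0 sg ce ec p1 ce1} => //= p /negPf.
apply: (@not_fin_gen _ _ charK _ rhoP sg (\det (transvectant 1 p.-1 e)) (wedge_form p e)).
- by move=> v vf; apply: (curve_comp_fixed (e := e)) => // i _; right; rewrite size_poly0.
- by apply: transvectant_det_inv; eassumption.
- have hk i j : (i <= 1)%N -> (j <= p.-1)%N ->
      curve sg (mlin (e (i + j)%N)) = ends p X 1 (i + j).
    by move=> i1 jp; apply: ec; lia.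
  have tE (a b : 'I_2) : curve sg (transvectant 1 p.-1 e a b) =
      \sum_(j < p.-1.+1) sign p.-1 j *:
        (ends p X 1 (a + j)%N * ends p X 1 (b + (p.-1 - j))%N).
    rewrite /transvectant -mulmxA mxE rmorph_sum; apply: eq_bigr => j _.
    have lt_pj : (p.-1 - j < p.-1.+1)%N by rewrite ltnS leq_subr.
    rewrite !mxE rmorphM /= (bigD1 (Ordinal lt_pj)) //= !mxE eqxx mul1r.
    rewrite big1 ?addr0 => [|k]; last first.
      by rewrite -val_eqE /= !mxE eq_sym => /negPf ->; rewrite mul0r mpolyC0 mul0r.
    by rewrite mul_mpolyC curveZ !hk -?scalerAr //; rewrite -ltnS.
  have sE (a b : 'I_2) : curve sg (transvectant 1 p.-1 e a b) =
      ends p X 1 a * ends p X 1 (b + p.-1)%N + ends p X 1 (a + p.-1)%N * ends p X 1 b.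
    rewrite tE.
    pose F j := sign p.-1 j *: (ends p X 1 (a + j)%N * ends p X 1 (b + (p.-1 - j))%N).
    rewrite (sum_ends (F := F)) /F; last 2 first.
    - by lia.
    - move=> i ip; rewrite (@ends_mid p X 1 (a + i)) ?mul0r ?scaler0 //.
      by have := ltn_ord a; lia.
    rewrite sl2_sign0 sl2_signn -signr_odd odd1 expr0 !scale1r.
    by rewrite addn0 subn0 subnn addn0.
  (* Since p > 2, the indices 1 and p - 1 are interior and their values are 0. The Gram matrix has
     zero diagonal and both other entries t, hence determinant -t^2. *)
  rewrite det_mx2 rmorphB !rmorphM /= !sE /= add0n p1 ends_l ends_r //.
  rewrite (@ends_mid p X 1 1) ?(@ends_mid p X 1 p.-1); try lia.
  rewrite !mulr0 !mul0r !addr0 add0r mul0r sub0r mulr1 mul1r size_polyN -expr2.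
  by rewrite size_polyXn.
- by apply: wedge_form_inv; eassumption.
- exact: wr_lin_wedge_form.
- exact: wr_euler_wedge_form.
apply: contract_neq0.
rewrite (contract_wedge_ends p0 ec (@ends_mid p X 1)) ends_l ends_r // derivX.
by rewrite derivC mul0r scaler0 addr0 mul1r oner_neq0.
Qed.

(** The multiplier is the determinant of the two vectors; along the curve with values (t, 1) and (0,
    1) it equals t. *)
Lemma pair1_not_fin_gen e x e' x' :
  component rho 1 e x -> component rho 1 e' x' ->
  (forall i j, pairv (e' j) (x i) = 0) -> (forall i j, pairv (e j) (x' i) = 0) ->
  ~ lie_fin_gen (free_metab_inv rho).
Proof.
move=> ce ce' e'x ex'.
pose sg := comp_curve 1 1 x x' (ends 1 X 1) (ends 1 0 1).
have ec i : (i <= 1)%N -> curve sg (mlin (e i)) = ends 1 X 1 i by apply: curve_comp_l.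
have ec' i : (i <= 1)%N -> curve sg (mlin (e' i)) = ends 1 0 1 i.
  exact: curve_comp_r.
apply: (@not_fin_gen _ _ charK _ rhoP sg (biform 1 e e') (wedge_form 1 e)).
- move=> v vf; apply: (curve_comp_fixed (e := e)) => // i iq.
  by case: ce' => _ _ fx; left; apply: fx.
- by apply: biform_inv; eassumption.
- rewrite (curve_biform_ends _ ec ec' (@ends_mid 1 X 1)) // /ends /=.
  by rewrite mulr1 mulr0 scaler0 addr0 size_polyX.
- by apply: wedge_form_inv; eassumption.
- exact: wr_lin_wedge_form.
- exact: wr_euler_wedge_form.
apply: contract_neq0.
rewrite (contract_wedge_ends _ ec (@ends_mid 1 X 1)) // /ends /= derivX.
by rewrite derivC mul0r scaler0 addr0 mul1r oner_neq0.
Qed.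

Lemma curve_euler_biform sg p e e' :
  curve sg (mpoly_euler (biform p e e')) = 2%:R *: curve sg (biform p e e').
Proof. by rewrite (mpoly_euler_homog (biform_homog _ _ _)) curveZ. Qed.

(** The second invariant is the linear form of V_0 if q = 0 and the quadratic form of V_q otherwise.
    It is a nonzero constant along the curve, so the contracted field is a nonzero multiple of the
    derivative of the first invariant 2t. *)
Lemma even_not_fin_gen2 p q e x e' x' :
  component rho p e x -> component rho q e' x' ->
  ~~ odd p -> (0 < p)%N -> ~~ odd q ->
  (forall i j, pairv (e' j) (x i) = 0) -> (forall i j, pairv (e j) (x' i) = 0) ->
  ~ lie_fin_gen (free_metab_inv rho).
Proof.
move=> ce ce' pe p0 qe e'x ex'.
pose sg := comp_curve p q x x' (ends p X 1) (ends q 1 1).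
have ec i : (i <= p)%N -> curve sg (mlin (e i)) = ends p X 1 i by apply: curve_comp_l.
have ec' i : (i <= q)%N -> curve sg (mlin (e' i)) = ends q 1 1 i.
  exact: curve_comp_r.
pose h2 := if q == 0%N then mlin (e' 0%N) else biform q e' e'.
have I2 : poly_invariant rho h2.
  rewrite /h2; case: eqP => [q0 g|_]; last by apply: biform_inv; eassumption.
  rewrite (component_msub rhoP g ce') // q0 big_ord1 /sl2_coef /sl2_row !expr0 mul1r.
  by rewrite coef1 scale1r.
have [k k0 [h2E h2C]] : exists2 k : K, k != 0 &
    curve sg (mpoly_euler h2) = k%:P /\ (curve sg h2)^`() = 0.
  rewrite /h2; case: eqP => [q0|/eqP].
    exists 1; first exact: oner_neq0.
    by rewrite (mpoly_euler_homog (mlin_homog _)) scale1r ec' //= derivC.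
  rewrite -lt0n => q0.
  have b2 : curve sg (biform q e' e') = 2%:R%:P.
    rewrite (curve_biform_ends q0 ec' ec' (@ends_mid q 1 1)) ends_l ends_r //.
    by rewrite -signr_odd (negPf qe) expr0 scale1r mulr1 -mulr2n rmorph_nat.
  exists (2%:R * 2%:R); first by rewrite mulf_neq0 // natr_neq0.
  by rewrite curve_euler_biform b2 derivC scale_polyC.
have b1 : curve sg (biform p e e) = 2%:R *: X.
  rewrite (curve_biform_ends p0 ec ec (@ends_mid p X 1)) ends_l ends_r //.
  by rewrite -signr_odd (negPf pe) expr0 scale1r mulr1 mul1r -mulr2n scaler_nat.
apply: (@not_fin_gen _ _ charK _ rhoP sg (biform p e e) (cross_grad (biform p e e) h2)).
- move=> v vf; apply: (curve_comp_fixed (e := e)) => // i iq.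
  case: (posnP q) => [q0|q0]; last by case: ce' => _ _ fx; left; apply: fx.
  by right; move: iq; rewrite q0 leqn0 => /eqP ->; rewrite size_poly1.
- by apply: biform_inv; eassumption.
- by rewrite b1 size_2X.
- apply: cross_grad_inv => //; apply: biform_inv; eassumption.
- exact: wr_lin_cross_grad.
- exact: wr_euler_cross_grad.
apply: contract_neq0.
rewrite contract_cross_grad h2E h2C mulr0 subr0 b1 derivZ derivX mul_polyC scalerA.
by rewrite scaler_eq0 oner_eq0 orbF mulf_neq0 // natr_neq0.
Qed.

(* Compare the orders of vanishing at 0. *)
Lemma order_neq0 (A B : {poly K}) (a b : K) : b != 0 -> A.[0] != 0 ->
  root B 0 -> B != 0 -> a != 0 -> a *: B * A^`() - b *: A * B^`() != 0.
Proof.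
move=> b0 A0 Br B0 a0; have [k [C]] := multiplicity_XsubC B 0.
rewrite B0 /= subr0 => Cr BE; case: k BE => [|k] BE.
  by move: Br; rewrite BE expr0 mulr1 (negPf Cr).
have C0 : C.[0] != 0 by [].
have -> : a *: B * A^`() - b *: A * B^`() =
    (a *: (C * X * A^`()) - b *: (A * C^`() * X) - (b *+ k.+1) *: (A * C)) * X ^+ k.
  have bk : (b *+ k.+1)%:P = b%:P * k.+1%:R :> {poly K}.
    by rewrite mulr_natr; apply: (raddfMn (@polyC K)).
  rewrite BE derivM derivXn /= -!mul_polyC bk -(mulr_natr (X ^+ k)) exprS; ring.
rewrite mulf_neq0 ?expf_neq0 ?polyX_eq0 //.
have : (a *: (C * X * A^`()) - b *: (A * C^`() * X) - (b *+ k.+1) *: (A * C)).[0] != 0.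
  rewrite !hornerE /= !(mulr0, mul0r, oppr0, add0r) oppr_eq0.
  by rewrite -mulr_natr !mulf_neq0 // natr_neq0.
by apply: contra_neq => ->; rewrite horner0.
Qed.

(** The two invariants are the quadratic form A and the catalecticant B. The curve has middle value
    t, extreme values 1 - t and all others 0. At t = 0 it gives A = 2 and B = 0, and at t = 1 it
    gives B nonzero; comparison of vanishing orders at 0 shows that the contracted field is
    nonzero. *)
Lemma even_not_fin_gen m e x : component rho (m + m) e x -> (1 < m)%N ->
  ~ lie_fin_gen (free_metab_inv rho).
Proof.
move=> ce m1; set p := (m + m)%N in ce *; have p0 : (0 < p)%N by rewrite /p; lia.
pose c i : {poly K} := if i == m then X else ends p (1 - X) (1 - X) i.
pose sg := comp_curve p 0 x (fun _ _ => 0) c (fun=> 0).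
have ec i : (i <= p)%N -> curve sg (mlin (e i)) = c i.
  by apply: curve_comp_l => // *; apply: pairv0.
pose A := curve sg (biform p e e); pose N := hankel m m e; pose B := curve sg (\det N).
have A0 : A.[0] = 2%:R.
  rewrite /A curve_biform horner_sum.
  pose F i := (sign p i *: (c i * c (p - i)%N)).[0].
  rewrite (eq_bigr (fun i : 'I_p.+1 => F i)) => [|i _]; last first.
    by rewrite !ec ?leq_subr // -ltnS.
  rewrite (sum_ends (F := F)) // => [|i ip]; rewrite /F.
    have mp : (p == m) = false by rewrite /p; lia.
    have m0 : (0 == m)%N = false by lia.
    rewrite sl2_sign0 sl2_signn subn0 subnn /c m0 mp ends_l ends_r // scale1r.
    rewrite -signr_odd /p addnn odd_double expr0 scale1r !hornerE /=.
    by rewrite subr0 mulr1.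
  rewrite /c ends_mid //; case: eqP => _; last by rewrite mul0r scaler0 horner0.
  by rewrite hornerZ hornerM hornerX mul0r mulr0.
have cN t (i j : 'I_m.+1) : (curve sg (N i j)).[t] = (c (i + j)%N).[t].
  by rewrite mxE ec // leq_add // -ltnS.
have BE t : B.[t] = \det (\matrix_(i < m.+1, j < m.+1) (c (i + j)%N).[t]).
  rewrite /B -[_.[t]]/(horner_eval t _) -det_map_mx -det_map_mx; congr (\det _).
  by apply/matrixP => i j; rewrite !mxE -cN mxE.
have B0 : root B 0.
  (* Row 1 of the Hankel matrix has the indices 1 to m + 1, all interior because m > 1; at t = 0
     their values vanish. *)
  rewrite rootE BE; have lt1 : (1 < m.+1)%N by lia.
  rewrite (expand_det_row _ (Ordinal lt1)) big1 // => j _; rewrite mxE /c /=.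
  have jm := ltn_ord j; case: eqP => _; first by rewrite hornerX mul0r.
  by rewrite ends_mid ?horner0 ?mul0r // /p; lia.
have Bn0 : B != 0.
  have : B.[1] != 0.
    rewrite BE; set M := \matrix_(i, j) _.
    (* At t = 1 only the antidiagonal survives, with entries 1; this matrix is its own inverse. *)
    have ME (i j : 'I_m.+1) : M i j = (m - i == j)%N%:R.
      rewrite mxE /c; have := ltn_ord i; have := ltn_ord j => jm im.
      case: eqP => ij; first by rewrite hornerX (_ : (m - i == j)%N) //; lia.
      rewrite (_ : (m - i == j)%N = false); last lia.
      by rewrite /ends; do 2?case: eqP => _; rewrite ?hornerE ?subrr.
    have MM : M *m M = 1%:M.
      apply/matrixP => i k; rewrite !mxE.
      have lt_mi : (m - i < m.+1)%N by rewrite ltnS leq_subr.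
      rewrite (bigD1 (Ordinal lt_mi)) //= !ME eqxx mul1r big1 ?addr0 => [|j].
        by rewrite /= subKn -?val_eqE // -ltnS.
      by rewrite -val_eqE /= ME eq_sym => /negPf ->; rewrite mul0r.
    have := congr1 determinant MM; rewrite det_mulmx det1 => dd.
    by apply: contra_eq_neq dd => ->; rewrite mul0r eq_sym oner_neq0.
  by apply: contra_neq => ->; rewrite horner0.
apply: (@not_fin_gen _ _ charK _ rhoP sg (\det N) (cross_grad (biform p e e) (\det N))).
- by move=> v vf; apply: (curve_comp_fixed (e := e)) => // i _; right; rewrite size_poly0.
- by apply: hankel_det_inv; eassumption.
- rewrite ltnNge; apply/negP => /size1_polyC BC; have /eqP := B0.
  by rewrite -/B in BC; rewrite BC hornerC => b0; move: Bn0; rewrite BC b0 eqxx.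
- apply: cross_grad_inv; first by apply: biform_inv; eassumption.
  by apply: hankel_det_inv; eassumption.
- exact: wr_lin_cross_grad.
- exact: wr_euler_cross_grad.
apply: contract_neq0.
rewrite contract_cross_grad curve_euler_biform (mpoly_euler_homog (hankel_det_homog _ _)).
rewrite curveZ -/A -/N -/B; apply: order_neq0 => //; rewrite ?A0 natr_neq0 //.
Qed.

End NotFinGen.

(** * Finitely generated cases *)

Section Points.
Variables (K : fieldType) (d : nat).
Hypothesis charK : [pchar K] =i pred0.
Variable (rho : SL2 K -> 'rV[K]_d -> 'rV[K]_d).
Hypothesis rhoP : linear_action rho.
Local Notation S := {mpoly K[d]}.
Local Notation wr := (wr K d).
Implicit Types (g : SL2 K) (v : 'rV[K]_d) (xi : 'I_d -> K) (q : S) (w : wr).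
Implicit Types (e : nat -> 'rV[K]_d) (x : nat -> 'I_d -> K).

Lemma curve_horner (sg : 'I_d -> {poly K}) q t :
  (curve sg q).[t] = q.@[fun k => (sg k).[t]].
Proof.
rewrite /curve /mmap horner_sum mevalE; apply: eq_bigr => m _.
rewrite hornerCM /mmap1 horner_prod; congr (_ * _).
by apply: eq_bigr => i _; rewrite horner_exp.
Qed.

(* A polynomial vanishing on K^d has vanishing partial derivatives, hence
   vanishing coefficients in characteristic 0. *)
Lemma mpoly_eval0 q : (forall xi, q.@[xi] = 0) -> q = 0.
Proof.
have deriv0 p i : (forall xi, p.@[xi] = 0) -> forall xi, p^`M(i).@[xi] = 0.
  move=> p0 xi; pose sg k : {poly K} := (xi k)%:P + (k == i)%:R *: 'X.
  have c0 : curve sg p = 0 by apply: (poly_eval0 charK) => t; rewrite curve_horner.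
  have := contract_grad sg p; rewrite c0 deriv0 /contract (bigD1 i) //= ffunE.
  rewrite /sg eqxx derivD derivC derivZ derivX add0r scale1r mulr1 big1 => [|k].
    rewrite addr0 => /(congr1 (fun r => r.[0])); rewrite curve_horner horner0.
    move=> <-; apply: meval_eq => k.
    by rewrite !hornerE ?mulr0 ?addr0.
  by move=> /negPf ki; rewrite ki scale0r addr0 derivC mulr0.
move=> q0; apply/mpolyP => m; rewrite mcoeff0; elim/mnm_ind: m q q0 => [|i m IH] q q0.
  rewrite -(q0 (fun=> 0)) mevalE [q in LHS]mpolyE raddf_sum.
  apply: eq_bigr => m _ /=; rewrite mcoeffZ mcoeffX; congr (_ * _).
  have [->|/mnm_neq0[i mi]] := eqVneq m 0%MM.
    by rewrite big1 // => i _; rewrite mnm0E.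
  by rewrite (bigD1 i) //= expr0n (negPf mi) mul0r.
have /eqP := IH _ (deriv0 _ i q0); rewrite mcoeff_deriv addmC.
by rewrite -mulr_natr mulf_eq0 (negPf (natr_neq0 charK _)) orbF => /eqP.
Qed.

Definition weval w xi : 'rV[K]_d := \row_j (w j).@[xi].
(** The transposed action on points of the dual: the value of [v] at [rpoint g xi] is the value of
    [rho g v] at [xi]. *)
Definition rpoint g xi : 'I_d -> K := fun i => pairv (rho_basis rho g i) xi.

Lemma weval_eq w xi xi' : xi =1 xi' -> weval w xi = weval w xi'.
Proof. by move=> e; apply/rowP => j; rewrite !mxE; apply: meval_eq. Qed.

Lemma pairv_linear xi : linear_for *%R (fun v : 'rV[K]_d => pairv v xi).
Proof.
move=> a u v; rewrite /pairv mulr_sumr -big_split; apply: eq_bigr => i _ /=.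
by rewrite !mxE mulrDl mulrA.
Qed.

Lemma pairv_sum xi (I : Type) (r : seq I) (c : I -> K) (u : I -> 'rV[K]_d) :
  pairv (\sum_(i <- r) c i *: u i) xi = \sum_(i <- r) c i * pairv (u i) xi.
Proof.
have p0 : pairv (0 : 'rV[K]_d) xi = 0.
  by rewrite /pairv big1 // => k _; rewrite mxE mul0r.
by elim: r => [|i r IH]; rewrite ?big_nil // !big_cons pairv_linear IH.
Qed.

Lemma pairvD u v xi : pairv (u + v) xi = pairv u xi + pairv v xi.
Proof. by have := pairv_linear xi 1 u v; rewrite scale1r mul1r. Qed.

Lemma pairvZ a v xi : pairv (a *: v) xi = a * pairv v xi.
Proof. by rewrite /pairv mulr_sumr; apply: eq_bigr => k _; rewrite mxE mulrA. Qed.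

Lemma meval_lin v xi : (mlin v).@[xi] = pairv v xi.
Proof.
rewrite raddf_sum; apply: eq_bigr => i _ /=.
by rewrite mevalZ mevalXU.
Qed.

Lemma pairv_rpoint g xi v : pairv v (rpoint g xi) = pairv (rho g v) xi.
Proof. by rewrite -row_subst_rho // pairv_sum. Qed.

Lemma pairv_delta i xi : pairv (delta_mx 0 i) xi = xi i.
Proof.
rewrite /pairv (bigD1 i) //= mxE !eqxx mul1r big1 ?addr0 // => k /negPf ki.
by rewrite mxE ki andbF mul0r.
Qed.

Lemma weval_inv w g xi : wr_invariant rho w ->
  weval w xi = rho g (weval w (rpoint g xi)).
Proof.
move=> wI; apply/rowP => j; rewrite mxE -{1}(wI g) wsubE -row_subst_rho // summxE.
rewrite raddf_sum; apply: eq_bigr => i _ /=.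
rewrite mevalM mevalC comp_mpoly_meval !mxE; congr (_ * _).
by apply: meval_eq => k; rewrite tnth_mktuple meval_lin.
Qed.

Lemma meval_wr_euler w xi : (wr_euler w).@[xi] = pairv (weval w xi) xi.
Proof.
rewrite raddf_sum; apply: eq_bigr => i _ /=.
by rewrite mevalM mevalXU mxE mulrC.
Qed.

Lemma rho_eq0 g v : rho g v = 0 -> v = 0.
Proof.
case: (rhoP) => _ r1 rM /(congr1 (rho g^-1%g)).
by rewrite -rM mulVg r1 rho_0.
Qed.

Lemma pairv_rho p e x g v j : component rho p e x ->
  v = \sum_(i < p.+1) pairv v (x i) *: e i -> (j <= p)%N ->
  pairv (rho g v) (x j) = \sum_(i < p.+1) pairv v (x i) * sl2_coef g p i j.
Proof.
move=> [eT ex _] vE jp; rewrite {1}vE rho_sum // pairv_sum; apply: eq_bigr => i _.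
have ip : (i <= p)%N by rewrite -ltnS.
rewrite eT // pairv_sum; congr (_ * _); rewrite -ltnS in jp.
rewrite (bigD1 (Ordinal jp)) //= ex // eqxx mulr1 big1 ?addr0 // => k.
by rewrite -val_eqE /= eq_sym => /negPf kj; rewrite ex ?kj ?mulr0 // -ltnS.
Qed.

(** A value of [w] at a nonzero multiple of the middle coordinate form is fixed by the torus, so
    only its middle coordinate can be nonzero, and the Euler equation kills that one. Equivariance
    carries the vanishing along orbits, and density extends it to all points. *)
Lemma sym2_wr_invariant0 e x w : component rho 2 e x ->
  (forall v, v = \sum_(i < 3) pairv v (x i) *: e i) ->
  wr_invariant rho w -> wr_euler w = wr_lin w -> w = 0.
Proof.
move=> ce eE wI wE; have [eT ex fx] := ce.
have sum3 (V : nmodType) (F : nat -> V) : \sum_(i < 3) F i = F 0%N + (F 1%N + F 2).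
  by rewrite !big_ord_recl big_ord0 addr0.
have v0 v : (forall i, (i <= 2)%N -> pairv v (x i) = 0) -> v = 0.
  by move=> vx; rewrite (eE v) big1 // => i _; rewrite vx ?scale0r // -ltnS.
have lin0 : wr_lin w = 0.
  rewrite wr_lin_coef0 (v0 (wr_coef0 w)) ?raddf0 // => i ip.
  by apply: fx => //; apply: wr_invariant_coef0.
have we0 xi : pairv (weval w xi) xi = 0 by rewrite -meval_wr_euler wE lin0 meval0.
have x1E v j : (j <= 2)%N -> forall g, pairv (rho g v) (x j) =
    \sum_(i < 3) pairv v (x i) * sl2_coef g 2 i j.
  by move=> j2 g; apply: (pairv_rho _ ce).
have two0 : (2%:R : K) != 0 by apply: natr_neq0.
have two : (2%:R : K) * 2%:R^-1 - 0 * 0 = 1 by rewrite mulr0 subr0 mulfV.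
have torus v j : (j <= 2)%N -> pairv (rho (sl2 two) v) (x j) =
    pairv v (x j) * (2%:R ^+ j * 2%:R^-1 ^+ (2 - j)).
  move=> j2; rewrite x1E //; have lt_j3 : (j < 3)%N by [].
  rewrite (bigD1 (Ordinal lt_j3)) //= big1 ?addr0 => [|k].
    by rewrite /sl2_coef sl2_row_diag coefCM coefXn eqxx mulr1.
  rewrite -val_eqE /= eq_sym => /negPf kj.
  by rewrite /sl2_coef sl2_row_diag coefCM coefXn kj !mulr0.
have mid (c : K) : c != 0 -> weval w (fun k => c * x 1%N k) = 0.
  move=> c0; set xi := fun k => _; set u := weval w xi.
  have pxi v : pairv v xi = c * pairv v (x 1%N).
    by rewrite /pairv mulr_sumr; apply: eq_bigr => k _; rewrite /xi; ring.
  have uE : u = rho (sl2 two) u.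
    rewrite {1}/u (weval_inv (sl2 two) _ wI); congr rho; apply: weval_eq => k.
    rewrite -pairv_delta pairv_rpoint pxi torus // expr1 expr1 mulfV // mulr1.
    by rewrite pairv_delta.
  have three0 : (3%:R : K) != 0 by apply: natr_neq0.
  apply: v0 => -[|[|[|//]]] _.
  - have := congr1 (fun v => pairv v (x 0%N)) uE; rewrite /= torus //= expr0 mul1r exprVn.
    move/(congr1 (fun a => a * 2%:R ^+ 2)); rewrite mulfVK ?expf_neq0 //.
    move/eqP; rewrite -subr_eq0 -[X in _ - X]mulr1 -mulrBr mulf_eq0 => /orP[/eqP->//|].
    by rewrite (_ : 2%:R ^+ 2 - 1 = 3%:R) ?(negPf three0) //; ring.
  - have := we0 xi; rewrite -/u pxi => /eqP; rewrite mulf_eq0 (negPf c0).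
    by move/eqP.
  - have := congr1 (fun v => pairv v (x 2)) uE; rewrite /= torus //= expr0 mulr1.
    move/eqP; rewrite -subr_eq0 -[X in X - _]mulr1 -mulrBr mulf_eq0 => /orP[/eqP->//|].
    rewrite -opprB oppr_eq0 (_ : 2%:R ^+ 2 - 1 = 3%:R) ?(negPf three0) //; ring.
(* The forms p, q, z(2q - zp), with z any parameter, are those in the orbits of
   the multiples of the middle coordinate form. *)
have orbit (p q z : K) : p != 0 -> z * p - q != 0 ->
    weval w (fun k => p * x 0%N k + q * x 1%N k + z * (2%:R * q - z * p) * x 2 k) = 0.
  (* The element g has rows (z, 1) and (zu - 1, u). It carries c times the middle form to the form
     with coordinates 2cu, c(2zu - 1), 2cz(zu - 1), which are p, q, z(2q - zp) because 2cu = p. *)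
  move=> p0; set c := z * p - q => c0; pose u := p / (2%:R * c).
  have det1 : z * u - 1 * (z * u - 1) = 1 by ring.
  pose g := sl2 det1.
  have := mid c c0; rewrite (weval_inv g _ wI) => /rho_eq0 <-.
  apply: weval_eq => k; rewrite -[RHS]pairv_delta pairv_rpoint.
  have -> v : pairv v (fun k => c * x 1%N k) = c * pairv v (x 1%N).
    by rewrite /pairv mulr_sumr; apply: eq_bigr => l _; ring.
  rewrite x1E // (sum3 _ (fun i => pairv _ (x i) * sl2_coef g 2 i 1)).
  rewrite !pairv_delta /sl2_coef !sl2_rowS.
  have coef1M (A B : {poly K}) : (A * B)`_1 = A`_0 * B`_1 + A`_1 * B`_0.
    by rewrite coefM !big_ord_recl big_ord0 addr0.
  have lin_coef a b : (a%:P * 'X + b%:P : {poly K})`_0 = b /\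
      (a%:P * 'X + b%:P : {poly K})`_1 = a.
    by rewrite !coefD !coefCM !coefX !coefC /= mulr0 mulr1 add0r addr0.
  have [l0 l1] := lin_coef z (z * u - 1); have [m0 m1] := lin_coef 1 u.
  rewrite /= expr0 expr1 mul1r mulr1 !expr2 !coef1M l0 l1 m0 m1.
  have two_cu : 2%:R * c * u = p by rewrite /u mulrC divfK // mulf_neq0.
  have qE : q = z * p - c by rewrite /c; ring.
  by rewrite qE -two_cu; ring.
have wp xi j : pairv (e 0%N) xi != 0 -> (w j).@[xi] = 0.
  set p := pairv _ _ => p0; set q := pairv (e 1%N) xi.
  pose sg k : {poly K} := (p * x 0%N k + q * x 1%N k)%:P + x 2 k *: 'X.
  pose Q : {poly K} := (2%:R * q) *: 'X - p *: 'X^2.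
  have QE z : Q.[z] = z * (2%:R * q - z * p) by rewrite !hornerE /=; ring.
  (* For fixed p and q the third coordinate reached is Q(z); the factor pz - q takes care of the
     excluded value of z. As Q is not constant, the restriction of w_j to the line of all third
     coordinates vanishes. *)
  have R0 : (curve sg (w j) \Po Q) * (p *: 'X - q%:P) = 0.
    apply: (poly_eval0 charK) => z; rewrite hornerM horner_comp curve_horner.
    have [->|pq] := eqVneq (p *: 'X - q%:P).[z] 0; first by rewrite mulr0.
    rewrite -[X in X * _](_ : 0 = _) ?mul0r //.
    have := orbit p q z p0; rewrite !hornerE in pq; rewrite mulrC => /(_ pq).
    move/(congr1 (fun u : 'rV[K]_d => u 0 j)); rewrite !mxE => <-.
    apply: meval_eq => k; rewrite /sg QE !hornerE /=; ring.
  have szQ : (1 < size Q)%N.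
    have sz2 : size (- (p *: 'X^2) : {poly K}) = 3%N.
      by rewrite size_polyN size_scale // size_polyXn.
    rewrite /Q addrC size_polyDl sz2 //.
    by apply: leq_ltn_trans (size_scale_leq _ _) _; rewrite size_polyX.
  have lin_neq0 : p *: 'X - q%:P != 0 :> {poly K}.
    apply/negP => /eqP/(congr1 (fun r : {poly K} => r`_1)).
    by rewrite coefB coefZ coefX coefC coef0 /= mulr1 subr0 => /eqP; rewrite (negPf p0).
  move/eqP: R0; rewrite mulf_eq0 (negPf lin_neq0) orbF comp_poly_eq0 // => /eqP R0.
  have := congr1 (fun r => r.[pairv (e 2) xi]) R0; rewrite horner0 curve_horner => <-.
  apply: meval_eq => k; rewrite !hornerE -[xi k]pairv_delta (eE (delta_mx 0 k)).
  rewrite pairv_sum (sum3 _ (fun i => pairv _ (x i) * pairv (e i) xi)).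
  by rewrite !pairv_delta /p /q; ring.
apply/ffunP => j; rewrite ffunE; apply/eqP.
(* Multiplication by the first coordinate form covers the points where it vanishes. *)
have : mlin (e 0%N) * w j = 0.
  apply: mpoly_eval0 => xi; rewrite mevalM meval_lin.
  by have [->|/wp ->] := eqVneq (pairv (e 0%N) xi) 0; rewrite ?mul0r ?mulr0.
move/eqP; rewrite mulf_eq0 => /orP[/eqP e0|//].
have := ex 0%N 0%N isT isT; rewrite -meval_lin e0 meval0 => /eqP.
by rewrite eq_sym oner_eq0.
Qed.

End Points.

Section FinGen.
Variables (K : fieldType) (d : nat).
Hypothesis charK : [pchar K] =i pred0.
Variable (rho : SL2 K -> 'rV[K]_d -> 'rV[K]_d).
Hypothesis rhoP : linear_action rho.
Local Notation S := {mpoly K[d]}.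
Local Notation wr := (wr K d).
Implicit Types (g : SL2 K) (v : 'rV[K]_d) (xi : 'I_d -> K) (q : S) (w : wr).
Implicit Types (e : nat -> 'rV[K]_d) (x : nat -> 'I_d -> K).

Lemma lie_span_inv (s : seq (free_metab K d)) :
  (forall u, u \in s -> wr_invariant rho (magnus u)) ->
  forall f, lie_span [set` s]%classic f -> free_metab_inv rho f.
Proof.
move=> sI f; elim=> {f} [u su||a u v _ IHu _ IHv|u v _ IHu _ IHv];
  apply/(metab_invP charK) => //.
- exact: sI.
- by rewrite raddf0 => g; rewrite raddf0.
- move=> g; rewrite linearP linearP /=.
  by move/(metab_invP charK): IHu => ->; move/(metab_invP charK): IHv => ->.
- move=> g; rewrite magnus_br wsub_br.
  by move/(metab_invP charK): IHu => ->; move/(metab_invP charK): IHv => ->.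
Qed.

Lemma sym2_fin_gen e x : component rho 2 e x ->
  (forall v, v = \sum_(i < 3) pairv v (x i) *: e i) ->
  lie_fin_gen (free_metab_inv rho).
Proof.
move=> ce eE; exists [::]; apply/predeqP => f; split; last exact: lie_span_inv.
move=> /(metab_invP charK) fI.
have f0 := sym2_wr_invariant0 charK rhoP ce eE fI (magnus_euler f).
have -> : f = 0 by apply: (magnus_inj charK); rewrite f0 raddf0.
exact: LieSpan0.
Qed.

(** * Generators for V_1 + V_0 + ... + V_0 *)

Section Sym1.
Variables (e : nat -> 'rV[K]_d) (x : nat -> 'I_d -> K).
Hypothesis ce : component rho 1 e x.
Let pi0 v := v - (pairv v (x 0%N) *: e 0%N + pairv v (x 1%N) *: e 1%N).
Hypothesis pi0_fixed : forall v, rho_fixed rho (pi0 v).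

Let pairv_e i j : (i <= 1)%N -> (j <= 1)%N -> pairv (e j) (x i) = (i == j)%:R.
Proof. by case: ce => _ ex _; apply: ex. Qed.

Let pairv_pi0 v i : (i <= 1)%N -> pairv (pi0 v) (x i) = 0.
Proof. by case: ce => _ _ fx ip; apply: fx. Qed.

Let pi0_linear : linear pi0.
Proof.
move=> a u v; rewrite /pi0 !pairv_linear.
by apply/rowP => k; rewrite !mxE; ring.
Qed.

Let pi0K v : pi0 (pi0 v) = pi0 v.
Proof. by rewrite {1}/pi0 !pairv_pi0 // !scale0r addr0 subr0. Qed.

Let P0 i := pi0 (delta_mx 0 i).

Let row_subst_P0 v : row_subst P0 v = pi0 v.
Proof. by rewrite {2}(row_sum_delta v) (lin_sum _ _ _ pi0_linear). Qed.

Let decomp v : v = pairv v (x 0%N) *: e 0%N + pairv v (x 1%N) *: e 1%N + pi0 v.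
Proof. by rewrite addrC subrK. Qed.

(* Evaluation of the two coordinates of the nontrivial summand at (1, 0). *)
Let tau q : S := q \mPo [tuple (x 0%N i)%:MP + mlin (P0 i) | i < d].
Let base_point xi i := x 0%N i + pairv (P0 i) xi.

Let meval_tau q xi : (tau q).@[xi] = q.@[base_point xi].
Proof.
rewrite comp_mpoly_meval; apply: meval_eq => k.
by rewrite tnth_mktuple mevalD mevalC meval_lin.
Qed.

Let pairv_base v xi : pairv v (base_point xi) = pairv v (x 0%N) + pairv (pi0 v) xi.
Proof.
rewrite -row_subst_P0 pairv_sum -big_split; apply: eq_bigr => k _ /=.
by rewrite mulrDr.
Qed.

Let msub_tau q : msub P0 (tau q) = tau q.
Proof.
apply/eqP; rewrite -subr_eq0; apply/eqP; apply: (mpoly_eval0 charK) => xi.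
rewrite mevalB comp_mpoly_meval !meval_tau; apply/eqP; rewrite subr_eq0; apply/eqP.
apply: meval_eq => i; rewrite /base_point; congr (_ + _).
rewrite -[P0 i in RHS]pi0K -row_subst_P0 pairv_sum; apply: eq_bigr => k _.
by rewrite tnth_mktuple meval_lin.
Qed.

Let omega := wedge_form 1 e.
(** At the base point, [coef w] is the second V_1-coordinate of the value of [w], and [part w] is
    the projection of that value to the trivial summands. *)
Let coef w : S := \sum_i (x 1%N i)%:MP * tau (w i).
Let part w : wr := \sum_i wr_mul (tau (w i)) (wlin (P0 i)).

Let msub_coef w : msub P0 (coef w) = coef w.
Proof.
rewrite raddf_sum; apply: eq_bigr => i _ /=.
by rewrite rmorphM /= msub_tau /msub comp_mpolyC.
Qed.

Let wsub_part w : wsub P0 (part w) = part w.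
Proof.
rewrite raddf_sum; apply: eq_bigr => i _ /=.
by rewrite wsub_mul msub_tau wsub_lin row_subst_P0 pi0K.
Qed.

Let coef_pair g (i j : nat) : (i <= 1)%N -> (j <= 1)%N ->
  sl2_coef g 1 i j = if i == 0%N then (if j == 0%N then SL2_mx g 1 1 else SL2_mx g 0 1)
                     else (if j == 0%N then SL2_mx g 1 0 else SL2_mx g 0 0).
Proof.
rewrite /sl2_coef /sl2_row; case: i j => [|[|//]] [|[|//]] _ _ /=;
by rewrite ?expr0 ?expr1 ?mul1r ?mulr1 coefD coefCM coefX coefC /=
  ?mulr0 ?mulr1 ?add0r ?addr0.
Qed.

Let rho_e g i : (i <= 1)%N ->
  rho g (e i) = sl2_coef g 1 i 0 *: e 0%N + sl2_coef g 1 i 1 *: e 1%N.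
Proof.
by case: ce => eT _ _ ip; rewrite eT // !big_ord_recl big_ord0 addr0.
Qed.

Let rho_decomp g v : rho g v = pairv v (x 0%N) *: rho g (e 0%N) +
  pairv v (x 1%N) *: rho g (e 1%N) + pi0 v.
Proof.
rewrite {1}(decomp v).
have rD u u' : rho g (u + u') = rho g u + rho g u'.
  by have := rho_linear rhoP g 1 u u'; rewrite !scale1r.
have rZ a u : rho g (a *: u) = a *: rho g u.
  by have := rho_linear rhoP g a u 0; rewrite !addr0 rho_0 // addr0.
by rewrite 2!rD !rZ pi0_fixed.
Qed.

Let pairv_rho1 g v xi : pairv (rho g v) xi =
  pairv v (x 0%N) * (SL2_mx g 1 1 * pairv (e 0%N) xi + SL2_mx g 0 1 * pairv (e 1%N) xi) +
  pairv v (x 1%N) * (SL2_mx g 1 0 * pairv (e 0%N) xi + SL2_mx g 0 0 * pairv (e 1%N) xi) +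
  pairv (pi0 v) xi.
Proof.
rewrite rho_decomp !rho_e // !coef_pair //=; move: (pi0 v) => u.
by rewrite !pairvD !pairvZ !pairvD !pairvZ.
Qed.

(** Both sides are compared at points where the form e_0 does not vanish, a dense set. Such a point
    is moved to its base point by the group, so the value of [w] there is determined by its value at
    the base point. *)
Let wr_invariant_decomp w : wr_invariant rho w ->
  w = part w - wr_mul (coef w) omega.
Proof.
move=> wI; pose w' := part w - wr_mul (coef w) omega.
have omegaE xi j : (omega j).@[xi] =
    pairv (e 1%N) xi * e 0%N 0 j - pairv (e 0%N) xi * e 1%N 0 j.
  rewrite /omega /wedge_form !big_ord_recl big_ord0 addr0 !ffunE raddfD /=.
  rewrite !mevalZ !mevalM !mevalC !meval_lin /sl2_sign /=.
  by rewrite bin0 binn expr0 expr1 !mulr1 mul1r mulN1r.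
have partE xi : weval (part w) xi = pi0 (weval w (base_point xi)).
  rewrite -row_subst_P0; apply/rowP => j; rewrite mxE wr_sumE raddf_sum summxE.
  apply: eq_bigr => i _ /=.
  by rewrite !ffunE mevalM mevalC meval_tau !mxE.
have coefE xi : (coef w).@[xi] = pairv (weval w (base_point xi)) (x 1%N).
  rewrite raddf_sum; apply: eq_bigr => i _ /=.
  by rewrite mevalM mevalC meval_tau mxE mulrC.
have pi0_e i : (i <= 1)%N -> pi0 (e i) = 0.
  move=> ip; rewrite /pi0 !pairv_e //.
  by case: i ip => [|[|//]] _; rewrite scale1r scale0r ?addr0 ?add0r subrr.
have pair0 xi : pairv 0 xi = 0 by rewrite -[0](scale0r 0) pairvZ mul0r.
have base_e xi i : (i <= 1)%N -> pairv (e i) (base_point xi) = (i == 0%N)%:R.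
  by move=> ip; rewrite pairv_base pi0_e // pair0 addr0 pairv_e // eq_sym.
have base_pi0 v xi : pairv (pi0 v) (base_point xi) = pairv (pi0 v) xi.
  by rewrite pairv_base pairv_pi0 // add0r pi0K.
have uni : (1 : K) * 1 - 1 * 0 = 1 by rewrite mulr0 subr0 mulr1.
(* The unipotent element fixes the base point, hence the value of [w] there; comparing second
   coordinates shows that the first one vanishes. *)
have base0 xi : pairv (weval w (base_point xi)) (x 0%N) = 0.
  set u := weval w _; have uE : u = rho (sl2 uni) u.
    rewrite {1}/u (weval_inv rhoP (sl2 uni) _ wI); congr rho; apply: weval_eq => k.
    rewrite -[LHS]pairv_delta -[RHS]pairv_delta pairv_rpoint // pairv_rho1.
    by rewrite [in RHS]pairv_base !base_e // base_pi0 !mxE /=; ring.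
  have := congr1 (fun v => pairv v (x 1%N)) uE; rewrite pairv_rho1.
  rewrite pairv_pi0 // !pairv_e // !mxE /= => /eqP; rewrite -subr_eq0 => /eqP uE1.
  by rewrite -[RHS]oppr0 -uE1; ring.
have eval_eq xi j : pairv (e 0%N) xi != 0 -> (w j).@[xi] = (w' j).@[xi].
  set a := pairv _ _ => a0; pose b := pairv (e 1%N) xi.
  (* The matrix with rows (a, 0) and (-b, 1/a) sends the V_1-coordinates (a, b) of [xi] to (1,
     0). *)
  have det1 : a * a^-1 - 0 * (- b) = 1 by rewrite mul0r subr0 mulfV.
  pose g := sl2 det1; set u := weval w (base_point xi).
  have wE : weval w xi = rho g u.
    rewrite (weval_inv rhoP g _ wI); congr rho; apply: weval_eq => k.
    rewrite -[LHS]pairv_delta -[RHS]pairv_delta pairv_rpoint // pairv_rho1.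
    by rewrite pairv_base !mxE /= -/a -/b mulVf //; ring.
  have := congr1 (fun v : 'rV[K]_d => v 0 j) wE; rewrite mxE => ->.
  rewrite rho_decomp base0 scale0r add0r rho_e // !coef_pair //= !mxE /=.
  have := congr1 (fun v : 'rV[K]_d => v 0 j) (partE xi); rewrite mxE => partEj.
  rewrite /w' !ffunE raddfB /= partEj mevalM coefE omegaE -/a -/b -/u !mxE; ring.
apply/ffunP => j; apply/eqP; rewrite -subr_eq0; apply/eqP.
have : mlin (e 0%N) * (w j - w' j) = 0.
  apply: (mpoly_eval0 charK) => xi; rewrite mevalM meval_lin mevalB.
  have [->|/eval_eq ->] := eqVneq (pairv (e 0%N) xi) 0; first by rewrite mul0r.
  by rewrite subrr mulr0.
move/eqP; rewrite mulf_eq0 => /orP[/eqP e0|/eqP//].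
have := pairv_e (leq0n 1) (leq0n 1); rewrite -meval_lin e0 meval0 => /eqP.
by rewrite eq_sym oner_eq0.
Qed.

(** Generators are the preimage of the symplectic form [omega] and the projections of the y_i to the
    trivial summands. Brackets with the latter multiply [omega] by arbitrary polynomials in the
    trivial variables; the remaining part of an invariant lies in the subalgebra that the
    projections generate. *)
Lemma sym1_fin_gen : lie_fin_gen (free_metab_inv rho).
Proof.
pose fo := magnus_inv omega.
have foE : magnus fo = omega.
  apply: (magnus_invK charK).
  by rewrite (wr_euler_wedge_form charK) // wr_lin_wedge_form.
pose s := fo :: map (fun i => free_metab_lin (P0 i)) (enum 'I_d).
have s_lin i : free_metab_lin (P0 i) \in s.
  by rewrite inE (map_f (fun i => free_metab_lin (P0 i))) ?mem_enum ?orbT.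
exists s; apply/predeqP => f; split; last first.
  apply: lie_span_inv => u; rewrite inE => /orP[/eqP ->|/mapP[i _ ->]] g.
    by rewrite foE; apply: wedge_form_inv; eassumption.
  by rewrite magnus_lin wsub_rho // pi0_fixed.
move=> /(metab_invP charK) fI.
have mul_span q : exists2 h, lie_span [set` s]%classic h &
    magnus h = wr_mul (msub P0 q) omega.
  elim/mpolyind: q => [|c m q _ _ [h hs hE]].
    exists 0; first exact: LieSpan0.
    by rewrite !raddf0; apply/ffunP => i; rewrite !ffunE mul0r.
  have [hm hms hmE] : exists2 hm, lie_span [set` s]%classic hm &
      magnus hm = wr_mul (msub P0 'X_[m]) omega.
    elim/mnm_ind: m => [|i m [hm hms hmE]].
      exists fo; first by apply: LieSpan_gen; rewrite /= inE eqxx.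
      by rewrite foE mpolyX0 rmorph1; apply/ffunP => i; rewrite ffunE mul1r.
    exists (lbr (free_metab_lin (P0 i)) hm).
      by apply: LieSpan_br => //; apply: LieSpan_gen; apply: s_lin.
    rewrite magnus_br magnus_lin hmE mpolyXD rmorphM /= msubX.
    apply/ffunP => j; rewrite wr_lbrE wr_lin_mul wr_lin_wedge_form scaler0 mul0r subr0.
    by rewrite wr_lin_lin !ffunE mulrA.
  exists (c *: hm + h); first exact: LieSpanP.
  rewrite linearP /= hmE hE linearP; apply/ffunP => j.
  by rewrite !ffunE mulrDl scalerAl.
have [h hs hE] := mul_span (coef (magnus f)); rewrite msub_coef in hE.
have dec := wr_invariant_decomp fI.
pose f0 := magnus_inv (part (magnus f)).
(* As the sum of two Magnus images, [part] satisfies the Euler equation and so comes from an element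
   of F_d. *)
have partE : part (magnus f) = magnus f + magnus h by rewrite hE {2}dec subrK.
have f0E : magnus f0 = part (magnus f).
  apply: (magnus_invK charK); rewrite partE -raddfD /=.
  exact: magnus_euler.
(* The substitution [P0] fixes [f0], since it fixes its image; hence [f0] is a Lie polynomial in the
   projected generators. *)
have f0_span : lie_span [set` s]%classic f0.
  have -> : f0 = metab_sub P0 f0.
    by apply: (magnus_inj charK); rewrite magnus_sub f0E wsub_part.
  have mF := @free_metabP K d.
  have lin := free_metab_eval_linear (fun i => free_metab_lin (P0 i)) mF.
  elim/free_metab_ind: f0 {f0E} => [|a u v IHu IHv|i|u v IHu IHv].
  - have := lin (-1) 0 0; rewrite !scaleN1r !addNr -/(metab_sub P0 0) => ->.
    exact: LieSpan0.
  - by rewrite /metab_sub lin; apply: LieSpanP.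
  - by rewrite /metab_sub free_metab_eval_gen //; apply: LieSpan_gen; apply: s_lin.
  - by rewrite /metab_sub free_metab_eval_br //; apply: LieSpan_br.
have -> : f = -1 *: h + f0.
  apply: (magnus_inj charK); rewrite raddfD /= f0E partE linearZ_LR /= scaleN1r.
  by rewrite addrCA addNr addr0.
exact: LieSpanP.
Qed.

End Sym1.
End FinGen.

(** * Case distinction over the summands *)

Lemma sym_pow0_trivial (K : fieldType) (g : SL2 K) (f : sym_pow K 0) :
  gm_act g f = f.
Proof.
rewrite /= [f in LHS]sym_coP [RHS]sym_coP.
have la : linear (@sym_act K 0 g) by case: (@sym_actP K 0).
rewrite (lin_sum _ _ _ la); apply: eq_bigr => i _; congr (_ *: _).
rewrite ord1 sym_act_e // big_ord1 /sl2_coef /sl2_row !expr0 mul1r coef1.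
by rewrite scale1r.
Qed.

Lemma sym_pow_sum0_trivial (K : fieldType) k (g : SL2 K)
    (f : sym_pow_sum K (nseq k 0)) : gm_act g f = f.
Proof.
elim: k f => [//|k IH] [f1 f2] /=.
by rewrite -[sym_act g f1]/(@gm_act _ _ (sym_pow K 0) g f1) sym_pow0_trivial IH.
Qed.

Lemma sym_pow_sum_fin_gen (K : fieldType) (d : nat)
    (rho : SL2 K -> 'rV[K]_d -> 'rV[K]_d) (rhoP : linear_action rho) :
  [pchar K] =i pred0 ->
  (exists k : nat, gm_iso (GModule rhoP) (sym_pow_sum K (1 :: nseq k 0)))
  \/ gm_iso (GModule rhoP) (sym_pow K 2) ->
  lie_fin_gen (free_metab_inv rho).
Proof.
move=> charK [[k]|] iso.
  have [e [x [h [ce _ eh vh]]]] := sum_component charK iso.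
  apply: (sym1_fin_gen charK rhoP ce) => v g; have [u] := vh v.
  rewrite !big_ord_recl big_ord0 addr0 => ->.
  by rewrite eh sym_pow_sum0_trivial.
have iso2 := gm_iso_trans iso (gm_iso_sym (gm_iso_sum0 (sym_pow K 2))).
have [e [x [h [ce lh _ vh]]]] := sum_component charK iso2.
apply: (sym2_fin_gen charK rhoP ce) => v; have [u /eqP] := vh v.
have -> : u = 0 by apply/rowP => -[].
have -> : h 0 = 0 by have := lh (-1) 0 0; rewrite !scaleN1r !addNr.
by rewrite subr_eq0 => /eqP.
Qed.

(** No odd p > 2 can occur. If 1 occurs, any other nonzero summand is excluded: an odd one would be
    a second V_1, and an even one is ruled out beside V_1. Otherwise all p_i are even, a positive
    one must be the only summand, and it cannot exceed 2. *)
Lemma sym_pow_sum_not_fin_gen (K : fieldType) (d : nat)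
    (rho : SL2 K -> 'rV[K]_d -> 'rV[K]_d) (rhoP : linear_action rho) ps :
  [pchar K] =i pred0 -> ps <> nseq (size ps) 0 ->
  gm_iso (GModule rhoP) (sym_pow_sum K ps) ->
  lie_fin_gen (free_metab_inv rho) ->
  (exists k : nat, gm_iso (GModule rhoP) (sym_pow_sum K (1 :: nseq k 0)))
  \/ gm_iso (GModule rhoP) (sym_pow K 2).
Proof.
move=> charK ps0 iso fg.
have rem_iso p : p \in ps ->
    gm_iso (GModule rhoP) (gm_sum (sym_pow K p) (sym_pow_sum K (rem p ps))).
  by move=> pps; apply: gm_iso_trans iso (sym_pow_sum_rem K pps).
have no_odd3 p : p \in ps -> odd p -> (2 < p)%N -> False.
  move=> /rem_iso/(sum_component charK)[e [x [_ [ce _ _ _]]]] po p2.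
  exact: (odd_not_fin_gen charK rhoP ce po p2 fg).
have all0P qs : ~~ has (predC1 0%N) qs -> qs = nseq (size qs) 0%N.
  by rewrite has_predC negbK => /all_pred1P.
have [ps1|ps1] := boolP (1%N \in ps).
  have iso1 := rem_iso _ ps1.
  have [/hasP[q qps q0]|/all0P remE] := boolP (has (predC1 0%N) (rem 1%N ps)); last first.
    by left; exists (size (rem 1%N ps)); rewrite /= -remE.
  have iso2 := gm_iso_trans iso1 (gm_iso_sum (sym_pow K 1) (sym_pow_sum_rem K qps)).
  have [e [x [e' [x' [ce ce' e'x ex']]]]] := sum_component2 charK iso2.
  have [qo|qe] := boolP (odd q).
    have q1 : q = 1%N.
      have := no_odd3 q (mem_rem qps) qo.
      by case: q qo {q0 iso2 ce' qps} => [|[|[|q]]] // _ /(_ isT).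
    rewrite q1 in ce'.
    by case: (pair1_not_fin_gen charK rhoP ce ce' e'x ex' fg).
  case: (odd_even_not_fin_gen charK rhoP ce ce' isT qe _ e'x ex' fg).
  by rewrite lt0n.
have even_ps p : p \in ps -> ~~ odd p.
  move=> pps; apply/negP => po; have := no_odd3 p pps po.
  by case: p po pps => [|[|[|p]]] //; [rewrite (negPf ps1) | move=> _ _ /(_ isT)].
have [/hasP[p pps p0]|/all0P//] := boolP (has (predC1 0%N) ps).
have iso1 := rem_iso _ pps; have pe := even_ps _ pps; rewrite /= -lt0n in p0.
case remE : (rem p ps) iso1 => [|q qs] iso1.
  have [p2|p2] := eqVneq p 2%N.
    by right; rewrite -p2; apply: gm_iso_trans iso1 (gm_iso_sum0 _).
  have [e [x [_ [ce _ _ _]]]] := sum_component charK iso1.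
  have pE : p = (p./2 + p./2)%N by rewrite addnn even_halfK.
  rewrite pE in ce; case: (even_not_fin_gen charK rhoP ce _ fg).
  by move: p2 pe p0; clear -p; case: p => [|[|[|[|p]]]].
have qe : ~~ odd q by apply: even_ps; apply: (@mem_rem _ p); rewrite remE inE eqxx.
have [e [x [e' [x' [ce ce' e'x ex']]]]] := sum_component2 charK iso1.
by case: (even_not_fin_gen2 charK rhoP ce ce' pe p0 qe e'x ex' fg).
Qed.

Theorem theorem3p8 (K : fieldType) (charK : [pchar K]%R =i pred0)
    (d : nat) (rho : SL2 K -> 'rV[K]_d -> 'rV[K]_d)
    (rhoP : linear_action rho) (ps : seq nat)
    (ps_neq0 : ps <> nseq (size ps) 0)
    (rho_iso : gm_iso (GModule rhoP) (sym_pow_sum K ps)) :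
  lie_fin_gen (free_metab_inv rho) <->
  (exists k : nat, gm_iso (GModule rhoP) (sym_pow_sum K (1 :: nseq k 0)))
  \/ gm_iso (GModule rhoP) (sym_pow K 2).
Proof.
split; first exact: sym_pow_sum_not_fin_gen ps_neq0 rho_iso.
exact: sym_pow_sum_fin_gen.
Qed.
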